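(* Let $\theta<0$ and $\rho\le 0$ be real numbers, let $(W_t)_{t\ge 0}$ be a standard Brownian motion, and let $(X_t)$, $(V_t)$ be the solution of $dX_t=\theta X_t\,dt+dV_t$, $dV_t=\rho V_t\,dt+dW_t$ with $X_0=V_0=0$. Let $\widehat\theta_T$ and $\widehat\rho_T$ be the estimators defined in the context. Then, almost surely, $$\lim_{T\to\infty}\widehat\theta_T=\theta^*\qquad\text{and}\qquad \lim_{T\to\infty}\widehat\rho_T=\rho^*,$$ where $$\theta^*=\theta+\rho\qquad\text{and}\qquad \rho^*=\frac{\theta\rho(\theta+\rho)}{(\theta+\rho)^2+\theta\rho}.$$
   Context: For $T>0$, the estimator of $\theta$ is $$\widehat\theta_T=\frac{\int_0^T X_t\,dX_t}{\int_0^T X_t^2\,dt}=\frac{X_T^2-T}{2\int_0^T X_t^2\,dt}.$$ Put $\Sigma_t=\int_0^t X_s\,ds$, and for $0\le t\le T$ define the residuals $\widehat V_t=X_t-\widehat\theta_T\,\Sigma_t$ (these depend on $T$ through $\widehat\theta_T$). The estimator of $\rho$ is $$\widehat\rho_T=\frac{\widehat V_T^2-T}{2\int_0^T\widehat V_t^2\,dt}.$$ *)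

(* Defs.v *)
From HB Require Import structures.
From mathcomp Require Import all_boot all_order all_algebra.
From mathcomp Require Import all_classical all_reals all_analysis.
Set Implicit Arguments.
Unset Strict Implicit.
Unset Printing Implicit Defensive.
Import Order.TTheory GRing.Theory Num.Theory.
Import numFieldNormedType.Exports.
Local Open Scope classical_set_scope.
Local Open Scope ring_scope.

Section Defs.
Context {d : measure_display} {Omega : measurableType d} {R : realType}.
Variable P : probability Omega R.

(* Taking A i = setT recovers the product rule for every subfamily. *)
Definition mutually_independent (n : nat) (Y : 'I_n -> Omega -> R) : Prop :=
  forall A : 'I_n -> set R, (forall i, measurable (A i)) ->
    P (\bigcap_(i in [set: 'I_n]) (Y i @^-1` A i)) =
    (\prod_(i < n) P (Y i @^-1` A i))%E.

(* Processes are indexed by R, but only times t >= 0 are ever constrained. *)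
Definition continuous_paths (X : R -> {RV P >-> R}) : Prop :=
  {ae P, forall w, {within `[0, +oo[, continuous (fun t => X t w)}}.

(* normal_prob takes a standard deviation, not a variance. *)
Definition brownian_motion (W : R -> {RV P >-> R}) : Prop :=
  [/\ {ae P, forall w, W 0 w = 0},
      forall (n : nat) (t : nat -> R), 0 <= t 0%N ->
        {homo t : i j / (i <= j)%N >-> i <= j} ->
        mutually_independent (fun i : 'I_n => W (t i.+1) \- W (t i)),
      forall s t : R, 0 <= s -> s < t ->
        forall A : set R, measurable A ->
        P ((W t \- W s) @^-1` A) = normal_prob 0 (Num.sqrt (t - s)) A
    & continuous_paths W].

Definition time_integral (f : R -> R) (t : R) : R :=
  \int[lebesgue_measure]_(s in `[0, t]) f s.

(* dY_t = a Y_t dt + dZ_t with Y_0 = 0.  The noise is additive, so no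
   stochastic integral occurs in the integrated equation. *)
Definition linear_sde_solution (a : R) (Z Y : R -> {RV P >-> R}) : Prop :=
  [/\ continuous_paths Y,
      {ae P, forall w, Y 0 w = 0}
    & {ae P, forall w, forall t : R, 0 <= t ->
        Y t w - Y 0 w =
          a * time_integral (fun s => Y s w) t + (Z t w - Z 0 w)}].

End Defs.

(* The estimators are functionals of a single path x of X. *)
Section Estimators.
Context {R : realType}.
Implicit Types (x : R -> R) (T t : R).

(* By Ito's formula, the numerator (x T ^+ 2 - T) / 2 is the value of the
   stochastic integral of X against itself over [0, T]. *)
Definition theta_hat x T : R :=
  (x T ^+ 2 - T) / (2 * time_integral (fun t => x t ^+ 2) T).

Definition V_hat x T t : R := x t - theta_hat x T * time_integral x t.

Definition rho_hat x T : R :=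
  (V_hat x T T ^+ 2 - T) / (2 * time_integral (fun t => V_hat x T t ^+ 2) T).

End Estimators.

(* Main.v *)
Require Import Defs.
From HB Require Import structures.
From mathcomp Require Import all_boot all_order all_algebra.
From mathcomp Require Import all_classical all_reals all_analysis.
From mathcomp Require Import measurable_realfun.
From mathcomp Require Import ring lra zify.

(** Both estimators are functionals of the path of [X], and no stochastic
    integral is needed: the noise is additive, so that [V] and the primitive [S]
    of [X] solve ordinary linear equations driven by the Brownian path,
    [V = rho * (primitive of V) + W], [S' = theta S + V], [X = theta S + V].

    Suppose [rho < 0]. If the long-time averages of [X ^ 2] and [S ^ 2] converge,
    to [a] and [b], and the endpoint values are [o(sqrt T)], then
    [theta_hat = (X_T ^ 2 - T) / (2 int X ^ 2)] tends to [- 1 / (2 a)]; and since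
    [2 int (S X) = S_T ^ 2], the energy of the residuals [X - theta_hat S] is
    asymptotically [(a + (theta + rho) ^ 2 b) T]. The values
    [a = - 1 / (2 (theta + rho))], [b = - 1 / (2 theta rho (theta + rho))] give
    the two limits.

    Apart from continuity, probability enters only through three almost sure
    properties of a Brownian path, collected in [brownian_like]: on every dyadic mesh the squared
    increments over [L] steps average to [L] times the mesh; the quadratic
    variations on [0, 2 ^ k], for all dyadic meshes at once, are at most
    [2 * 2 ^ k] for large [k]; and the oscillation on unit windows is
    [o(sqrt T)]. They follow from second and fourth moments of the increments
    and from the independence of pairs of increments, by variance bounds that
    are summable along suitable subsequences ([variance_sum_le],
    [ae_bounded_series], [ae_double_family], [has_mean_of_squares]).

    The rest is deterministic. By polarization, distinct increments are
    uncorrelated on average, which determines the second moments of the Euler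
    schemes of [V] and [S] on a mesh [h] ([ou_scheme], [filter_scheme]). By
    chaining, the quadratic variation bound says that [W] is at squared [L^2]
    distance [O(h T)] from its step approximation on [0, T] ([step_err_grid]),
    and the stability of the two linear equations transports this to [V], [S]
    and [X] ([step_err_filter]). Letting [h] tend to [0] yields [a] and [b]
    ([time_mean_approx]). The oscillation bound yields the endpoint values
    ([ou_endpoint]).

    If [rho = 0], then [V = W] and the residuals are close to [W], whose energy
    grows faster than [T] ([integral_sqr_superlinear]) and faster than [W_T ^ 2]
    ([endpoint_negligible]); hence the limit [0] of the second estimator. *)

Set Implicit Arguments.
Unset Strict Implicit.
Unset Printing Implicit Defensive.
Import Order.TTheory GRing.Theory Num.Theory.
Import numFieldNormedType.Exports.
Local Open Scope classical_set_scope.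
Local Open Scope ring_scope.

(** * Long-time averages of sequences *)

Section Means.
Variable R : realType.
Implicit Types (u v y c xi : nat -> R) (a z : R).

(** The property [o(n)], phrased without filters so that it passes through
    sums, shifts and recursions by elementary estimates. *)
Definition sublinear u := forall e : R, 0 < e ->
  exists K : R, forall n, `|u n| <= K + e * n%:R.

(** Cesaro convergence of [u] to [z]. *)
Definition has_mean u z := sublinear (fun n => \sum_(k < n) u k - n%:R * z).

Definition mean_bounded u :=
  exists K B : R, forall n, \sum_(k < n) u k <= K + B * n%:R.

Lemma eq_sublinear u v : u =1 v -> sublinear u -> sublinear v.
Proof. by move=> /funext ->. Qed.

Lemma sublinearD u v : sublinear u -> sublinear v ->
  sublinear (fun n => u n + v n).
Proof.
move=> hu hv e e0; have e2 : 0 < e / 2 by lra.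
have [K Ku] := hu _ e2; have [L Lv] := hv _ e2.
exists (K + L) => n; have := ler_normD (u n) (v n).
by have := Ku n; have := Lv n; lra.
Qed.

Lemma sublinearZ a u : sublinear u -> sublinear (fun n => a * u n).
Proof.
move=> hu e e0; have a1 : 0 < `|a| + 1 by rewrite ltr_pwDr.
have [K Ku] := hu _ (divr_gt0 e0 a1).
exists (`|a| * K) => n; rewrite normrM.
apply: (@le_trans _ _ (`|a| * (K + e / (`|a| + 1) * n%:R))).
  by rewrite ler_wpM2l.
rewrite mulrDr lerD2l mulrA ler_wpM2r// mulrCA ger_pMr//.
by rewrite ler_pdivrMr// mul1r lerDl.
Qed.

Lemma sublinear_shift u : sublinear u -> sublinear (fun n => u n.+1).
Proof.
move=> hu e e0; have [K Ku] := hu _ e0.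
exists (K + e) => n; apply: (le_trans (Ku _)).
by rewrite -addn1 natrD; lra.
Qed.

Lemma sublinear_cst a : sublinear (fun=> a).
Proof. by move=> e e0; exists `|a| => n; rewrite lerDl mulr_ge0// ltW. Qed.

Lemma eq_has_mean u v z : u =1 v -> has_mean u z -> has_mean v z.
Proof. by move=> /funext ->. Qed.

Lemma has_meanD u v z z' : has_mean u z -> has_mean v z' ->
  has_mean (fun k => u k + v k) (z + z').
Proof.
move=> hu hv; apply: eq_sublinear (sublinearD hu hv) => n /=.
by rewrite big_split/=; ring.
Qed.

Lemma has_meanZ a u z : has_mean u z -> has_mean (fun k => a * u k) (a * z).
Proof.
move=> hu; apply: eq_sublinear (sublinearZ a hu) => n /=.
by rewrite -mulr_sumr; ring.
Qed.

Lemma has_mean0 : has_mean (fun=> 0) 0.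
Proof.
by apply: eq_sublinear (sublinear_cst 0) => n; rewrite big1_eq mulr0 subr0.
Qed.

Lemma has_mean_shift u z : has_mean u z -> has_mean (fun k => u k.+1) z.
Proof.
move=> hu; have h := sublinearD (sublinear_shift hu) (sublinear_cst (z - u 0%N)).
apply: eq_sublinear h => n /=.
by rewrite big_ord_recl/= -natr1; ring.
Qed.

Lemma has_mean_shiftn u z l : has_mean u z -> has_mean (fun k => u (k + l)%N) z.
Proof.
elim: l => [|l IH] hu; first by apply: eq_has_mean hu => k; rewrite addn0.
by apply: eq_has_mean (has_mean_shift (IH hu)) => k; rewrite addnS.
Qed.

Lemma has_mean_bounded u z : has_mean u z -> mean_bounded u.
Proof.
move=> hu; have [K hK] := hu _ ltr01; exists K, (1 + z) => n.
by have := hK n; rewrite ler_norml => /andP[_]; lra.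
Qed.

(** Through a contraction the past is only seen as a geometric series, so an
    [o(n)] forcing produces an [o(n)] solution. *)
Lemma sublinear_contraction a u v : 0 <= a < 1 ->
  (forall n, `|u n.+1| <= a * `|u n| + v n) -> sublinear v -> sublinear u.
Proof.
move=> /andP[a0 a1] huv hv e e0.
have ea : 0 < e * (1 - a) by rewrite mulr_gt0// subr_gt0.
have [K hK] := hv _ ea.
pose K' := Num.max `|u 0%N| (K / (1 - a)).
have K'1 : `|u 0%N| <= K' by rewrite le_max lexx.
have K'2 : K <= K' * (1 - a) by rewrite -ler_pdivrMr ?subr_gt0// le_max lexx orbT.
exists K'; elim=> [|n IH]; first by rewrite mulr0 addr0.
apply: (le_trans (huv n)).
have := hK n; rewrite ler_norml => /andP[_ hKn].
have := ler_wpM2l a0 IH.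
rewrite -natr1; lra.
Qed.

(** Averaging the recursion gives [mean u = a * mean u + z] up to boundary
    terms; [sublinear_contraction] shows that these are negligible. *)
Lemma has_mean_rec a u c z : 0 <= a < 1 ->
  (forall n, u n.+1 = a * u n + c n) -> has_mean c z ->
  has_mean u (z / (1 - a)).
Proof.
move=> a01 huc hc; have a1 : 1 - a != 0 by lra.
set b := z / (1 - a); have zb : z = b * (1 - a) by rewrite divfK.
pose p n := \sum_(k < n) u k - n%:R * b.
pose q n := `|(\sum_(k < n) c k - n%:R * z) + (u 0%N - b)|.
apply: (@sublinear_contraction a p q) => //.
  move=> n; rewrite /q.
  have -> : p n.+1 = a * p n + (\sum_(k < n) c k - n%:R * z + (u 0%N - b)).
    rewrite /p big_ord_recl/=.
    under eq_bigr do rewrite /bump/= add1n huc.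
    by rewrite big_split/= -mulr_sumr zb -natr1; ring.
  apply: (le_trans (ler_normD _ _)).
  by rewrite normrM (ger0_norm (proj1 (andP a01))).
have h := sublinearD hc (sublinear_cst (u 0%N - b)).
by move=> e e0; have [K hK] := h e e0; exists K => n; rewrite normr_id.
Qed.

(** Convexity of the square: [a x + e] is the convex combination of [x] and
    [e / (1 - a)] with weights [a] and [1 - a]. *)
Lemma contraction_sqr a (x e : R) : 0 <= a < 1 ->
  (a * x + e) ^+ 2 <= a * x ^+ 2 + e ^+ 2 / (1 - a).
Proof.
move=> /andP[a0 a1]; have b0 : 0 < 1 - a by lra.
have -> : e = (1 - a) * (e / (1 - a)) by field; lra.
set f := e / (1 - a).
have -> : ((1 - a) * f) ^+ 2 / (1 - a) = (1 - a) * f ^+ 2 by field; lra.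
have : 0 <= a * (1 - a) * (x - f) ^+ 2 by rewrite mulr_ge0 ?sqr_ge0 ?mulr_ge0// ltW.
lra.
Qed.

Lemma sum_sqr_contraction a u c n : 0 <= a < 1 ->
  (forall n, u n.+1 = a * u n + c n) ->
  (1 - a) * \sum_(k < n) u k ^+ 2 <= u 0%N ^+ 2 + \sum_(k < n) c k ^+ 2 / (1 - a).
Proof.
move=> a01 huc.
suff : (1 - a) * \sum_(k < n) u k ^+ 2 + u n ^+ 2
    <= u 0%N ^+ 2 + \sum_(k < n) c k ^+ 2 / (1 - a).
  by have := sqr_ge0 (u n); lra.
elim: n => [|n IH]; first by rewrite !big_ord0; lra.
rewrite !big_ord_recr/= huc; have := contraction_sqr (u n) (c n) a01; lra.
Qed.

Lemma mean_bounded_contraction a u c : 0 <= a < 1 ->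
  (forall n, u n.+1 = a * u n + c n) ->
  mean_bounded (fun k => c k ^+ 2) -> mean_bounded (fun k => u k ^+ 2).
Proof.
move=> a01 huc [K [B hc]]; have a1 : 0 < 1 - a by lra.
exists ((u 0%N ^+ 2 + K / (1 - a)) / (1 - a)), (B / (1 - a) / (1 - a)) => n.
have := sum_sqr_contraction n a01 huc; rewrite -mulr_suml => h.
rewrite mulrAC -mulrDl ler_pdivlMr// mulrC; apply: (le_trans h).
by rewrite -addrA lerD2l mulrAC -mulrDl ler_pM2r// invr_gt0.
Qed.

(** A solution [y] of a contracting recursion is uncorrelated with the future
    of [xi] as soon as its input is: unrolling the recursion [N] times leaves
    [N] uncorrelated terms and a remainder that carries the factor [a ^ N],
    times a correlation that the mean squares bound uniformly in the lag. *)
Lemma has_mean_decorrelate a y c xi z : 0 <= a < 1 ->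
  (forall n, y n.+1 = a * y n + c n) ->
  mean_bounded (fun k => y k ^+ 2) -> has_mean (fun k => xi k ^+ 2) z ->
  (forall l, has_mean (fun k => c k * xi (k + l.+1)%N) 0) ->
  forall l, has_mean (fun k => y k * xi (k + l)%N) 0.
Proof.
move=> a01 hyc [Ky [By hy]] hxi hcxi.
have /andP[a0 a1] := a01.
pose G l n := \sum_(k < n) y k * xi (k + l)%N.
have [B B0 hG] : exists2 B, 0 <= B &
    forall l, exists K, forall n, `|G l n| <= K + B * n%:R.
  exists (`|By| + `|z| + 1) => [|l]; first by rewrite !addr_ge0.
  have [K hK] := has_mean_shiftn l hxi ltr01.
  exists (`|Ky| + `|K|) => n.
  apply: (@le_trans _ _ (\sum_(k < n) (y k ^+ 2 + xi (k + l)%N ^+ 2))).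
    apply: (le_trans (ler_norm_sum _ _ _)); apply: ler_sum => k _.
    set p := y k; set q := xi _; rewrite ler_norml; apply/andP; split.
      by have := sqr_ge0 (p + q); have := sqr_ge0 p; have := sqr_ge0 q; lra.
    by have := sqr_ge0 (p - q); have := sqr_ge0 p; have := sqr_ge0 q; lra.
  rewrite big_split/=.
  have := hK n; rewrite ler_norml => /andP[_ h1].
  have h2 := hy n; have h3 := ler_norm Ky; have h4 := ler_norm K.
  have h5 : By * n%:R <= `|By| * n%:R by rewrite ler_wpM2r// ler_norm.
  have h6 : n%:R * z <= `|z| * n%:R by rewrite mulrC ler_wpM2r// ler_norm.
  lra.
have key N l e : 0 < e -> exists K, forall n, `|G l n| <= K + (a ^+ N * B + e) * n%:R.
  elim: N l e => [|N IH] l e e0.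
    have [K hK] := hG l; exists K => n; apply: (le_trans (hK n)).
    by rewrite expr0 lerD2l ler_wpM2r// mul1r lerDl ltW.
  have e2 : 0 < e / 2 by lra.
  have [K hK] := IH l.+1 _ e2; have [K' hK'] := hcxi l _ e2.
  have K0 : 0 <= K by have := hK 0%N; rewrite /G big_ord0 normr0 mulr0 addr0.
  have K'0 : 0 <= K' by have := hK' 0%N; rewrite big_ord0 mul0r subr0 normr0 mulr0 addr0.
  have q0 : 0 <= a ^+ N.+1 * B + e by rewrite addr_ge0 ?mulr_ge0 ?exprn_ge0// ltW.
  exists (`|y 0%N * xi l| + K + K') => -[|n].
    by rewrite /G big_ord0 normr0 mulr0 addr0 !addr_ge0.
  have -> : G l n.+1 = y 0%N * xi l + (a * G l.+1 n +
      (\sum_(k < n) c k * xi (k + l.+1)%N - n%:R * 0)).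
    rewrite /G big_ord_recl/= add0n; congr (_ + _).
    rewrite mulr0 subr0 mulr_sumr -big_split/=; apply: eq_bigr => k _.
    by rewrite /bump/= add1n hyc addSnnS; ring.
  apply: (le_trans (ler_normD _ _)); rewrite -!addrA lerD2l.
  apply: (le_trans (ler_normD _ _)); rewrite normrM (ger0_norm a0).
  have h1 := ler_wpM2l a0 (hK n).
  have h2 := hK' n.
  have h3 : a * K <= K by rewrite ler_piMl// ltW.
  have h4 : a * (e / 2) * n%:R <= e / 2 * n%:R by rewrite ler_wpM2r// ger_pMl//; lra.
  have h5 : (a ^+ N.+1 * B + e) * n%:R <= (a ^+ N.+1 * B + e) * n.+1%:R.
    by rewrite ler_wpM2l// ler_nat.
  rewrite exprS in h5 *.
  lra.
move=> l e e0; have [N hN] : exists N, a ^+ N * B <= e / 2.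
  have : a ^+ n * B @[n --> \oo] --> 0 * B.
    by apply: cvgMl; apply: cvg_expr; rewrite ger0_norm.
  rewrite mul0r => /cvgrPdist_le /(_ (e / 2)) /= [|N _ /(_ N (leqnn N))].
    by lra.
  rewrite sub0r normrN => h; exists N; apply: le_trans h; exact: ler_norm.
have [|K hK] := key N l (e / 2); first by lra.
exists K => n; rewrite mulr0 subr0; apply: (le_trans (hK n)).
by rewrite lerD2l ler_wpM2r//; lra.
Qed.

(** Polarization: the product of two increments is half a second difference
    of [L |-> (w (k + L) - w k) ^ 2], and [L |-> L * h] is affine, so distinct
    increments are uncorrelated on average. *)
Lemma has_mean_increments (w : nat -> R) h :
  (forall L, has_mean (fun k => (w (k + L)%N - w k) ^+ 2) (L%:R * h)) ->
  forall l, has_mean (fun k => (w k.+1 - w k) * (w (k + l).+2 - w (k + l).+1)) 0.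
Proof.
move=> hS l.
have h1 := hS l.+2; have h2 := has_mean_shift (hS l).
have h3 := has_meanZ (-1) (has_mean_shift (hS l.+1)); have h4 := has_meanZ (-1) (hS l.+1).
have := has_meanZ (2^-1) (has_meanD (has_meanD h1 h2) (has_meanD h3 h4)).
rewrite (_ : _ * _ = 0); last by rewrite -(natr1 l.+1) -(natr1 l); ring.
apply: eq_has_mean => k /=; rewrite !addnS !addSn.
by lra.
Qed.

End Means.

(** * Stationary moments of the Euler schemes *)

Section Schemes.
Variable R : realType.
Implicit Types (xi d s : nat -> R).

(** In the square of the recursion, [a ^ 2 d ^ 2 + 2 a d xi + xi ^ 2], the cross
    term averages to zero by decorrelation. *)
Lemma ou_scheme a h xi d : 0 <= a < 1 ->
  (forall k, d k.+1 = a * d k + xi k) ->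
  has_mean (fun k => xi k ^+ 2) h ->
  (forall l, has_mean (fun k => xi k * xi (k + l.+1)%N) 0) ->
  [/\ mean_bounded (fun k => d k ^+ 2),
      forall l, has_mean (fun k => d k * xi (k + l)%N) 0 &
      has_mean (fun k => d k ^+ 2) (h / (1 - a ^+ 2))].
Proof.
move=> a01 hd hxi hxixi.
have b : mean_bounded (fun k => d k ^+ 2).
  exact: mean_bounded_contraction a01 hd (has_mean_bounded hxi).
have D := has_mean_decorrelate a01 hd b hxi hxixi.
split => //.
have a2 : 0 <= a ^+ 2 < 1 by rewrite sqr_ge0/= expr_lt1//; case/andP: a01.
apply: (has_mean_rec (c := fun k => (2 * a) * (d k * xi (k + 0)%N) + xi k ^+ 2) a2).
  by move=> k; rewrite hd addn0; ring.
rewrite -[h]add0r -(mulr0 (2 * a)).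
by apply: has_meanD => //; apply: has_meanZ.
Qed.

(** The same squaring argument for a second filter fed by the first one: the
    mixed moment comes first, then the second moment of [s]. *)
Lemma filter_scheme a b h c xi d s : 0 <= a < 1 -> 0 <= b < 1 ->
  (forall k, d k.+1 = a * d k + xi k) ->
  (forall k, s k.+1 = b * s k + h * d k) ->
  has_mean (fun k => xi k ^+ 2) h ->
  has_mean (fun k => d k ^+ 2) c ->
  (forall l, has_mean (fun k => d k * xi (k + l)%N) 0) ->
  let csd := h * a * c / (1 - a * b) in
  has_mean (fun k => s k * d k) csd /\
  has_mean (fun k => s k ^+ 2) ((2 * b * h * csd + h ^+ 2 * c) / (1 - b ^+ 2)).
Proof.
move=> a01 b01 hd hs hxi hd2 hdxi csd.
have hhd : has_mean (fun k => (h * d k) ^+ 2) (h ^+ 2 * c).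
  by apply: eq_has_mean (has_meanZ (h ^+ 2) hd2) => k /=; rewrite exprMn.
have bs : mean_bounded (fun k => s k ^+ 2).
  exact: mean_bounded_contraction b01 hs (has_mean_bounded hhd).
have D : has_mean (fun k => s k * xi (k + 0)%N) 0.
  apply: (has_mean_decorrelate b01 hs bs hxi) => l.
  rewrite -(mulr0 h); apply: eq_has_mean (has_meanZ h (hdxi l.+1)) => k /=.
  by rewrite mulrA.
have hsd : has_mean (fun k => s k * d k) csd.
  have ab : 0 <= a * b < 1.
    have /andP[a0 a1] := a01; have /andP[b0 b1] := b01.
    by rewrite mulr_ge0//= mulr_ilt1.
  apply: (has_mean_rec (c := fun k => b * (s k * xi (k + 0)%N) + (h * a * d k ^+ 2
     + h * (d k * xi (k + 0)%N))) ab).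
    by move=> k; rewrite hs hd addn0; ring.
  rewrite -[X in has_mean _ X]addr0 addrC -{1}(mulr0 b).
  apply: has_meanD; first exact: has_meanZ.
  rewrite -[h * a * c]addr0 -(mulr0 h).
  by apply: has_meanD; exact: has_meanZ.
split => //.
have b2 : 0 <= b ^+ 2 < 1 by rewrite sqr_ge0/= expr_lt1//; case/andP: b01.
apply: (has_mean_rec (c := fun k => 2 * b * h * (s k * d k) + h ^+ 2 * d k ^+ 2) b2).
  by move=> k; rewrite hs; ring.
by apply: has_meanD; exact: has_meanZ.
Qed.

End Schemes.

(** * Integrals of continuous functions *)

Section ContinuousIntegral.
Variable R : realType.
Implicit Types (f g : R -> R) (a b c : R).
Local Notation mu := (@lebesgue_measure R).

Definition integral_on f a b : R := \int[mu]_(s in `[a, b]) f s.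

Lemma continuous_integrable f a b : continuous f ->
  mu.-integrable `[a, b] (EFin \o f).
Proof.
move=> cf; apply: continuous_compact_integrable; first exact: segment_compact.
exact: continuous_subspaceT.
Qed.

Lemma integral_onD f g a b : continuous f -> continuous g ->
  integral_on (fun x => f x + g x) a b = integral_on f a b + integral_on g a b.
Proof. by move=> cf cg; rewrite /integral_on RintegralD//; exact: continuous_integrable. Qed.

Lemma integral_onZ k f a b : continuous f ->
  integral_on (fun x => k * f x) a b = k * integral_on f a b.
Proof. by move=> cf; rewrite /integral_on RintegralZl//; exact: continuous_integrable. Qed.

Lemma integral_on_cst k a b : a <= b -> integral_on (fun=> k) a b = k * (b - a).
Proof.
move=> ab; rewrite /integral_on Rintegral_cst//= lebesgue_measure_itv/=.
case: ifPn => [_//|]; rewrite lte_fin -leNgt => ba.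
by rewrite (@le_anti _ _ a b) ?ab//= subrr.
Qed.

Lemma le_integral_on f g a b : continuous f -> continuous g ->
  (forall x, a <= x <= b -> f x <= g x) -> integral_on f a b <= integral_on g a b.
Proof.
move=> cf cg fg; apply: le_Rintegral => //; try exact: continuous_integrable.
Qed.

Lemma integral_on_ge0 f a b : (forall x, 0 <= f x) -> 0 <= integral_on f a b.
Proof. by move=> f0; apply: Rintegral_ge0. Qed.

Lemma eq_integral_on f g a b : (forall x, a <= x <= b -> f x = g x) ->
  integral_on f a b = integral_on g a b.
Proof.
by move=> fg; apply: eq_Rintegral => x; rewrite inE/= in_itv/=; exact: fg.
Qed.

Lemma integral_on_cat f a b c : continuous f -> a <= b -> b <= c ->
  integral_on f a c = integral_on f a b + integral_on f b c.
Proof.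
move=> cf ab bc; rewrite /integral_on.
rewrite -[\int[mu]_(s in `[b, c]) f s]Rintegral_itv_obnd_cbnd; last first.
  apply: integrableS (continuous_integrable b c cf) => //.
  exact: subset_itv_oc_cc.
rewrite -(@Rintegral_itvB _ f (BLeft a) (BRight c) b)//.
- by rewrite addrC subrK.
- exact: continuous_integrable.
Qed.

Lemma integral_on_point f a : integral_on f a a = 0.
Proof. by rewrite /integral_on set_itv1 Rintegral_set1. Qed.

Lemma ger_integral_on f a b c : continuous f -> (forall x, 0 <= f x) ->
  b <= c -> integral_on f a b <= integral_on f a c.
Proof.
move=> cf f0 bc; have [ab|ba] := leP a b; last first.
  rewrite [leLHS]/integral_on set_itv_ge ?Rintegral_set0 ?integral_on_ge0//.
  by rewrite bnd_simp -ltNge.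
by rewrite (integral_on_cat cf ab bc) lerDl integral_on_ge0.
Qed.

Lemma ltr_subl_integral_on f a b c : continuous f -> (forall x, 0 <= f x) ->
  a <= b -> b <= c -> integral_on f b c <= integral_on f a c.
Proof.
by move=> cf f0 ab bc; rewrite (integral_on_cat cf ab bc) lerDr integral_on_ge0.
Qed.

Lemma continuous_sqr f : continuous f -> continuous (fun x => f x ^+ 2).
Proof. by move=> cf x; apply: (cvg_comp f (fun y => y ^+ 2)); [exact: cf|exact: exprn_continuous]. Qed.

Lemma continuousDf f g : continuous f -> continuous g -> continuous (fun x => f x + g x).
Proof. by move=> cf cg x; apply: cvgD; [exact: cf|exact: cg]. Qed.

Lemma continuousZf k f : continuous f -> continuous (fun x => k * f x).
Proof. by move=> cf x; apply: cvgM; [exact: cvg_cst|exact: cf]. Qed.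

Lemma continuousMf f g : continuous f -> continuous g -> continuous (fun x => f x * g x).
Proof. by move=> cf cg x; apply: cvgM; [exact: cf|exact: cg]. Qed.

Lemma continuous_cstf (k : R) : continuous (fun _ : R => k).
Proof. by move=> x; exact: cvg_cst. Qed.

Lemma continuousBf f g : continuous f -> continuous g -> continuous (fun x => f x - g x).
Proof. by move=> cf cg x; apply: cvgB; [exact: cf|exact: cg]. Qed.

(** Cauchy-Schwarz against the constant function [1]: the variance of [f] on
    [a, b] is nonnegative. *)
Lemma sqr_integral_on f a b : continuous f -> a <= b ->
  integral_on f a b ^+ 2 <= (b - a) * integral_on (fun x => f x ^+ 2) a b.
Proof.
move=> cf; rewrite le_eqVlt => /predU1P[<-|ab].
  by rewrite integral_on_point subrr mul0r expr0n.
set I := integral_on f a b; set J := integral_on _ a b.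
have ba : 0 < b - a by rewrite subr_gt0.
pose m := I / (b - a).
have mE : I = m * (b - a) by rewrite divfK// gt_eqF.
have : 0 <= integral_on (fun x => (f x - m) ^+ 2) a b.
  by apply: integral_on_ge0 => x; exact: sqr_ge0.
have -> : integral_on (fun x => (f x - m) ^+ 2) a b = J - m ^+ 2 * (b - a).
  rewrite (@eq_integral_on _ (fun x => f x ^+ 2 + (- (2 * m) * f x + m ^+ 2))).
    rewrite integral_onD; first 1 last.
    - exact: continuous_sqr.
    - by apply: continuousDf; [exact: continuousZf|exact: continuous_cstf].
    rewrite integral_onD; [|exact: continuousZf|exact: continuous_cstf].
    rewrite integral_onZ// integral_on_cst ?ltW// -/I -/J mE; ring.
  by move=> x _; ring.
rewrite subr_ge0 => h.
have := ler_wpM2l (ltW ba) h; rewrite mE; lra.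
Qed.

(** Paths are only controlled at nonnegative times; freezing them before time
    [0] gives functions that are continuous on the whole line. *)
Lemma continuous_max0 f : {within `[0, +oo[, continuous f} ->
  continuous (fun t : R => f (Num.max 0 t)).
Proof.
move=> /continuous_within_itvcyP[cf f0] x.
apply/cvgrPdist_lt => e e0.
have [x0|x0|x0] := ltgtP x 0.
- near=> y; have y0 : y < 0 by near: y; exact: lt_nbhsl.
  by rewrite !max_l ?(ltW y0) ?(ltW x0)// subrr normr0.
- have cx : f y @[y --> x] --> f x by apply: cf; rewrite in_itv/= x0.
  move/cvgrPdist_lt : cx => /(_ e e0) h.
  near=> y; have y0 : 0 < y by near: y; exact: lt_nbhsr.
  by rewrite !max_r ?(ltW y0) ?(ltW x0)//; near: y.
- rewrite x0.
  move/cvgrPdist_lt : f0 => /(_ e e0); rewrite near_withinE => h.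
  near=> y; have [y0|y0] := leP y 0.
    by rewrite subrr normr0.
  suff : 0 < y -> `|f 0 - f y| < e by apply.
  by near: y.
Unshelve. all: by end_near. Qed.

Lemma integral_on_max0 f a : integral_on f 0 (Num.max 0 a) = integral_on f 0 a.
Proof.
have [//|a0] := leP 0 a.
rewrite integral_on_point /integral_on set_itv_ge ?Rintegral_set0//.
by rewrite bnd_simp -ltNge.
Qed.

Lemma continuous_integral_on f : continuous f -> continuous (integral_on f 0).
Proof.
move=> cf.
suff /continuous_max0 h : {within `[0, +oo[, continuous (integral_on f 0)}.
  have E : (fun t : R => integral_on f 0 (Num.max 0 t)) = integral_on f 0.
    by apply/funext => t; rewrite integral_on_max0.
  by rewrite -E.
apply/continuous_within_itvcyP.
have hb b : 0 < b -> {within `[0, b], continuous (integral_on f 0)}.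
  move=> b0; apply: parameterized_integral_continuous; first exact: ltW.
  exact: continuous_integrable.
split.
  move=> x; rewrite in_itv/= andbT => x0.
  have x1 : 0 < x + 1 by rewrite addr_gt0.
  have /(continuous_within_itvP _ x1)[h _ _] := hb _ x1.
  by apply: h; rewrite in_itv/= x0 ltrDl ltr01.
by have /(continuous_within_itvP _ ltr01)[_ h _] := hb _ ltr01.
Qed.

(** The chain rule for the square of a primitive. *)
Lemma sqr_primitive f T : continuous f -> 0 <= T ->
  integral_on f 0 T ^+ 2 = 2 * integral_on (fun t => integral_on f 0 t * f t) 0 T.
Proof.
move=> cf; rewrite le_eqVlt => /predU1P[<-|T0].
  by rewrite !integral_on_point expr0n mulr0.
have cF := continuous_integral_on cf.
have dF (x : R) : 0 < x -> is_derive x 1 (integral_on f 0) (f x).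
  move=> x0; have [] := @continuous_FTC1_closed _ f 0 x (x + 1) _ (continuous_integrable _ _ cf) x0 (cf x).
    by rewrite ltrDl.
  by rewrite derive1E => d1 d2; exact: DeriveDef.
have dG (x : R) : 0 < x -> is_derive x 1 (fun t => integral_on f 0 t ^+ 2)
    (2 * (integral_on f 0 x * f x)).
  move=> x0; have := dF _ x0 => d.
  have -> : (fun t => integral_on f 0 t ^+ 2) = integral_on f 0 * integral_on f 0.
    by apply/funext => t; rewrite expr2.
  by apply: is_derive_eq (is_deriveM d d) _; rewrite /GRing.scale/=; ring.
have cG : continuous (fun t => integral_on f 0 t ^+ 2) by exact: continuous_sqr.
have := @continuous_FTC2 _ (fun t => 2 * (integral_on f 0 t * f t)) (fun t => integral_on f 0 t ^+ 2) 0 T T0.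
rewrite -EFinB integral_on_point expr0n subr0 => /(_ _ _ _)/(congr1 fine) /= <-.
- by rewrite -integral_onZ//; exact: continuousMf.
- by apply: continuous_subspaceT; apply: continuousZf; exact: continuousMf.
- split.
  + by move=> x; rewrite in_itv/= => /andP[x0 _]; have [] := dG _ x0.
  + exact/cvg_at_right_filter/cG.
  + exact/cvg_at_left_filter/cG.
- move=> x; rewrite in_itv/= => /andP[x0 _]; rewrite derive1E.
  by have [_ ->] := dG _ x0.
Qed.

End ContinuousIntegral.

(** * Distance between a path and a step function *)

Section StepErr.
Variable R : realType.
Implicit Types (F Y : R -> R) (f y : nat -> R) (h : R).

(** The squared [L^2] distance on [0, n h] between [F] and the step function
    equal to [f k] on the [k]-th cell of length [h]. Working with sums over
    cells keeps every integrand continuous. *)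
Definition step_err F f h n : R :=
  \sum_(k < n) integral_on (fun t => (F t - f k) ^+ 2) (k%:R * h) (k.+1%:R * h).

Lemma cell_le h k : 0 < h -> k%:R * h <= k.+1%:R * h.
Proof. by move=> h0; rewrite ler_pM2r// ler_nat. Qed.

Lemma cell_len h k : k.+1%:R * h - k%:R * h = h.
Proof. by rewrite -natr1; ring. Qed.

Lemma sum_cells F h n : 0 < h -> continuous F ->
  \sum_(k < n) integral_on F (k%:R * h) (k.+1%:R * h) = integral_on F 0 (n%:R * h).
Proof.
move=> h0 cF; elim: n => [|n IH].
  by rewrite big_ord0 mul0r integral_on_point.
rewrite big_ord_recr/= IH -integral_on_cat//; last exact: cell_le.
by rewrite mulr_ge0// ltW.
Qed.

Lemma step_err_ge0 F f h n : 0 <= step_err F f h n.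
Proof. by apply: sumr_ge0 => k _; apply: integral_on_ge0 => x; exact: sqr_ge0. Qed.

Lemma cont_sqrB F k : continuous F -> continuous (fun t => (F t - k) ^+ 2).
Proof. by move=> cF; apply: continuous_sqr; apply: continuousBf => //; exact: continuous_cstf. Qed.

Lemma step_err_nondecreasing F f h n p : (n <= p)%N ->
  step_err F f h n <= step_err F f h p.
Proof.
move=> /subnKC <-; elim: (p - n)%N => [|j IH]; first by rewrite addn0.
rewrite addnS; apply: (le_trans IH); rewrite /step_err big_ord_recr/= lerDl.
by apply: integral_on_ge0 => x; exact: sqr_ge0.
Qed.

(** Young's inequality applied to the cross term of [z = x + (z - x)]. *)
Lemma sqr_perturb (d x z : R) : 0 < d ->
  `|z ^+ 2 - x ^+ 2| <= d * x ^+ 2 + (1 + d^-1) * (z - x) ^+ 2.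
Proof.
move=> d0; have -> : z ^+ 2 - x ^+ 2 = (z - x) ^+ 2 + 2 * x * (z - x) by ring.
set r := z - x; rewrite ler_norml; apply/andP; split.
  have : 0 <= d * (x + d^-1 * r) ^+ 2 by rewrite mulr_ge0 ?sqr_ge0// ltW.
  have -> : d * (x + d^-1 * r) ^+ 2 = d * x ^+ 2 + 2 * x * r + d^-1 * r ^+ 2 by field; lra.
  by have := sqr_ge0 r; lra.
have : 0 <= d * (x - d^-1 * r) ^+ 2 by rewrite mulr_ge0 ?sqr_ge0// ltW.
have -> : d * (x - d^-1 * r) ^+ 2 = d * x ^+ 2 - 2 * x * r + d^-1 * r ^+ 2 by field; lra.
lra.
Qed.

Lemma step_err_mean F f h n (d : R) : 0 < h -> 0 < d -> continuous F ->
  `|integral_on (fun t => F t ^+ 2) 0 (n%:R * h) - h * \sum_(k < n) f k ^+ 2| <=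
  d * (h * \sum_(k < n) f k ^+ 2) + (1 + d^-1) * step_err F f h n.
Proof.
move=> h0 d0 cF; rewrite -sum_cells//; last exact: continuous_sqr.
rewrite !mulr_sumr -sumrB -big_split/=; apply: (le_trans (ler_norm_sum _ _ _)).
apply: ler_sum => k _; set a := k%:R * h; set b := k.+1%:R * h.
have ab : a <= b by exact: cell_le.
have lab : b - a = h by exact: cell_len.
have cF2 := continuous_sqr cF.
have cE := @cont_sqrB F (f k) cF.
have d1 : 0 <= 1 + d^-1 by rewrite addr_ge0// invr_ge0 ltW.
have up : integral_on (fun t => F t ^+ 2) a b <=
    integral_on (fun t => (1 + d) * f k ^+ 2 + (1 + d^-1) * (F t - f k) ^+ 2) a b.
  apply: le_integral_on => //.
    by apply: continuousDf; [exact: continuous_cstf|exact: continuousZf].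
  move=> x _; have := sqr_perturb (f k) (F x) d0; rewrite ler_norml => /andP[_]; lra.
have lo : integral_on (fun t => (1 - d) * f k ^+ 2 + (- (1 + d^-1)) * (F t - f k) ^+ 2) a b
    <= integral_on (fun t => F t ^+ 2) a b.
  apply: le_integral_on => //.
    by apply: continuousDf; [exact: continuous_cstf|exact: continuousZf].
  move=> x _; have := sqr_perturb (f k) (F x) d0; rewrite ler_norml => /andP[]; lra.
rewrite integral_onD in up; [|exact: continuous_cstf|exact: continuousZf].
rewrite integral_on_cst// integral_onZ// lab in up.
rewrite integral_onD in lo; [|exact: continuous_cstf|exact: continuousZf].
rewrite integral_on_cst// integral_onZ// lab in lo.
by rewrite ler_norml; apply/andP; split; lra.
Qed.

Lemma step_err_lin F Y f y (a b : R) h n : 0 < h -> continuous F -> continuous Y ->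
  step_err (fun t => a * F t + b * Y t) (fun k => a * f k + b * y k) h n <=
  2 * a ^+ 2 * step_err F f h n + 2 * b ^+ 2 * step_err Y y h n.
Proof.
move=> h0 cF cY; rewrite !mulr_sumr -big_split/=; apply: ler_sum => k _.
have cE := @cont_sqrB F (f k) cF; have cE' := @cont_sqrB Y (y k) cY.
rewrite -!integral_onZ// -integral_onD; [|exact: continuousZf|exact: continuousZf].
apply: le_integral_on => [| |x _].
- by apply: cont_sqrB; apply: continuousDf; exact: continuousZf.
- by apply: continuousDf; exact: continuousZf.
have := sqr_ge0 (a * (F x - f k) - b * (Y x - y k)); lra.
Qed.

(** Stability of the Euler scheme of [Y' = lam Y + F]. The errors [q k] at the
    grid points satisfy a recursion with contraction factor [1 + lam h]; since
    [1 - (1 + lam h)] is of order [h], their sum of squares is controlled by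
    [sum_sqr_contraction], and the oscillation of [Y] inside a cell is
    controlled by the square integral of its derivative. The latter is compared
    with the derivative of the scheme, and the term in the error that this
    comparison produces is absorbed because [h] is small. *)
Lemma step_err_filter (lam h : R) F Y f y n :
  lam < 0 -> 0 < h -> 48 * (lam * h) ^+ 2 <= 1 ->
  continuous F -> continuous Y ->
  (forall t, 0 <= t -> Y t = integral_on (fun s => lam * Y s + F s) 0 t) ->
  y 0%N = 0 -> (forall k, y k.+1 = (1 + lam * h) * y k + h * f k) ->
  step_err Y y h n <= 24 * h ^+ 2 * (h * \sum_(k < n) (lam * y k + f k) ^+ 2) +
    (48 * h ^+ 2 + 8 * lam ^- 2) * step_err F f h n.
Proof.
move=> lam0 h0 hs cF cY hY y0 hy.
pose D t := lam * Y t + F t; pose d k := lam * y k + f k.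
have cD : continuous D by apply: continuousDf => //; exact: continuousZf.
have cD2 := continuous_sqr cD.
pose I g k := integral_on g (k%:R * h) (k.+1%:R * h).
pose q k := Y (k%:R * h) - y k.
pose D2 k := I (fun t => D t ^+ 2) k.
pose E k := I (fun t => (Y t - y k) ^+ 2) k.
pose Phi k := I (fun t => (F t - f k) ^+ 2) k.
have cle k := cell_le k h0.
have k0 k : 0 <= k%:R * h by rewrite mulr_ge0// ltW.
have hY2 k t : k%:R * h <= t <= k.+1%:R * h ->
    Y t - Y (k%:R * h) = integral_on D (k%:R * h) t.
  move=> /andP[kt tk]; rewrite !hY//; last exact: le_trans kt.
  by rewrite (@integral_on_cat _ D 0 (k%:R * h) t)// addrC addKr.
have hDt k t : k%:R * h <= t <= k.+1%:R * h -> (Y t - Y (k%:R * h)) ^+ 2 <= h * D2 k.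
  move=> tk; rewrite hY2//; have /andP[t1 t2] := tk.
  apply: (le_trans (sqr_integral_on cD t1)).
  apply: ler_pM.
  - by rewrite subr_ge0.
  - by apply: integral_on_ge0 => x; exact: sqr_ge0.
  - by have := cell_len h k; lra.
  - by apply: ger_integral_on => // x; exact: sqr_ge0.
have hE k : E k <= 2 * h * q k ^+ 2 + 2 * h ^+ 2 * D2 k.
  apply: (@le_trans _ _ (I (fun=> 2 * q k ^+ 2 + 2 * (h * D2 k)) k)).
    apply: le_integral_on => [| |x xk].
    - exact: cont_sqrB.
    - exact: continuous_cstf.
    have := hDt _ _ xk; rewrite /q; set p := Y (_ * _) => hp.
    by have := sqr_ge0 ((Y x - p) - (p - y k)); lra.
  by rewrite /I integral_on_cst// cell_len; lra.
have hD2 k : D2 k <= 2 * h * d k ^+ 2 + 4 * lam ^+ 2 * E k + 4 * Phi k.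
  have c1 : continuous (fun t => (Y t - y k) ^+ 2) by exact: cont_sqrB.
  have c2 : continuous (fun t => (F t - f k) ^+ 2) by exact: cont_sqrB.
  apply: (@le_trans _ _ (I (fun t => (2 * d k ^+ 2 + (4 * lam ^+ 2 * (Y t - y k) ^+ 2
      + 4 * (F t - f k) ^+ 2))) k)).
    apply: le_integral_on => // [|x xk].
      by apply: continuousDf; [exact: continuous_cstf|apply: continuousDf; exact: continuousZf].
    have := sqr_ge0 (D x - 2 * d k); have := sqr_ge0 (lam * (Y x - y k) - (F x - f k)).
    rewrite /D /d; lra.
  rewrite /I integral_onD; [|exact: continuous_cstf|by apply: continuousDf; exact: continuousZf].
  rewrite integral_onD; [|exact: continuousZf|exact: continuousZf].
  rewrite integral_on_cst// !integral_onZ// cell_len -/(I _ _) -/(I _ _) -/(E k) -/(Phi k).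
  lra.
pose eps k := I (fun t => lam * (Y t - Y (k%:R * h)) + (F t - f k)) k.
have hq k : q k.+1 = (1 + lam * h) * q k + eps k.
  rewrite /q hy /eps.
  have -> : I (fun t => lam * (Y t - Y (k%:R * h)) + (F t - f k)) k =
      I D k - h * (lam * Y (k%:R * h) + f k).
    rewrite /I (@eq_integral_on _ _ (fun t => D t + - (lam * Y (k%:R * h) + f k))).
      by rewrite integral_onD ?integral_on_cst ?cell_len//; [ring|exact: continuous_cstf].
    by move=> x _; rewrite /D; ring.
  by rewrite /I -hY2 ?cle ?lexx//; ring.
have heps k : eps k ^+ 2 <= h * (2 * lam ^+ 2 * h ^+ 2 * D2 k + 2 * Phi k).
  have c2 : continuous (fun t => (F t - f k) ^+ 2) by exact: cont_sqrB.
  have c3 : continuous (fun t => lam * (Y t - Y (k%:R * h)) + (F t - f k)).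
    apply: continuousDf; last by apply: continuousBf => //; exact: continuous_cstf.
    by apply: continuousZf; apply: continuousBf => //; exact: continuous_cstf.
  apply: (le_trans (sqr_integral_on c3 (cle k))); rewrite cell_len (ler_wpM2l (ltW h0))//.
  have -> : 2 * lam ^+ 2 * h ^+ 2 * D2 k + 2 * Phi k =
      I (fun t => 2 * lam ^+ 2 * (h * D2 k) + 2 * (F t - f k) ^+ 2) k.
    rewrite /I integral_onD; [|exact: continuous_cstf|exact: continuousZf].
    by rewrite integral_on_cst// integral_onZ// cell_len -/(I _ _) -/(Phi k); ring.
  apply: le_integral_on => [| |x xk].
  - exact: continuous_sqr.
  - by apply: continuousDf; [exact: continuous_cstf|exact: continuousZf].
  have := hDt _ _ xk; set p := Y (_ * _) => hp.
  have := ler_wpM2l (sqr_ge0 lam) hp.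
  by have := sqr_ge0 (lam * (Y x - p) - (F x - f k)); lra.
have lh : 0 < - (lam * h) by rewrite oppr_gt0 pmulr_llt0.
have a01 : 0 <= 1 + lam * h < 1.
  apply/andP; split; last by lra.
  rewrite -subr_ge0; set p := lam * h in hs lh *; nra.
have := @sum_sqr_contraction R (1 + lam * h) q eps n a01 hq.
have q00 : q 0%N = 0 by rewrite /q mul0r y0 hY// integral_on_point subr0.
rewrite q00 expr0n add0r -mulr_suml.
have -> : 1 - (1 + lam * h) = - (lam * h) by ring.
move=> hsum.
pose SD2 := \sum_(k < n) D2 k; pose SPhi := step_err F f h n.
pose SE := step_err Y y h n; pose Sd := \sum_(k < n) d k ^+ 2.
have h1 : \sum_(k < n) eps k ^+ 2 <= h * (2 * lam ^+ 2 * h ^+ 2 * SD2 + 2 * SPhi).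
  apply: (@le_trans _ _ (\sum_(k < n) h * (2 * lam ^+ 2 * h ^+ 2 * D2 k + 2 * Phi k))).
    by apply: ler_sum => k _.
  by rewrite -mulr_sumr big_split/= -!mulr_sumr.
have h2 : \sum_(k < n) q k ^+ 2 <= 2 * h * SD2 + 2 * SPhi * lam ^- 2 / h.
  have := hsum; rewrite ler_pdivlMr// => h3.
  have l2 : 0 < (lam * h) ^+ 2 by rewrite -sqrrN; exact: exprn_gt0.
  rewrite -(ler_pM2l l2).
  apply: (@le_trans _ _ (\sum_(k < n) eps k ^+ 2)); first by lra.
  apply: (le_trans h1); rewrite le_eqVlt; apply/orP; left; apply/eqP.
  field; lra.
have h3 : SE <= 2 * h * (\sum_(k < n) q k ^+ 2) + 2 * h ^+ 2 * SD2.
  apply: (@le_trans _ _ (\sum_(k < n) (2 * h * q k ^+ 2 + 2 * h ^+ 2 * D2 k))).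
    by apply: ler_sum => k _; exact: hE.
  by rewrite big_split/= -!mulr_sumr.
have h4 : SD2 <= 2 * h * Sd + 4 * lam ^+ 2 * SE + 4 * SPhi.
  apply: (@le_trans _ _ (\sum_(k < n) (2 * h * d k ^+ 2 + 4 * lam ^+ 2 * E k + 4 * Phi k))).
    by apply: ler_sum => k _.
  by rewrite !big_split/= -!mulr_sumr.
have h5 : SE <= 6 * h ^+ 2 * SD2 + 4 * lam ^- 2 * SPhi.
  apply: (le_trans h3); have := ler_wpM2l (_ : 0 <= 2 * h) h2.
  rewrite (_ : 2 * h * (2 * h * SD2 + 2 * SPhi * lam ^- 2 / h) =
    4 * h ^+ 2 * SD2 + 4 * lam ^- 2 * SPhi); last by field; lra.
  by move=> H; have := H (ltac:(lra)); lra.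
have h6 : SE <= 6 * h ^+ 2 * (2 * h * Sd + 4 * lam ^+ 2 * SE + 4 * SPhi) + 4 * lam ^- 2 * SPhi.
  apply: (le_trans h5); rewrite lerD2r ler_wpM2l//.
  by rewrite mulr_ge0// sqr_ge0.
have SE0 : 0 <= SE by exact: step_err_ge0.
have h7 := ler_wpM2r SE0 hs.
rewrite -/Sd -/SPhi -/SE; lra.
Qed.

End StepErr.

(** * Long-time averages of paths *)

Section TimeMeans.
Variable R : realType.
Implicit Types (F Y w : R -> R) (f y : nat -> nat -> R) (a b h c : R).

(** The property [o(T)]. *)
Definition sublinear_time (G : R -> R) := forall e : R, 0 < e ->
  exists K : R, forall T, 1 <= T -> `|G T| <= K + e * T.

Definition time_mean F c := sublinear_time (fun T => integral_on F 0 T - T * c).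

Lemma eq_sublinear_time G G' : (forall T, 1 <= T -> G T = G' T) ->
  sublinear_time G -> sublinear_time G'.
Proof.
by move=> GG' hG e e0; have [K hK] := hG e e0; exists K => T T1; rewrite -GG'// hK.
Qed.

Lemma sublinear_timeD G G' : sublinear_time G -> sublinear_time G' ->
  sublinear_time (fun T => G T + G' T).
Proof.
move=> hG hG' e e0; have e2 : 0 < e / 2 by lra.
have [K hK] := hG _ e2; have [K' hK'] := hG' _ e2.
exists (K + K') => T T1; have := ler_normD (G T) (G' T).
by have := hK _ T1; have := hK' _ T1; lra.
Qed.

Lemma sublinear_timeZ a G : sublinear_time G -> sublinear_time (fun T => a * G T).
Proof.
move=> hG e e0; have a1 : 0 < `|a| + 1 by rewrite ltr_pwDr.
have [K hK] := hG _ (divr_gt0 e0 a1).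
exists (`|a| * K) => T T1; rewrite normrM.
apply: (@le_trans _ _ (`|a| * (K + e / (`|a| + 1) * T))).
  by rewrite ler_wpM2l// hK.
rewrite mulrDr lerD2l mulrA ler_wpM2r ?(le_trans ler01)// mulrCA ger_pMr//.
by rewrite ler_pdivrMr// mul1r lerDl.
Qed.

Definition mesh m : R := 2 ^- m.

Lemma mesh_gt0 m : 0 < mesh m.
Proof. by rewrite invr_gt0 exprn_gt0. Qed.

Lemma mesh_exp m : 2 ^+ m * mesh m = 1 :> R.
Proof. by rewrite mulfV// expf_neq0// pnatr_eq0. Qed.

Lemma meshS m : mesh m.+1 = mesh m / 2.
Proof. by rewrite /mesh exprS invfM mulrC. Qed.

Lemma cvg_mesh : mesh m @[m --> \oo] --> (0 : R).
Proof.
rewrite /mesh; under eq_cvg do rewrite -exprVn.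
by apply: cvg_expr; rewrite ger0_norm ?invr_ge0// invf_lt1// ltr1n.
Qed.

Lemma mesh_small e : 0 < e -> exists m0, forall m, (m0 <= m)%N -> mesh m <= e.
Proof.
move=> e0; have /cvgrPdist_le/(_ e e0)[m0 _ h] := cvg_mesh.
by exists m0 => m /h; rewrite /= sub0r normrN ger0_norm// ltW// mesh_gt0.
Qed.

(** [F] is approached by the step functions with values [f m] on the dyadic
    mesh [2 ^- m], with a squared [L^2] error per unit of time that becomes
    arbitrarily small as [m] grows, after a burn-in that may depend on [m]. *)
Definition approximable F (f : nat -> nat -> R) := forall eta : R, 0 < eta ->
  exists m0, forall m, (m0 <= m)%N -> exists K : R,
    forall n, step_err F (f m) (mesh m) n <= K + eta * (n%:R * mesh m).

Lemma approximable_lin F Y f y a b : continuous F -> continuous Y ->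
  approximable F f -> approximable Y y ->
  approximable (fun t => a * F t + b * Y t) (fun m k => a * f m k + b * y m k).
Proof.
move=> cF cY hF hY e e0.
have A0 : 0 <= 2 * a ^+ 2 by rewrite mulr_ge0// sqr_ge0.
have B0 : 0 <= 2 * b ^+ 2 by rewrite mulr_ge0// sqr_ge0.
pose C := 2 * a ^+ 2 + 2 * b ^+ 2 + 1.
have C0 : 0 < C by rewrite /C; lra.
have [m1 h1] := hF _ (divr_gt0 e0 C0); have [m2 h2] := hY _ (divr_gt0 e0 C0).
exists (maxn m1 m2) => m; rewrite geq_max => /andP[mm1 mm2].
have [K1 k1] := h1 _ mm1; have [K2 k2] := h2 _ mm2.
exists (2 * a ^+ 2 * K1 + 2 * b ^+ 2 * K2) => n.
apply: (le_trans (step_err_lin _ _ _ _ _ (mesh_gt0 m) cF cY)).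
have := ler_wpM2l A0 (k1 n); have := ler_wpM2l B0 (k2 n).
set T := n%:R * mesh m.
have T0 : 0 <= T by rewrite mulr_ge0// ltW// mesh_gt0.
have : e / C * T * (2 * a ^+ 2 + 2 * b ^+ 2) <= e * T.
  rewrite mulrAC ler_wpM2r// mulrAC ler_pdivrMr// ler_pM2l// /C; lra.
lra.
Qed.

(** A stable linear filter is a bounded operator, so the quality of an
    approximation survives it; [B] bounds the energy of the derivative of the
    scheme uniformly in the mesh. *)
Lemma approximable_filter lam F Y f y B : lam < 0 -> continuous F -> continuous Y ->
  (forall t, 0 <= t -> Y t = integral_on (fun s => lam * Y s + F s) 0 t) ->
  (forall m, y m 0%N = 0) ->
  (forall m k, y m k.+1 = (1 + lam * mesh m) * y m k + mesh m * f m k) ->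
  0 <= B ->
  (exists m0, forall m, (m0 <= m)%N -> exists K, forall n,
      \sum_(k < n) (lam * y m k + f m k) ^+ 2 <= K + B * n%:R) ->
  approximable F f -> approximable Y y.
Proof.
move=> lam0 cF cY hY y0 hy B0 [m1 hB] hF e e0.
pose C := 48 + 8 * lam ^- 2.
have l2 : 0 <= lam ^- 2 by rewrite invr_ge0 sqr_ge0.
have C0 : 0 < C by rewrite /C; lra.
have C20 : 0 < 2 * C by lra.
have [m2 h2] := hF _ (divr_gt0 e0 C20).
have [m3 h3] := mesh_small ltr01.
have B1 : 0 < 48 * (B + 1) by lra.
have [m4 h4] := mesh_small (divr_gt0 e0 B1).
have L1 : 0 < 48 * lam ^+ 2 by rewrite mulr_gt0// exprn_even_gt0//= lt_eqF.
have [m5 h5] := mesh_small (divr_gt0 ltr01 L1).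
exists (maxn m1 (maxn m2 (maxn m3 (maxn m4 m5)))) => m.
rewrite !geq_max => /and5P[/hB[K1 k1] /h2[K2 k2] /h3 s3 /h4 s4 /h5 s5].
have h0 := mesh_gt0 m; set h := mesh m in h0 s3 s4 s5 k2 *.
have hh : h ^+ 2 <= h by rewrite expr2 ger_pMl.
have hs : 48 * (lam * h) ^+ 2 <= 1.
  move: s5; rewrite ler_pdivlMr// => s5; rewrite exprMn.
  have := ler_wpM2l (ltW L1) hh; lra.
exists (24 * h ^+ 3 * K1 + C * K2) => n.
apply: (le_trans (step_err_filter n lam0 h0 hs cF cY hY (y0 m) (hy m))).
have n0 : 0 <= n%:R :> R by [].
have p1 : 24 * h ^+ 2 * (h * \sum_(k < n) (lam * y m k + f m k) ^+ 2) <=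
   24 * h ^+ 3 * (K1 + B * n%:R).
  have hh3 : 0 <= 24 * h ^+ 3 by rewrite mulr_ge0 ?exprn_ge0 ?(ltW h0).
  by have := ler_wpM2l hh3 (k1 n); lra.
have p2 : (48 * h ^+ 2 + 8 * lam ^- 2) * step_err F (f m) h n <=
    C * (K2 + e / (2 * C) * (n%:R * h)).
  apply: ler_pM; rewrite ?step_err_ge0//.
  - by have := sqr_ge0 h; lra.
  - by rewrite /C; lra.
have p3 : C * (e / 2 / C * (n%:R * h)) = e / 2 * (n%:R * h) by field; lra.
have p4 : 24 * h ^+ 3 * (B * n%:R) <= e / 2 * (n%:R * h).
  have nh : 0 <= n%:R * h by rewrite mulr_ge0// ltW.
  have -> : 24 * h ^+ 3 * (B * n%:R) = (24 * h ^+ 2 * B) * (n%:R * h) by ring.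
  rewrite ler_wpM2r//.
  move: s4; rewrite ler_pdivlMr// => s4.
  have := ler_wpM2r B0 hh; lra.
move: p2; rewrite mulrDr; have -> : (e / (2 * C)) = e / 2 / C by field; lra.
rewrite p3; lra.
Qed.

(** The mean square of a path is the limit, as the mesh goes to [0], of the
    mean squares of its approximations. *)
Lemma time_mean_approx F f (cm : nat -> R) c : continuous F -> approximable F f ->
  (exists m0, forall m, (m0 <= m)%N -> has_mean (fun k => f m k ^+ 2) (cm m)) ->
  cm m @[m --> \oo] --> c -> time_mean (fun t => F t ^+ 2) c.
Proof.
move=> cF hF [m1 hm] /cvgrPdist_le hc e e0.
(* [d] weighs the two terms of [step_err_mean]; once it is chosen, [eta] is
   the approximation error that the second term can afford. *)
pose d : R := Num.min 1 (e / (2 * (`|c| + 3))).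
have c0 := normr_ge0 c.
have d0 : 0 < d by rewrite lt_min ltr01 divr_gt0// mulr_gt0//; lra.
have d1 : d <= 1 by rewrite ge_min lexx.
have d2 : d * (`|c| + 3) <= e / 2.
  rewrite (_ : e / 2 = e / (2 * (`|c| + 3)) * (`|c| + 3)); last by field; lra.
  by rewrite ler_wpM2r ?ge_min ?lexx ?orbT//; lra.
have di0 : 0 < d^-1 by rewrite invr_gt0.
pose eta : R := Num.min 1 (e / 2 / (2 + d^-1)).
have eta0 : 0 < eta by rewrite lt_min ltr01 !divr_gt0//; lra.
have eta1 : eta <= 1 by rewrite ge_min lexx.
have eta2 : eta * (2 + d^-1) <= e / 2.
  rewrite -ler_pdivlMr; last by lra.
  by rewrite ge_min lexx orbT.
have [m2 h2] := hF _ eta0; have [m3 _ h3] := hc _ eta0.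
pose m := maxn m1 (maxn m2 m3).
have m1m : (m1 <= m)%N by rewrite leq_maxl.
have m2m : (m2 <= m)%N by rewrite !leq_max leqnn orbT.
have m3m : (m3 <= m)%N by rewrite !leq_max leqnn !orbT.
have [K2 k2] := h2 _ m2m.
have [K1 k1] := hm _ m1m _ d0.
have := h3 _ m3m => /=; set c' := cm m in k1 * => hcc'.
have h0 := mesh_gt0 m; set h := mesh m in k2 h0.
have c'1 : `|c'| <= `|c| + 1.
  have -> : c' = c - (c - c') by ring.
  by apply: (le_trans (ler_normB _ _)); lra.
have key n : `|integral_on (fun t => F t ^+ 2) 0 (n%:R * h) - n%:R * h * c| <=
   2 * h * `|K1| + (1 + d^-1) * `|K2| + e * (n%:R * h).
  have T0 : 0 <= n%:R * h by rewrite mulr_ge0// ltW.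
  have := step_err_mean (f m) n h0 d0 cF.
  set I := integral_on _ _ _; set S := \sum_(k < n) _; set E := step_err _ _ _ _ => q1.
  have q2 : E <= `|K2| + eta * (n%:R * h).
    by apply: (le_trans (k2 n)); rewrite lerD2r ler_norm.
  have q3 : `|S - n%:R * c'| <= `|K1| + d * n%:R.
    by apply: (le_trans (k1 n)); rewrite lerD2r ler_norm.
  have q4 : `|h * S - n%:R * h * c'| <= h * `|K1| + d * (n%:R * h).
    have -> : h * S - n%:R * h * c' = h * (S - n%:R * c') by ring.
    rewrite normrM (ger0_norm (ltW h0)); have := ler_wpM2l (ltW h0) q3; lra.
  have q5 : `|n%:R * h * c' - n%:R * h * c| <= eta * (n%:R * h).
    by rewrite -mulrBr normrM (ger0_norm T0) mulrC ler_wpM2r// distrC.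
  have q6 : h * S <= n%:R * h * (`|c| + 1) + h * `|K1| + d * (n%:R * h).
    have := ler_norm (h * S - n%:R * h * c').
    have : n%:R * h * c' <= n%:R * h * (`|c| + 1).
      by rewrite ler_wpM2l// (le_trans (ler_norm _)).
    lra.
  have -> : I - n%:R * h * c = (I - h * S) + (h * S - n%:R * h * c') +
      (n%:R * h * c' - n%:R * h * c) by ring.
  apply: (le_trans (ler_normD _ _)).
  have := ler_normD (I - h * S) (h * S - n%:R * h * c').
  have q7 := ler_wpM2l (ltW d0) q6.
  have q8 : (1 + d^-1) * E <= (1 + d^-1) * (`|K2| + eta * (n%:R * h)).
    by rewrite ler_wpM2l//; lra.
  have q9 := ler_wpM2r T0 eta2.
  have q10 := ler_wpM2r T0 d2.
  have K10 : 0 <= h * `|K1| by rewrite mulr_ge0// ltW.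
  have q11 := ler_wpM2r K10 d1.
  have q12 : d * d * (n%:R * h) <= d * (n%:R * h).
    by rewrite ler_wpM2r// ger_pMl.
  lra.
pose K := 2 * h * `|K1| + (1 + d^-1) * `|K2| + e * h + h * `|c|.
exists K => T T1.
have Th0 : 0 <= T / h by rewrite divr_ge0 ?(ltW h0)// (le_trans ler01).
have /andP[] := truncn_itv Th0; set n := Num.truncn _.
rewrite ler_pdivlMr// ltr_pdivrMr// => nT Tn.
have f0 t : 0 <= F t ^+ 2 by exact: sqr_ge0.
have cF2 := continuous_sqr cF.
have up := ger_integral_on 0 cF2 f0 (ltW Tn).
have lo := ger_integral_on 0 cF2 f0 nT.
have := key n; have := key n.+1; rewrite !ler_norml => /andP[_ u2] /andP[l1 _].
have hn : n.+1%:R * h = n%:R * h + h by rewrite -natr1; ring.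
rewrite hn in u2 up Tn.
have r1 : (n%:R * h - T) * c <= h * `|c|.
  apply: (le_trans (ler_norm _)); rewrite normrM ler_wpM2r//.
  by rewrite ler_norml; apply/andP; split; move: h0 nT Tn; clear; lra.
have r2 : (n%:R * h + h - T) * c <= h * `|c|.
  apply: (le_trans (ler_norm _)); rewrite normrM ler_wpM2r//.
  by rewrite ler_norml; apply/andP; split; move: h0 nT Tn; clear; lra.
have r3 : (T - n%:R * h) * c <= h * `|c|.
  apply: (le_trans (ler_norm _)); rewrite normrM ler_wpM2r//.
  by rewrite ler_norml; apply/andP; split; move: h0 nT Tn; clear; lra.
have eT : e * (n%:R * h) <= e * T by rewrite ler_wpM2l// ltW.
have eh : 0 <= e * h by rewrite mulr_ge0 ?(ltW e0) ?(ltW h0).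
by rewrite /K; apply/andP; split; lra.
Qed.

End TimeMeans.

(** * Dyadic chaining *)

Section Dyadic.
Variable R : realType.
Implicit Types (w : R -> R).

Lemma dyadic_above k0 N : exists k, [/\ (k0 <= k)%N, (N <= 2 ^ k)%N & (2 ^ k <= 2 ^ k0 + 2 * N)%N].
Proof.
have [N1|N1] := leqP N 1.
  by exists k0; split => //; [rewrite (leq_trans N1)// expn_gt0|exact: leq_addr].
have /andP[h1 h2] := up_log_bounds (isT : 1 < 2)%N N1.
have [hk|hk] := leqP k0 (up_log 2 N).
  exists (up_log 2 N); split => //; rewrite (leq_trans _ (leq_addl _ _))//.
  rewrite -[up_log 2 N]prednK ?up_log_gt0// expnS leq_mul2l/=; exact: ltnW.
exists k0; split; [exact: leqnn| |exact: leq_addr].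
by apply: (leq_trans h2); rewrite leq_exp2l// ltnW.
Qed.

(** Heine's theorem, with [t] allowed to leave the segment. *)
Lemma unif_continuous_segment w (b e : R) : continuous w -> 0 < e ->
  exists2 d : R, 0 < d &
    forall x t, 0 <= x <= b -> `|t - x| <= d -> `|w t - w x| <= e.
Proof.
move=> cw e0.
have := @segment_compact R 0 b; rewrite compact_near_coveringP => nc.
have [] := @nc _ (0^'+ : set_system R) (fun d x => forall t, `|t - x| <= d -> `|w t - w x| <= e) _.
  move=> x _.
  have e2 : 0 < e / 2 by lra.
  have /cvgrPdist_le /(_ _ e2) := cw x.
  move=> /nbhs_ballP[r /= r0 hr].
  have r2 : 0 < r / 2 by lra.
  exists (ball x (r / 2), [set d : R | d < r / 2]) => /=.
    by split; [exact: nbhsx_ballx|exact: nbhs_right_lt].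
  move=> [y d]/= [+ dr] t td; rewrite /ball/= => xy.
  have h1 := hr y; have h2 := hr t; rewrite /ball/= in h1 h2.
  have {}h1 : `|w x - w y| <= e / 2 by apply: h1; rewrite (lt_le_trans xy)//; lra.
  have {}h2 : `|w x - w t| <= e / 2.
    apply: h2; have -> : x - t = (x - y) - (t - y) by ring.
    by apply: (le_lt_trans (ler_normB _ _)); lra.
  have -> : w t - w y = (w x - w y) - (w x - w t) by ring.
  by apply: (le_trans (ler_normB _ _)); lra.
move=> r /= r0 hr; exists (r / 2); first by lra.
move=> x t x0b tx; apply: (hr (r / 2)) => //=.
- by rewrite sub0r normrN ger0_norm; lra.
- by lra.
Qed.

Definition grid w m (i : nat) : R := w (i%:R * mesh R m).

Definition incr w m i : R := grid w m i.+1 - grid w m i.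

Lemma grid_double w m i : grid w m.+1 i.*2 = grid w m i.
Proof. by rewrite /grid meshS -muln2 natrM; congr w; field. Qed.

Lemma sum_double (g : nat -> R) n :
  \sum_(i < n.*2) g i = \sum_(i < n) (g i.*2 + g i.*2.+1).
Proof.
by elim: n => [|n IH]; rewrite ?big_ord0// doubleS !big_ord_recr/= IH addrA.
Qed.

(** One step of the chaining: refining the mesh changes the step function only
    on every other half cell, by one increment, so that the [L^2] distances at
    two consecutive levels differ by the square root of [mesh * variation]. The
    bounds are kept as squares [x ^ 2], [y ^ 2], and Minkowski's inequality
    becomes the choice [c = y / x] of the weight in Young's inequality. *)
Lemma step_err_halve w m n (x y : R) : continuous w -> 0 < x -> 0 < y ->
  step_err w (grid w m.+1) (mesh R m.+1) n.*2 <= x ^+ 2 ->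
  mesh R m.+1 * \sum_(i < n.*2) incr w m.+1 i ^+ 2 <= y ^+ 2 ->
  step_err w (grid w m) (mesh R m) n <= (x + y) ^+ 2.
Proof.
move=> cw x0 y0 hE hQ; pose c := y / x.
have c0 : 0 < c by exact: divr_gt0.
have -> : (x + y) ^+ 2 = (1 + c) * x ^+ 2 + (1 + c^-1) * y ^+ 2.
  by rewrite /c; field; lra.
have ci0 : 0 < c^-1 by rewrite invr_gt0.
have c1 : 0 <= 1 + c by lra.
have c2 : 0 <= 1 + c^-1 by lra.
apply: le_trans (lerD (ler_wpM2l c1 hE) (ler_wpM2l c2 hQ)).
rewrite /step_err.
rewrite (sum_double (fun i => integral_on (fun t => (w t - grid w m.+1 i) ^+ 2)
  (i%:R * mesh R m.+1) (i.+1%:R * mesh R m.+1))).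
rewrite (sum_double (fun i => incr w m.+1 i ^+ 2)) !mulr_sumr -big_split/=.
apply: ler_sum => i _.
set h := mesh R m.+1; have h0 : 0 < h by exact: mesh_gt0.
have hm : mesh R m = 2 * h by rewrite /h meshS; field.
have -> : i%:R * mesh R m = i.*2%:R * h by rewrite hm -muln2 natrM; ring.
have -> : i.+1%:R * mesh R m = i.*2.+2%:R * h by rewrite hm -doubleS -muln2 natrM; ring.
rewrite grid_double.
set a := i.*2%:R * h; set b := i.*2.+1%:R * h; set d := i.*2.+2%:R * h.
have ab : a <= b by exact: cell_le.
have bd : b <= d by exact: cell_le.
have lbd : d - b = h by exact: cell_len.
have cF k : continuous (fun t => (w t - k) ^+ 2) by exact: cont_sqrB.
rewrite (integral_on_cat (cF (grid w m i)) ab bd).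
have -> : incr w m.+1 i.*2 = grid w m.+1 i.*2.+1 - grid w m i.
  by rewrite /incr grid_double.
set u := grid w m i; set v := grid w m.+1 i.*2.+1.
have : integral_on (fun t => (w t - u) ^+ 2) b d <=
    integral_on (fun t => (1 + c) * (w t - v) ^+ 2 + (1 + c^-1) * (v - u) ^+ 2) b d.
  apply: le_integral_on => // [|t _].
    by apply: continuousDf; [exact: continuousZf|exact: continuous_cstf].
  have : 0 <= c * ((w t - v) - c^-1 * (v - u)) ^+ 2 by rewrite mulr_ge0 ?sqr_ge0 ?ltW.
  have -> : c * ((w t - v) - c^-1 * (v - u)) ^+ 2 =
    c * (w t - v) ^+ 2 - 2 * (w t - v) * (v - u) + c^-1 * (v - u) ^+ 2 by field; lra.
  lra.
rewrite integral_onD; [|exact: continuousZf|exact: continuous_cstf].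
rewrite integral_on_cst// integral_onZ// lbd.
have : 0 <= integral_on (fun t => (w t - u) ^+ 2) a b.
  by apply: integral_on_ge0 => t; exact: sqr_ge0.
move=> I0; have cI := mulr_ge0 (ltW c0) I0.
have : 0 <= (1 + c^-1) * (h * incr w m.+1 i.*2.+1 ^+ 2).
  by rewrite mulr_ge0// mulr_ge0 ?sqr_ge0// ltW.
lra.
Qed.

(** Uniform continuity: on a fixed horizon the chaining ends. *)
Lemma step_err_vanish w k (x : R) : continuous w -> 0 < x ->
  exists M0, forall M, (M0 <= M)%N ->
    step_err w (grid w M) (mesh R M) (2 ^ (M + k)) <= x ^+ 2.
Proof.
move=> cw x0; pose e := x ^+ 2 / 2 ^+ k.
have p2 : 0 < 2 ^+ k :> R by exact: exprn_gt0.
have e0 : 0 < e by rewrite divr_gt0// exprn_gt0.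
have se0 : 0 < Num.sqrt e by rewrite sqrtr_gt0.
have [d d0 hd] := unif_continuous_segment (2 ^+ k) cw se0.
have [M0 hM0] := mesh_small d0; exists M0 => M /hM0 hM.
have h0 := mesh_gt0 R M; set h := mesh R M in hM h0 *.
have hn : (2 ^ (M + k))%:R * h = 2 ^+ k :> R.
  by rewrite natrX exprD mulrAC mesh_exp mul1r.
apply: (@le_trans _ _ (\sum_(i < 2 ^ (M + k)) e * h)); last first.
  by rewrite sumr_const card_ord -mulr_natl mulrCA hn /e divfK// gt_eqF.
apply: ler_sum => i _.
rewrite -{3}(cell_len h i) -integral_on_cst; last exact: cell_le.
apply: le_integral_on => [| |t /andP[t1 t2]].
- exact: cont_sqrB.
- exact: continuous_cstf.
have : `|w t - w (i%:R * h)| <= Num.sqrt e.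
  apply: hd.
    rewrite mulr_ge0 ?(ltW h0)//= -hn ler_pM2r// ler_nat; exact: ltnW.
  by rewrite ger0_norm ?subr_ge0//; have := cell_len h i; lra.
move=> hw; rewrite -real_normK ?num_real// -[leRHS]sqr_sqrtr ?(ltW e0)//.
by rewrite ler_sqr ?nnegrE ?normr_ge0 ?sqrtr_ge0.
Qed.

Definition quadratic_variation_bounded w := exists k0, forall k, (k0 <= k)%N ->
  forall m, \sum_(i < 2 ^ (m + k)) incr w m i ^+ 2 <= 2 * 2 ^+ k.

(** Chaining over all finer meshes: the corrections at level [j] are of order
    [sqrt (2 ^- j)] per unit of time, hence sum to [sqrt (mesh m)]. That the
    bound on the quadratic variation is uniform over the levels is what makes
    the error linear in time for each fixed [m]. *)
Lemma step_err_grid w m : continuous w -> quadratic_variation_bounded w ->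
  exists K, forall n, step_err w (grid w m) (mesh R m) n <=
    K + 100 * mesh R m * (n%:R * mesh R m).
Proof.
move=> cw [k0 hQ].
(* [r ^ m] is the square root of [mesh m]. *)
pose r : R := Num.sqrt 2^-1.
have r2 : r ^+ 2 = 2^-1 by rewrite sqr_sqrtr// invr_ge0.
have r0 : 0 < r by rewrite sqrtr_gt0 invr_gt0.
have r45 : r <= 4 / 5.
  by rewrite -ler_sqr ?nnegrE ?(ltW r0)// ?r2 ?divr_ge0//; lra.
have rm j : (r ^+ j) ^+ 2 = mesh R j by rewrite exprAC r2 exprVn.
have key k : (k0 <= k)%N ->
    step_err w (grid w m) (mesh R m) (2 ^ (m + k)) <= 50 * 2 ^+ k * mesh R m.
  move=> k0k; pose s : R := Num.sqrt (2 * 2 ^+ k).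
  have s0 : 0 < s by rewrite sqrtr_gt0 mulr_gt0// exprn_gt0.
  have s2 : s ^+ 2 = 2 * 2 ^+ k by rewrite sqr_sqrtr// mulr_ge0// exprn_ge0.
  have chain i x : 0 < x ->
      step_err w (grid w (m + i)%N) (mesh R (m + i)) (2 ^ (m + i + k)) <= x ^+ 2 ->
      step_err w (grid w m) (mesh R m) (2 ^ (m + k)) <=
        (x + 4 * s * r ^+ m * (1 - r ^+ i)) ^+ 2.
    elim: i x => [|i IH] x x0; first by rewrite addn0 expr0 subrr mulr0 addr0.
    rewrite addnS => hE.
    have y0 : 0 < s * r ^+ (m + i).+1 by rewrite mulr_gt0// exprn_gt0.
    have hx : 0 < x + s * r ^+ (m + i).+1 by rewrite addr_gt0.
    have := IH _ hx; have := @step_err_halve w (m + i) (2 ^ (m + i + k)) x _ cw x0 y0.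
    rewrite (_ : (2 ^ (m + i + k)).*2 = 2 ^ ((m + i).+1 + k))%N; last first.
      by rewrite addSn expnS mul2n.
    move=> /(_ hE) h1 h2.
    have /h2 : step_err w (grid w (m + i)%N) (mesh R (m + i)) (2 ^ (m + i + k))
       <= (x + s * r ^+ (m + i).+1) ^+ 2.
      apply: h1; rewrite exprMn rm s2 mulrC (ler_wpM2r (ltW (mesh_gt0 R _)))//.
      exact: hQ.
    move=> h3; apply: (le_trans h3).
    have rp j : 0 < r ^+ j by exact: exprn_gt0.
    have ri1 : r ^+ i <= 1 by rewrite exprn_ile1// ?ltW//; lra.
    have z1 : 0 <= 4 * s * r ^+ m * (1 - r ^+ i).
      by rewrite !mulr_ge0 ?subr_ge0// ltW.
    have z2 : s * r ^+ (m + i).+1 <= 4 * s * r ^+ m * (r ^+ i - r ^+ i.+1).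
      rewrite -addnS exprD exprS.
      have : 0 < s * (r ^+ m * r ^+ i) by rewrite !mulr_gt0.
      move=> /ltW z; have := ler_wpM2l z r45; lra.
    rewrite ler_sqr ?nnegrE; first by lra.
      by rewrite addr_ge0// ltW.
    have z3 : r ^+ i.+1 <= 1 by rewrite exprn_ile1// ?ltW//; lra.
    by rewrite addr_ge0 ?(ltW x0)// !mulr_ge0 ?subr_ge0// ltW.
  have x0 : 0 < s * r ^+ m by rewrite mulr_gt0// exprn_gt0.
  have [M0 hM0] := step_err_vanish k cw x0.
  have := chain M0 _ x0 (hM0 _ (leq_addl _ _)).
  move=> h; apply: (le_trans h).
  have -> : 50 * 2 ^+ k * mesh R m = (5 * (s * r ^+ m)) ^+ 2.
    by rewrite !exprMn rm s2; ring.
  have rp j : 0 < r ^+ j by exact: exprn_gt0.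
  have ri1 : r ^+ M0 <= 1 by rewrite exprn_ile1// ?ltW//; lra.
  have z1 : 0 <= 4 * s * r ^+ m * (1 - r ^+ M0).
    by rewrite !mulr_ge0 ?subr_ge0// ltW.
  have z2 : 0 <= s * r ^+ m * r ^+ M0 by rewrite !mulr_ge0// ltW.
  by rewrite ler_sqr ?nnegrE; [lra|rewrite addr_ge0// ltW|rewrite mulr_ge0// ltW].
have h0 := mesh_gt0 R m; set h := mesh R m in h0 *.
exists (50 * (2 ^+ k0 + 2) * h) => n.
have [k [k0k kn kle]] := dyadic_above k0 (n %/ 2 ^ m).+1.
have n2 : (n <= 2 ^ (m + k))%N.
  rewrite expnD; apply: (leq_trans (ltnW (ltn_ceil n (expn_gt0 2 m)))).
  by rewrite mulnC leq_mul2l kn orbT.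
apply: (le_trans (step_err_nondecreasing _ _ _ n2)).
apply: (le_trans (key k k0k)); rewrite -/h.
have : 2 ^+ k <= 2 ^+ k0 + 2 * (n%:R * h + 1) :> R.
  have : (2 ^ k)%:R <= (2 ^ k0 + 2 * (n %/ 2 ^ m).+1)%:R :> R by rewrite ler_nat.
  rewrite natrD natrM !natrX => /le_trans; apply.
  rewrite lerD2l ler_wpM2l// -natr1 lerD2r.
  rewrite ler_pdivlMr ?exprn_gt0//.
  by rewrite -natrX -natrM ler_nat; exact: leq_trunc_div.
move=> hk.
have h1 := ler_wpM2l (ltW h0) hk.
have T0 : 0 <= n%:R * h by rewrite mulr_ge0// ltW.
lra.
Qed.

Lemma approximable_grid w : continuous w -> quadratic_variation_bounded w ->
  approximable w (grid w).
Proof.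
move=> cw hQ eta eta0; have eta1 : 0 < eta / 100 by lra.
have [m0 hm0] := mesh_small eta1; exists m0 => m /hm0 hm.
have [K hK] := step_err_grid m cw hQ; exists K => n.
apply: (le_trans (hK n)); rewrite lerD2l ler_wpM2r ?mulr_ge0 ?(ltW (mesh_gt0 R m))//.
lra.
Qed.

Definition unit_oscillation_sublinear w := forall e : R, 0 < e ->
  exists K : R, forall T t, 1 <= T -> T - 1 <= t <= T -> (w T - w t) ^+ 2 <= K + e * T.

(** Any ratio [q < 1] with [2 * q ^ 4 > 1] would do in place of [9 / 10]: the
    sum of the fourth powers of the increments has expectation of order
    [2 ^ (k - m)], which must be summable against [4 ^ k * q ^ (4 (k + m))]. *)
Definition increments_dominated w := exists k0, forall k, (k0 <= k)%N ->
  forall m i, (i < 2 ^ (m + k))%N ->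
    incr w m i ^+ 2 <= 2 ^+ k * ((9 / 10) ^+ (k + m)) ^+ 2.

(** Chaining in the supremum norm: on [0, 2 ^ k] the increments at level [m]
    are at most [sqrt (2 ^ k) * q ^ k * q ^ m], so the oscillation inside a unit
    cell is at most a multiple of [sqrt (2 ^ k) * q ^ k], and [q ^ k] goes to
    [0]. *)
Lemma oscillation_from_increments w : continuous w -> increments_dominated w ->
  unit_oscillation_sublinear w.
Proof.
move=> cw [k0 hw]; pose q : R := 9 / 10.
have q0 : 0 < q by rewrite /q; lra.
have q1 : q < 1 by rewrite /q; lra.
have qp j : 0 < q ^+ j by exact: exprn_gt0.
pose B k : R := Num.sqrt (2 ^+ k).
have B0 k : 0 < B k by rewrite sqrtr_gt0 exprn_gt0.
have B2 k : B k ^+ 2 = 2 ^+ k by rewrite sqr_sqrtr// exprn_ge0.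
have hinc k m i : (k0 <= k)%N -> (i < 2 ^ (m + k))%N ->
    `|incr w m i| <= B k * q ^+ k * q ^+ m.
  move=> k0k im; rewrite -ler_sqr ?nnegrE ?normr_ge0// ?real_normK ?num_real//.
    by rewrite -mulrA -exprD exprMn B2; exact: hw.
  by rewrite !mulr_ge0// ltW.
have chain k t : (k0 <= k)%N -> 0 <= t < 2 ^+ k ->
    `|w t - w (Num.truncn t)%:R| <= 10 * (B k * q ^+ k).
  move=> k0k /andP[t0 t2].
  pose n j := Num.truncn (t * 2 ^+ j).
  have nP j : (n j)%:R <= t * 2 ^+ j < (n j).+1%:R.
    by apply: truncn_itv; rewrite mulr_ge0// exprn_ge0.
  have nlt j : (n j < 2 ^ (j + k))%N.
    have /andP[h _] := nP j; rewrite -(ltr_nat R) natrX exprD.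
    by apply: (le_lt_trans h); rewrite mulrC ltr_pM2l// exprn_gt0.
  have hn j : `|grid w j (n j) - w (n 0%N)%:R| <= B k * q ^+ k * (9 * (1 - q ^+ j)).
    elim: j => [|j IH].
      by rewrite /grid /mesh !expr0 invr1 mulr1 !subrr normr0 !mulr0.
    have step : `|grid w j.+1 (n j.+1) - grid w j (n j)| <= B k * q ^+ k * q ^+ j.+1.
      rewrite -(grid_double w j (n j)).
      have /andP[a1 a2] := nP j; have /andP[b1 b2] := nP j.+1.
      rewrite exprS mulrCA in b1 b2.
      have c1 : ((n j).*2 <= n j.+1)%N.
        rewrite -ltnS -(ltr_nat R); apply: le_lt_trans b2.
        by rewrite -mul2n natrM; lra.
      have c2 : (n j.+1 < (n j).*2.+2)%N.
        rewrite -(ltr_nat R); apply: (le_lt_trans b1).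
        by rewrite -doubleS -mul2n natrM; lra.
      have [->|hne] := eqVneq (n j.+1) (n j).*2.
        by rewrite subrr normr0 !mulr_ge0// ltW.
      have E : n j.+1 = (n j).*2.+1.
        by apply/eqP; rewrite eqn_leq -ltnS c2 ltn_neqAle eq_sym hne c1.
      rewrite E; apply: (hinc k j.+1 (n j).*2 k0k).
      by rewrite addSn expnS -mul2n ltn_pmul2l.
    have -> : grid w j.+1 (n j.+1) - w (n 0%N)%:R =
      (grid w j.+1 (n j.+1) - grid w j (n j)) + (grid w j (n j) - w (n 0%N)%:R) by ring.
    apply: (le_trans (ler_normD _ _)).
    have P0 : 0 < B k * q ^+ k by rewrite mulr_gt0.
    have := lerD step IH; move=> /le_trans; apply; rewrite exprS /q; lra.
  have P0 : 0 < B k * q ^+ k by rewrite mulr_gt0.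
  have /cvgrPdist_le /(_ _ P0) := cw t.
  move=> /nbhs_ballP[d /= d0 hd].
  have d2 : 0 < d / 2 by lra.
  have [j /(_ j (leqnn j)) hj] := mesh_small d2.
  have /hd/= : ball t d ((n j)%:R * mesh R j).
    rewrite /ball/=; have /andP[a1 a2] := nP j; have m0 := mesh_gt0 R j.
    have e1 := ler_wpM2r (ltW m0) a1; have e2 := ler_wpM2r (ltW m0) (ltW a2).
    rewrite -mulrA mesh_exp mulr1 in e1; rewrite -mulrA mesh_exp mulr1 in e2.
    rewrite -natr1 mulrDl mul1r in e2.
    by rewrite ger0_norm; lra.
  rewrite -/(grid w j (n j)) => h1.
  have h2 := hn j; have nE : n 0%N = Num.truncn t by rewrite /n expr0 mulr1.
  rewrite nE in h2.
  have -> : w t - w (Num.truncn t)%:R =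
    (w t - grid w j (n j)) + (grid w j (n j) - w (Num.truncn t)%:R) by ring.
  apply: (le_trans (ler_normD _ _)).
  have := mulr_gt0 P0 (qp j); lra.
move=> e e0.
have [k1 hk1] : exists k1, forall k, (k1 <= k)%N -> 882 * (q ^+ k) ^+ 2 <= e.
  have : q ^+ k @[k --> \oo] --> (0 : R) by apply: cvg_expr; rewrite ger0_norm ?ltW.
  have e8 : 0 < e / 882 by lra.
  move=> /cvgrPdist_le /(_ _ e8)[k1 _ h]; exists k1 => k /h/=.
  rewrite sub0r normrN ger0_norm ?(ltW (qp k))// => hq.
  have : (q ^+ k) ^+ 2 <= q ^+ k by rewrite expr2 ger_pMl// exprn_ile1// ltW.
  lra.
pose k2 := maxn k0 k1.
exists (e * (2 ^+ k2 + 2)) => T t T1 /andP[Tt tT].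
have T0 : 0 <= T by lra.
have t0 : 0 <= t by lra.
have [k [k2k kn kle]] := dyadic_above k2 (Num.truncn T).+1.
have k0k : (k0 <= k)%N by rewrite (leq_trans _ k2k)// leq_maxl.
have k1k : (k1 <= k)%N by rewrite (leq_trans _ k2k)// leq_maxr.
have /andP[a1 a2] := truncn_itv T0; have /andP[b1 b2] := truncn_itv t0.
set N := Num.truncn T in a1 a2 kn kle *; set N' := Num.truncn t in b1 b2 *.
have NT : N.+1%:R <= 2 ^+ k :> R by rewrite -natrX ler_nat.
have hT := chain k T k0k; have ht := chain k t k0k.
rewrite T0 (lt_le_trans a2 NT)/= -/N in hT; rewrite t0/= -/N' in ht.
have {}hT := hT isT; have {}ht := ht (le_lt_trans tT (lt_le_trans a2 NT)).
have P0 : 0 < B k * q ^+ k by rewrite mulr_gt0.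
have hN : `|w N%:R - w N'%:R| <= B k * q ^+ k.
  have N'N : (N' <= N)%N by rewrite -ltnS -(ltr_nat R); lra.
  have NN' : (N <= N'.+1)%N.
    by rewrite -ltnS -(ltr_nat R) -natr1; lra.
  have [->|hne] := eqVneq N N'; first by rewrite subrr normr0 ltW.
  have -> : N = N'.+1.
    by apply/eqP; rewrite eqn_leq NN' ltn_neqAle eq_sym hne N'N.
  have := hinc k 0%N N' k0k; rewrite expr0 mulr1 /incr /grid /mesh expr0 invr1 !mulr1; apply.
  by rewrite add0n (leq_ltn_trans N'N kn).
have : `|w T - w t| <= 21 * (B k * q ^+ k).
  have -> : w T - w t = (w T - w N%:R) + (w N%:R - w N'%:R) - (w t - w N'%:R) by ring.
  apply: (le_trans (ler_normB _ _)).
  have := ler_normD (w T - w N%:R) (w N%:R - w N'%:R); lra.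
move=> hTt.
have : `|w T - w t| ^+ 2 <= (21 * (B k * q ^+ k)) ^+ 2.
  by rewrite ler_sqr ?nnegrE ?normr_ge0// mulr_ge0// ltW.
rewrite real_normK ?num_real// => /le_trans; apply.
have -> : (21 * (B k * q ^+ k)) ^+ 2 = 441 * (2 ^+ k * (q ^+ k) ^+ 2).
  by rewrite -B2; ring.
have : 2 ^+ k <= 2 ^+ k2 + 2 * (T + 1) :> R.
  have : (2 ^ k)%:R <= (2 ^ k2 + 2 * N.+1)%:R :> R by rewrite ler_nat.
  rewrite natrD natrM !natrX => /le_trans; apply.
  by rewrite lerD2l ler_wpM2l// -natr1 lerD2r.
move=> hk; have p2 : 0 < 2 ^+ k :> R by exact: exprn_gt0.
have := ler_wpM2r (ltW p2) (hk1 _ k1k).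
have := ler_wpM2l (ltW e0) hk.
have : 0 <= e * 2 ^+ k2 by rewrite mulr_ge0 ?(ltW e0)// exprn_ge0.
lra.
Qed.

End Dyadic.

(** * Ornstein-Uhlenbeck paths driven by a Brownian-like path *)

Section Deterministic.
Variable R : realType.
Implicit Types (w D F V X : R -> R) (lam theta rho : R).

Definition linear_structure_function w := forall m L,
  has_mean (fun k => (grid w m (k + L)%N - grid w m k) ^+ 2) (L%:R * mesh R m).

(** The almost sure properties of a Brownian path on which everything else
    rests. *)
Record brownian_like w : Prop := BrownianLike {
  bl_continuous : continuous w;
  bl_start : w 0 = 0;
  bl_structure : linear_structure_function w;
  bl_variation : quadratic_variation_bounded w;
  bl_oscillation : unit_oscillation_sublinear w }.

Lemma mean_incr_sqr w m : brownian_like w ->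
  has_mean (fun k => incr w m k ^+ 2) (mesh R m).
Proof.
move=> bw; have := bl_structure bw m 1%N; rewrite mul1r.
by apply: eq_has_mean => k; rewrite addn1.
Qed.

Lemma mean_incr_prod w m l : brownian_like w ->
  has_mean (fun k => incr w m k * incr w m (k + l.+1)%N) 0.
Proof.
move=> bw; have := has_mean_increments (bl_structure bw m) l.
by apply: eq_has_mean => k; rewrite /incr addnS.
Qed.

Fixpoint euler lam h (f : nat -> R) k : R :=
  if k is k'.+1 then (1 + lam * h) * euler lam h f k' + h * f k' else 0.

(** The Euler scheme is run on the primitive of the path, whose equation is
    driven by [w] itself; its derivative [ou_euler] then solves the
    autoregression driven by the increments of [w]. *)
Definition ou_euler lam w m k : R := lam * euler lam (mesh R m) (grid w m) k + grid w m k.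

Lemma ou_eulerS lam w m k :
  ou_euler lam w m k.+1 = (1 + lam * mesh R m) * ou_euler lam w m k + incr w m k.
Proof. by rewrite /ou_euler /incr /=; ring. Qed.

Lemma euler_factor lam : lam < 0 -> exists m0, forall m, (m0 <= m)%N ->
  0 <= 1 + lam * mesh R m < 1.
Proof.
move=> lam0; have l0 : 0 < 1 / - lam by rewrite divr_gt0//; lra.
have [m0 h] := mesh_small l0; exists m0 => m /h.
rewrite ler_pdivlMr; last by lra.
by have := nmulr_rlt0 (mesh R m) lam0; rewrite mesh_gt0 => + hm; lra.
Qed.

Lemma mean_bounded_uniform (g : nat -> nat -> R) (c : nat -> R) (c0 : R) :
  (exists m0, forall m, (m0 <= m)%N -> has_mean (g m) (c m)) ->
  c m @[m --> \oo] --> c0 ->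
  exists2 B, 0 <= B & exists m0, forall m, (m0 <= m)%N -> exists K, forall n,
      \sum_(k < n) g m k <= K + B * n%:R.
Proof.
move=> [m1 hm] /cvgrPdist_le /(_ 1 ltr01) [m2 _ h2].
exists (`|c0| + 2); first by rewrite addr_ge0.
exists (maxn m1 m2) => m; rewrite geq_max => /andP[/hm h1 /h2 /= h3].
have [K hK] := h1 _ ltr01; exists K => n.
have := hK n; rewrite ler_norml => /andP[_ h4].
have : n%:R * c m <= n%:R * (`|c0| + 1).
  rewrite ler_wpM2l//; have := ler_norm c0; move: h3; rewrite ler_norml => /andP[]; lra.
lra.
Qed.

(** The stationary moments given by [ou_scheme] and [filter_scheme], with the
    common factor [h] cancelled so that they are continuous at [h = 0]. *)
Definition ou_mean lam h : R := (- (2 * lam) - lam ^+ 2 * h)^-1.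
Definition cross_mean theta rho h : R :=
  (1 + rho * h) * ou_mean rho h / (- theta - rho - theta * rho * h).
Definition filter_mean theta rho h : R :=
  (2 * (1 + theta * h) * cross_mean theta rho h + h * ou_mean rho h) /
  (- (2 * theta) - theta ^+ 2 * h).

Lemma cvg_ou_mean lam : lam < 0 ->
  ou_mean lam (mesh R m) @[m --> \oo] --> (- (2 * lam))^-1.
Proof.
move=> l0; apply: cvgV; first by rewrite gt_eqF//; lra.
rewrite -[X in _ --> X]subr0 -(mulr0 (lam ^+ 2)).
by apply: cvgB; [exact: cvg_cst|apply: cvgM; [exact: cvg_cst|exact: cvg_mesh]].
Qed.

Lemma cvg_cross_mean theta rho : theta < 0 -> rho < 0 ->
  cross_mean theta rho (mesh R m) @[m --> \oo] --> (2 * rho * (theta + rho))^-1.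
Proof.
move=> t0 r0.
have -> : (2 * rho * (theta + rho))^-1 =
  (1 + rho * 0) * (- (2 * rho))^-1 / (- theta - rho - theta * rho * 0).
  by field; lra.
have hm := @cvg_mesh R.
apply: cvgM; first (apply: cvgM; last exact: cvg_ou_mean).
  by apply: cvgD; [exact: cvg_cst|apply: cvgM => //; exact: cvg_cst].
apply: cvgV; first by rewrite gt_eqF//; lra.
by apply: cvgB; [exact: cvg_cst|apply: cvgM => //; exact: cvg_cst].
Qed.

Lemma cvg_filter_mean theta rho : theta < 0 -> rho < 0 ->
  filter_mean theta rho (mesh R m) @[m --> \oo] --> (- (2 * theta * rho * (theta + rho)))^-1.
Proof.
move=> t0 r0.
have -> : (- (2 * theta * rho * (theta + rho)))^-1 =
  (2 * (1 + theta * 0) * (2 * rho * (theta + rho))^-1 + 0 * (- (2 * rho))^-1) /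
    (- (2 * theta) - theta ^+ 2 * 0).
  by field; lra.
have hm := @cvg_mesh R.
apply: cvgM.
  apply: cvgD; apply: cvgM => //; [|exact: cvg_cross_mean|exact: cvg_ou_mean].
  apply: cvgM; first exact: cvg_cst.
  by apply: cvgD; [exact: cvg_cst|apply: cvgM => //; exact: cvg_cst].
apply: cvgV; first by rewrite gt_eqF//; lra.
by apply: cvgB; [exact: cvg_cst|apply: cvgM => //; exact: cvg_cst].
Qed.

Lemma mean_ou_euler lam w : lam < 0 -> brownian_like w ->
  exists m0, forall m, (m0 <= m)%N ->
    (forall l, has_mean (fun k => ou_euler lam w m k * incr w m (k + l)%N) 0) /\
    has_mean (fun k => ou_euler lam w m k ^+ 2) (ou_mean lam (mesh R m)).
Proof.
move=> l0 bw; have [m0 h] := euler_factor l0; exists m0 => m /h a01.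
have [_ h1 h2] := ou_scheme a01 (ou_eulerS lam w m) (mean_incr_sqr m bw)
  (fun l => mean_incr_prod m l bw).
split => //.
have -> : ou_mean lam (mesh R m) = mesh R m / (1 - (1 + lam * mesh R m) ^+ 2) => //.
have m0' := mesh_gt0 R m; set x := mesh R m in a01 m0' *.
rewrite /ou_mean.
have -> : 1 - (1 + lam * x) ^+ 2 = x * (- (2 * lam) - lam ^+ 2 * x) by ring.
rewrite invfM mulrA mulfV ?mul1r//; lra.
Qed.

Definition ou_path lam w D :=
  forall t, 0 <= t -> D t = lam * integral_on D 0 t + w t.

Lemma approximable_ou lam w D : lam < 0 -> brownian_like w -> continuous D ->
  ou_path lam w D -> approximable D (ou_euler lam w).
Proof.
move=> l0 bw cD hD; have cw := bl_continuous bw.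
pose Y := integral_on D 0; have cY : continuous Y by exact: continuous_integral_on.
have hY t : 0 <= t -> Y t = integral_on (fun s => lam * Y s + w s) 0 t.
  by move=> t0; apply: eq_integral_on => x /andP[x0 _]; exact: hD.
have [m1 hm1] := mean_ou_euler l0 bw.
have [||B B0 hB] := @mean_bounded_uniform (fun m k => ou_euler lam w m k ^+ 2)
   (fun m => ou_mean lam (mesh R m)) (- (2 * lam))^-1.
- by exists m1 => m /hm1[].
- exact: cvg_ou_mean.
have aw := approximable_grid cw (bl_variation bw).
have aY : approximable Y (fun m => euler lam (mesh R m) (grid w m)).
  by apply: (@approximable_filter _ lam w Y (grid w) _ B).
have := approximable_lin lam 1 cY cw aY aw.
move=> h eta /h[m0 hm0]; exists m0 => m /hm0[K hK]; exists K => n.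
apply: le_trans (hK n); rewrite /step_err.
rewrite le_eqVlt; apply/orP; left; apply/eqP; apply: eq_bigr => k _.
apply: eq_integral_on => x /andP[kx _].
rewrite hD; first by rewrite /ou_euler !mul1r.
by apply: le_trans kx; rewrite mulr_ge0// ltW// mesh_gt0.
Qed.

Lemma time_mean_ou lam w D : lam < 0 -> brownian_like w -> continuous D ->
  ou_path lam w D -> time_mean (fun t => D t ^+ 2) (- (2 * lam))^-1.
Proof.
move=> l0 bw cD hD.
apply: (time_mean_approx cD (approximable_ou l0 bw cD hD)) (cvg_ou_mean l0).
by have [m0 h] := mean_ou_euler l0 bw; exists m0 => m /h[].
Qed.

(** The two-stage system: [V] is driven by the noise, [X] by [V]. Its Euler
    scheme filters the scheme of [V], so that equal rates [theta = rho] need no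
    separate treatment. *)
Section Filter.
Variables (theta rho : R) (w V X : R -> R).
Hypotheses (theta0 : theta < 0) (rho0 : rho < 0) (bw : brownian_like w).
Hypotheses (cV : continuous V) (cX : continuous X).
Hypothesis hV : ou_path rho w V.
Hypothesis hX : ou_path theta V X.

Let Sig := integral_on X 0.
Let v := ou_euler rho w.
Let s m := euler theta (mesh R m) (v m).

Lemma filter_primitive t : 0 <= t ->
  Sig t = integral_on (fun u => theta * Sig u + V u) 0 t.
Proof. by move=> t0; apply: eq_integral_on => x /andP[x0 _]; exact: hX. Qed.

Lemma mean_filter_euler : exists m0, forall m, (m0 <= m)%N ->
  has_mean (fun k => s m k * v m k) (cross_mean theta rho (mesh R m)) /\
  has_mean (fun k => s m k ^+ 2) (filter_mean theta rho (mesh R m)).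
Proof.
have [m1 h1] := mean_ou_euler rho0 bw; have [m2 h2] := euler_factor theta0.
have [m3 h3] := euler_factor rho0.
exists (maxn m1 (maxn m2 m3)) => m; rewrite !geq_max => /and3P[/h1[p1 p2] /h2 b01 /h3 a01].
have := filter_scheme a01 b01 (ou_eulerS rho w m)
  (fun k => erefl : s m k.+1 = _) (mean_incr_sqr m bw) p2 p1.
cbv zeta.
set x := mesh R m in a01 b01 *; have x0 : 0 < x by exact: mesh_gt0.
have -> : x * (1 + rho * x) * ou_mean rho x / (1 - (1 + rho * x) * (1 + theta * x)) =
   cross_mean theta rho x.
  rewrite /cross_mean.
  have -> : 1 - (1 + rho * x) * (1 + theta * x) = x * (- theta - rho - theta * rho * x) by ring.
  set y := _ - _ - _.
  rewrite -!mulrA [x * _]mulrC -!mulrA; congr (_ * (_ * _)).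
  by rewrite invfM mulrC mulrA mulfV ?mul1r//; lra.
have -> // : (2 * (1 + theta * x) * x * cross_mean theta rho x + x ^+ 2 * ou_mean rho x) /
    (1 - (1 + theta * x) ^+ 2) = filter_mean theta rho x.
rewrite /filter_mean.
have -> : 1 - (1 + theta * x) ^+ 2 = x * (- (2 * theta) - theta ^+ 2 * x) by ring.
set y := - _ - _; set p := cross_mean _ _ _; set r := ou_mean _ _.
have -> : 2 * (1 + theta * x) * x * p + x ^+ 2 * r = x * (2 * (1 + theta * x) * p + x * r) by ring.
by rewrite invfM mulrACA mulfV ?mul1r//; lra.
Qed.

Let x m k := theta * s m k + 1 * v m k.
Let xmean h := theta ^+ 2 * filter_mean theta rho h + 2 * theta * cross_mean theta rho h + ou_mean rho h.

Lemma mean_x_euler : exists m0, forall m, (m0 <= m)%N ->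
  has_mean (fun k => x m k ^+ 2) (xmean (mesh R m)).
Proof.
have [m1 h1] := mean_ou_euler rho0 bw; have [m2 h2] := mean_filter_euler.
exists (maxn m1 m2) => m; rewrite !geq_max => /andP[/h1[_ p1] /h2[p2 p3]].
apply: eq_has_mean (has_meanD (has_meanD (has_meanZ (theta ^+ 2) p3) (has_meanZ (2 * theta) p2)) p1).
by move=> k /=; rewrite /x /v; ring.
Qed.

Lemma cvg_xmean : xmean (mesh R m) @[m --> \oo] --> (- (2 * (theta + rho)))^-1.
Proof.
have -> : (- (2 * (theta + rho)))^-1 = theta ^+ 2 * (- (2 * theta * rho * (theta + rho)))^-1
   + 2 * theta * (2 * rho * (theta + rho))^-1 + (- (2 * rho))^-1.
  have tr : theta + rho < 0 by have := theta0; have := rho0; lra.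
  by field; rewrite (lt_eqF rho0) (lt_eqF tr) (lt_eqF theta0).
apply: cvgD; last exact: cvg_ou_mean.
apply: cvgD; apply: cvgM; try exact: cvg_cst; [exact: cvg_filter_mean|exact: cvg_cross_mean].
Qed.

Lemma approximable_Sig : approximable Sig s.
Proof.
have [B B0 hB] := mean_bounded_uniform mean_x_euler cvg_xmean.
apply: (@approximable_filter _ theta V Sig v s B) => //.
- exact: continuous_integral_on.
- exact: filter_primitive.
- move: hB => [m0 h]; exists m0 => m /h[K hK]; exists K => n.
  by apply: le_trans (hK n); rewrite /x; under [leRHS]eq_bigr do rewrite mul1r.
- exact: approximable_ou.
Qed.

Lemma time_mean_Sig : time_mean (fun t => Sig t ^+ 2) (- (2 * theta * rho * (theta + rho)))^-1.
Proof.
apply: (time_mean_approx _ approximable_Sig) (cvg_filter_mean theta0 rho0).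
  exact: continuous_integral_on.
by have [m0 h] := mean_filter_euler; exists m0 => m /h[].
Qed.

Lemma time_mean_X : time_mean (fun t => X t ^+ 2) (- (2 * (theta + rho)))^-1.
Proof.
have cS : continuous Sig by exact: continuous_integral_on.
have h : time_mean (fun t => (theta * Sig t + 1 * V t) ^+ 2) (- (2 * (theta + rho)))^-1.
  apply: time_mean_approx mean_x_euler cvg_xmean.
    by apply: continuousDf; exact: continuousZf.
  exact: (approximable_lin theta 1 cS cV approximable_Sig (approximable_ou rho0 bw cV hV)).
apply: eq_sublinear_time h => T T1; congr (_ - _).
by apply: eq_integral_on => t /andP[t0 _]; rewrite mul1r hX.
Qed.

End Filter.

End Deterministic.

(** * Endpoint values *)

Section Pathwise.
Variable R : realType.
Implicit Types (w D F G X V : R -> R) (lam theta rho c : R).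

Lemma sublinear_time_window F c : continuous F -> (forall x, 0 <= F x) ->
  time_mean F c -> sublinear_time (fun T => integral_on F (T - 1) T).
Proof.
move=> cF F0 hF e e0; have e2 : 0 < e / 2 by lra.
have [K hK] := hF _ e2.
exists (2 * `|K| + 2 * `|c| + e) => T T1.
rewrite ger0_norm ?integral_on_ge0//.
have c1 := ler_norm c; have K1 := ler_norm K; have K0 := normr_ge0 K.
have c2 := ler_norm (- c); rewrite normrN in c2; have c0 := normr_ge0 c.
have := hK _ T1; rewrite ler_norml => /andP[l1 u1].
have [T2|T2] := leP 2 T.
  have T11 : 1 <= T - 1 by lra.
  have := hK _ T11; rewrite ler_norml => /andP[l2 u2].
  have T0 : 0 <= T - 1 by lra.
  have TT : T - 1 <= T by lra.
  have := integral_on_cat cF T0 TT; lra.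
have : integral_on F (T - 1) T <= integral_on F 0 T.
  by apply: ltr_subl_integral_on => //; lra.
have : T * c <= T * `|c| by rewrite ler_wpM2l//; lra.
have : T * `|c| <= 2 * `|c| by rewrite ler_wpM2r//; lra.
have := mulr_ge0 (ltW e0) (_ : 0 <= T).
move=> /(_ ltac:(lra)); lra.
Qed.

Lemma sublinear_time_le G G' : (forall T, 1 <= T -> `|G T| <= G' T) ->
  sublinear_time G' -> sublinear_time G.
Proof.
move=> GG' hG' e e0; have [K hK] := hG' _ e0; exists K => T T1.
exact: le_trans (GG' _ T1) (le_trans (ler_norm _) (hK _ T1)).
Qed.

(** The value at time [T] is, up to the oscillation of the noise, an average
    over the preceding unit window, whose energy is [o(T)] because the energy on
    [0, T] is asymptotically linear. *)
Lemma ou_endpoint lam w D c : continuous w -> unit_oscillation_sublinear w ->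
  continuous D -> ou_path lam w D -> time_mean (fun t => D t ^+ 2) c ->
  sublinear_time (fun T => D T ^+ 2).
Proof.
move=> cw hw cD hD hm; have cD2 := continuous_sqr cD.
have sq0 t : 0 <= D t ^+ 2 by exact: sqr_ge0.
have hW := sublinear_time_window cD2 sq0 hm.
have hW' := sublinear_timeZ (3 * (1 + lam ^+ 2)) hW.
move=> e e0; have e2 : 0 < e / 2 by lra.
have e6 : 0 < e / 6 by lra.
have [K hK] := hW' _ e2; have [K' hK'] := hw _ e6.
exists (K + 3 * K') => T T1; rewrite ger0_norm//.
have := hK _ T1; move/(le_trans (ler_norm _)).
set J := integral_on _ _ _ => hJ.
have T0 : 0 <= T by lra.
have TT : T - 1 <= T by lra.
have bound t : T - 1 <= t <= T ->
    D T ^+ 2 <= 3 * D t ^+ 2 + 3 * (lam ^+ 2 * J + K' + e / 6 * T).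
  move=> tT; have /andP[t1 t2] := tT; have t0 : 0 <= t by lra.
  have hw2 := hK' _ _ T1 tT.
  have DE : D T = D t + lam * integral_on D t T + (w T - w t).
    by rewrite (hD T)// (hD t)// (integral_on_cat cD t0 t2); ring.
  have : integral_on D t T ^+ 2 <= J.
    apply: (le_trans (sqr_integral_on cD t2)).
    have I0 : 0 <= integral_on (fun x => D x ^+ 2) t T by exact: integral_on_ge0.
    apply: (@le_trans _ _ (integral_on (fun x => D x ^+ 2) t T)).
      by rewrite ler_piMl//; lra.
    exact: ltr_subl_integral_on.
  move=> /(ler_wpM2l (sqr_ge0 lam)).
  rewrite DE; set a := D t; set b := integral_on _ _ _; set d := w T - w t.
  have := sqr_ge0 (a - lam * b); have := sqr_ge0 (a - d); have := sqr_ge0 (lam * b - d).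
  rewrite -/d in hw2; lra.
have : integral_on (fun=> D T ^+ 2) (T - 1) T <=
    integral_on (fun t => 3 * D t ^+ 2 + 3 * (lam ^+ 2 * J + K' + e / 6 * T)) (T - 1) T.
  apply: le_integral_on => //; first exact: continuous_cstf.
  by apply: continuousDf; [exact: continuousZf|exact: continuous_cstf].
rewrite integral_onD; [|exact: continuousZf|exact: continuous_cstf].
rewrite !integral_on_cst// integral_onZ// -/J; lra.
Qed.

Lemma sublinear_time_cvg G : sublinear_time G -> G T / T @[T --> +oo] --> 0.
Proof.
move=> hG; apply/cvgrPdist_le => e e0; have e2 : 0 < e / 2 by lra.
have [K hK] := hG _ e2.
near=> T.
have T1 : 1 <= T by near: T; apply: nbhs_pinfty_ge; exact: num_real.
have T0 : 0 < T by lra.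
rewrite sub0r normrN normrM normfV (ger0_norm (ltW T0)) ler_pdivrMr//.
apply: (le_trans (hK _ T1)).
have : K / (e / 2) <= T by near: T; apply: nbhs_pinfty_ge; exact: num_real.
rewrite ler_pdivrMr//; lra.
Unshelve. all: by end_near. Qed.

Lemma time_mean_cvg F c : time_mean F c -> integral_on F 0 T / T @[T --> +oo] --> c.
Proof.
move=> hF; have h := sublinear_time_cvg hF.
rewrite -[c]add0r.
apply: cvg_trans (_ : (integral_on F 0 T - T * c) / T + c @[T --> +oo] --> 0 + c).
  apply: near_eq_cvg; near=> T.
  have T0 : 0 < T by near: T; apply: nbhs_pinfty_gt; exact: num_real.
  by field; lra.
by apply: cvgD => //; exact: cvg_cst.
Unshelve. all: by end_near. Qed.

(** Since [(w (k + L) - w k) ^ 2] averages to [L] and is at most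
    [2 w (k + L) ^ 2 + 2 w k ^ 2], the mean square of [w] over the integers is at
    least [L / 4], for every [L]; passing from integers to the line costs a
    bounded amount per unit of time. *)
Lemma integral_sqr_superlinear w : brownian_like w -> forall M : R,
  exists T0 : R, forall T, T0 <= T -> M * T <= integral_on (fun t => w t ^+ 2) 0 T.
Proof.
move=> bw M; have cw := bl_continuous bw; have cw2 := continuous_sqr cw.
(* The factor [8] is what is lost between the [L]-step increments and the
   integral of [w ^ 2]; the additive constant exceeds three times the error
   [100] per unit of time in [step_err_grid] at mesh [1]. *)
pose L := (Num.truncn (8 * (`|M| + 310))).+1.
have hL : 8 * (`|M| + 310) <= L%:R.
  have M0 : 0 <= 8 * (`|M| + 310) by have := normr_ge0 M; lra.
  by have /andP[_ /ltW] := truncn_itv M0.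
have [K hK] := bl_structure bw 0%N L ltr01.
have [K' hK'] := step_err_grid 0%N cw (bl_variation bw).
have h1 : mesh R 0 = 1 by rewrite /mesh expr0 invr1.
rewrite h1 mulr1 in hK; rewrite h1 in hK'.
pose g := grid w 0.
have sumg n : n%:R * L%:R - K - n%:R <= 4 * \sum_(k < n + L) g k ^+ 2.
  have := hK n; rewrite ler_norml mul1r => /andP[lo _].
  have : \sum_(k < n) (g (k + L)%N - g k) ^+ 2 <=
      \sum_(k < n) (2 * g (k + L)%N ^+ 2 + 2 * g k ^+ 2).
    by apply: ler_sum => k _; have := sqr_ge0 (g (k + L)%N + g k); lra.
  rewrite big_split/= -!mulr_sumr.
  have : \sum_(k < n) g k ^+ 2 <= \sum_(k < n + L) g k ^+ 2.
    by rewrite big_split_ord/= lerDl sumr_ge0// => i _; exact: sqr_ge0.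
  have : \sum_(k < n) g (k + L)%N ^+ 2 <= \sum_(k < n + L) g k ^+ 2.
    rewrite addnC big_split_ord/=.
    under eq_bigr do rewrite addnC.
    by rewrite lerDr sumr_ge0// => i _; exact: sqr_ge0.
  move: lo; rewrite -/g; lra.
pose C := `|K| + 3 * `|K'| + L%:R * L%:R + 400 * L%:R + `|M| + 400.
exists (C + L%:R + 1) => T hT.
have L0 : 0 <= L%:R :> R by [].
have LL := mulr_ge0 L0 L0.
have K0 := normr_ge0 K; have K0' := normr_ge0 K'; have M0 := normr_ge0 M.
have C0 : 0 <= C by rewrite /C; lra.
have T0 : 0 <= T by lra.
have /andP[] := truncn_itv T0; set N := Num.truncn T => n1 n2.
rewrite -natr1 in n2.
have LN : (L <= N)%N by rewrite -ltnS -(ltr_nat R) -natr1; lra.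
have := sumg (N - L)%N; rewrite subnK// natrB//.
have := step_err_mean g N ltr01 (_ : 0 < 2^-1) cw.
move=> /(_ ltac:(lra)); rewrite mulr1 mul1r invrK.
rewrite ler_norml => /andP[lo _].
have := hK' N; rewrite !mulr1 -/g => e1 s1.
have := @ger_integral_on R _ 0 N%:R T cw2 (fun x => sqr_ge0 (w x)) n1.
have K1 := ler_norm K; have K1' := ler_norm K'; have M1 := ler_norm M.
have s2 : N%:R * (8 * (`|M| + 310)) <= N%:R * L%:R by rewrite ler_wpM2l.
have MT : M * T <= `|M| * T by rewrite ler_wpM2r.
have MN : `|M| * T <= `|M| * (N%:R + 1) by rewrite ler_wpM2l// ltW.
have hN : C <= 5 * N%:R by lra.
rewrite /C in hN.
lra.
Qed.

Lemma oscillation_windows w : unit_oscillation_sublinear w -> forall H : nat,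
  forall e : R, 0 < e -> exists K : R, forall T t, H%:R <= T ->
    T - H%:R <= t <= T -> (w T - w t) ^+ 2 <= K + e * T.
Proof.
move=> hw; elim=> [|H IH] e e0.
  exists 0 => T t T0; rewrite subr0 => /andP[t1 t2].
  by rewrite (@le_anti _ _ t T) ?t2// subrr expr0n/= add0r mulr_ge0// ltW.
have e4 : 0 < e / 4 by lra.
have [K1 h1] := IH _ e4; have [K2 h2] := hw _ e4.
exists (2 * `|K1| + 2 * `|K2|) => T t; rewrite -natr1 => HT /andP[t1 t2].
have H0 : 0 <= H%:R :> R by [].
have K10 := ler_norm K1; have K20 := ler_norm K2.
have K1p := normr_ge0 K1; have K2p := normr_ge0 K2.
have eT : 0 <= e * T by rewrite mulr_ge0// ?ltW//; lra.
have T1 : 1 <= T by lra.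
have [tT|tT] := leP (T - 1) t.
  have /(h2 _ _ T1) : T - 1 <= t <= T by rewrite tT t2.
  lra.
have /(h2 _ _ T1) q1 : T - 1 <= T - 1 <= T by lra.
have HT1 : H%:R <= T - 1 by lra.
have /(h1 _ _ HT1) q2 : T - 1 - H%:R <= t <= T - 1 by lra.
have := sqr_ge0 ((w T - w (T - 1)) - (w (T - 1) - w t)); lra.
Qed.

(** On a window of length [H] before [T] the path stays close to [w T], so
    [H * w T ^ 2] is at most about twice the integral over that window; then [H]
    is arbitrary. *)
Lemma endpoint_negligible w : brownian_like w -> forall e : R, 0 < e ->
  exists T0 : R, forall T, T0 <= T -> w T ^+ 2 <= e * integral_on (fun t => w t ^+ 2) 0 T.
Proof.
move=> bw e e0; have cw := bl_continuous bw; have cw2 := continuous_sqr cw.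
pose H := (Num.truncn (4 / e)).+1.
have hH : 4 / e <= H%:R.
  by have /truncn_itv/andP[_ /ltW//] : 0 <= 4 / e by rewrite divr_ge0// ltW.
have H0 : 0 < H%:R :> R by rewrite ltr0n.
have [K hK] := oscillation_windows (bl_oscillation bw) H ltr01.
have [T0 hT0] := integral_sqr_superlinear bw (8 / e).
exists (Num.max T0 (Num.max H%:R `|K|)) => T; rewrite !ge_max => /and3P[t0 tH tK].
have := hT0 _ t0; set I := integral_on _ _ _ => hI.
have TH0 : 0 <= T - H%:R by lra.
have TH : T - H%:R <= T by lra.
have : integral_on (fun=> w T ^+ 2) (T - H%:R) T <=
   integral_on (fun t => 2 * w t ^+ 2 + 2 * (K + T)) (T - H%:R) T.
  apply: le_integral_on => [| |t tT].
  - exact: continuous_cstf.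
  - by apply: continuousDf; [exact: continuousZf|exact: continuous_cstf].
  have := hK _ _ tH tT; rewrite mul1r => h.
  by have := sqr_ge0 (w T - 2 * w t); lra.
rewrite integral_onD; [|exact: continuousZf|exact: continuous_cstf].
rewrite !integral_on_cst// integral_onZ//.
have := ltr_subl_integral_on cw2 (fun x => sqr_ge0 (w x)) TH0 TH.
rewrite -/I; set J := integral_on _ _ _ => JI.
have -> : T - (T - H%:R) = H%:R by ring.
move=> h.
have I0 : 0 <= I by apply: integral_on_ge0 => x; exact: sqr_ge0.
have K1 := ler_norm K.
have hI' : 8 * T <= e * I.
  have := ler_wpM2l (ltW e0) hI.
  by have -> : e * (8 / e * T) = 8 * T by field; lra.
have hH' : 4 * I <= e * H%:R * I.
  by rewrite ler_wpM2r// mulrC -ler_pdivrMr.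
rewrite -(ler_pM2r H0); apply: (le_trans h).
have := ler_wpM2r (ltW H0) hI'.
have := ler_wpM2r (ltW H0) (le_trans K1 tK).
lra.
Qed.

End Pathwise.

(** * Convergence of the estimators along a path *)

Section Estimators.
Variable R : realType.
Implicit Types (w v x : R -> R) (theta rho c : R).

Lemma near_pinfty_gt0 : \forall T \near +oo, (0 : R) < T.
Proof. by apply: nbhs_pinfty_gt; exact: num_real. Qed.

(** Both estimators are quotients of this shape, with an energy [B] that grows
    linearly and an endpoint term [A] that is [o(T)]. *)
Lemma cvg_quotient (A B : R -> R) c : c != 0 ->
  A T / T @[T --> +oo] --> 0 -> B T / T @[T --> +oo] --> c ->
  (A T - T) / (2 * B T) @[T --> +oo] --> - (2 * c)^-1.
Proof.
move=> c0 hA hB.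
have -> : - (2 * c)^-1 = (0 - 1) / (2 * c) by rewrite sub0r mulN1r.
apply: cvg_trans (_ : (A T / T - 1) / (2 * (B T / T)) @[T --> +oo] --> (0 - 1) / (2 * c)).
  apply: near_eq_cvg; near=> T.
  have T0 : 0 < T by near: T; exact: near_pinfty_gt0.
  have -> : A T / T - 1 = (A T - T) / T by field; lra.
  by rewrite (mulrA 2) invf_div mulrA divfK//; lra.
apply: cvgM; first by apply: cvgB => //; exact: cvg_cst.
by apply: cvgV; [rewrite mulf_neq0|apply: cvgM => //; exact: cvg_cst].
Unshelve. all: by end_near. Qed.

Lemma theta_hat_cvg x a : a != 0 -> sublinear_time (fun T => x T ^+ 2) ->
  time_mean (fun t => x t ^+ 2) a -> theta_hat x T @[T --> +oo] --> - (2 * a)^-1.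
Proof.
move=> a0 hx hm.
exact: (cvg_quotient a0 (sublinear_time_cvg hx) (time_mean_cvg hm)).
Qed.

Lemma integral_residual x (th T : R) : continuous x -> 0 <= T ->
  integral_on (fun t => (x t - th * integral_on x 0 t) ^+ 2) 0 T =
  integral_on (fun t => x t ^+ 2) 0 T - th * integral_on x 0 T ^+ 2 +
  th ^+ 2 * integral_on (fun t => integral_on x 0 t ^+ 2) 0 T.
Proof.
move=> cx T0; have cS := continuous_integral_on cx.
have cxS := continuousMf cS cx.
have cS2 := continuous_sqr cS; have cx2 := continuous_sqr cx.
rewrite (@eq_integral_on _ _ (fun t => (x t ^+ 2 + (- (2 * th)) * (integral_on x 0 t * x t))
   + th ^+ 2 * integral_on x 0 t ^+ 2)).
  rewrite integral_onD; [|by apply: continuousDf => //; exact: continuousZf|exact: continuousZf].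
  rewrite integral_onD//; last exact: continuousZf.
  by rewrite !integral_onZ// (sqr_primitive cx T0); ring.
by move=> t _; ring.
Qed.

(** Expanding the squared residuals, [integral_residual], leaves the energies
    of [X] and of its primitive [S], and the endpoint [S T]. The energy of
    [V = X - theta S] expands in the same way, and comparing the three limits
    gives [S T ^ 2 = o(T)]. *)
Lemma estimators_cvg_stable theta rho w v x : theta < 0 -> rho < 0 ->
  brownian_like w -> continuous v -> continuous x ->
  ou_path rho w v -> ou_path theta v x ->
  theta_hat x T @[T --> +oo] --> theta + rho /\
  rho_hat x T @[T --> +oo] -->
    theta * rho * (theta + rho) / ((theta + rho) ^+ 2 + theta * rho).
Proof.
move=> t0 r0 bw cv cx hv hx.
have tr : theta + rho < 0 by lra.
pose S := integral_on x 0.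
have cS : continuous S by exact: continuous_integral_on.
pose a := (- (2 * (theta + rho)))^-1.
pose b := (- (2 * theta * rho * (theta + rho)))^-1.
have mV := time_mean_ou r0 bw cv hv.
have mX := time_mean_X t0 r0 bw cv cx hv hx; rewrite -/a in mX.
have mS := time_mean_Sig t0 r0 bw cv cx hv hx; rewrite -/b in mS.
have eV := ou_endpoint (bl_continuous bw) (bl_oscillation bw) cv hv mV.
have eS : sublinear_time (fun T => S T ^+ 2).
  have h := sublinear_timeD (sublinear_timeD mX (sublinear_timeZ (theta ^+ 2) mS))
    (sublinear_timeZ (-1) mV).
  apply: eq_sublinear_time (sublinear_timeZ theta^-1 h) => T T1.
  have T0 : 0 <= T by lra.
  have -> : integral_on (fun t => v t ^+ 2) 0 T =
     integral_on (fun t => (x t - theta * integral_on x 0 t) ^+ 2) 0 T.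
    apply: eq_integral_on => t /andP[tt _]; rewrite (hx t)//.
    by congr (_ ^+ 2); ring.
  rewrite integral_residual// -/S /a /b.
  by field; rewrite (lt_eqF t0) (lt_eqF r0) (lt_eqF tr).
have eX : sublinear_time (fun T => x T ^+ 2).
  have h := sublinear_timeD (sublinear_timeZ (2 * theta ^+ 2) eS) (sublinear_timeZ 2 eV).
  apply: sublinear_time_le h => T T1; rewrite ger0_norm ?sqr_ge0//.
  rewrite (hx T); last by lra.
  by have := sqr_ge0 (theta * S T - v T); rewrite -/(S T); lra.
have eXS : sublinear_time (fun T => x T * S T).
  have h := sublinear_timeD (sublinear_timeZ 2^-1 eX) (sublinear_timeZ 2^-1 eS).
  apply: sublinear_time_le h => T T1; rewrite ler_norml.
  have := sqr_ge0 (x T + S T); have := sqr_ge0 (x T - S T).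
  by move=> h1 h2; apply/andP; split; lra.
have a0 : a != 0 by rewrite invr_eq0 oppr_eq0 mulf_neq0// lt_eqF.
have th : theta_hat x T @[T --> +oo] --> theta + rho.
  have -> : theta + rho = - (2 * a)^-1 by rewrite /a; field; rewrite (lt_eqF tr).
  exact: theta_hat_cvg.
split => //.
pose q T := theta_hat x T.
have hq : q T @[T --> +oo] --> theta + rho by [].
have q2 : q T ^+ 2 @[T --> +oo] --> (theta + rho) ^+ 2.
  by apply: (cvg_comp q (fun y => y ^+ 2)); [exact: hq|exact: exprn_continuous].
have cX := sublinear_time_cvg eX; have cS2 := sublinear_time_cvg eS.
have cXS := sublinear_time_cvg eXS.
have cIX := time_mean_cvg mX; have cIS := time_mean_cvg mS.
have -> : theta * rho * (theta + rho) / ((theta + rho) ^+ 2 + theta * rho) =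
   - (2 * (a - (theta + rho) * 0 + (theta + rho) ^+ 2 * b))^-1.
  have P : 0 < (theta + rho) ^+ 2 + theta * rho.
    by rewrite ltr_wpDl ?sqr_ge0// nmulr_rgt0.
  have -> : a - (theta + rho) * 0 + (theta + rho) ^+ 2 * b =
    - ((theta + rho) ^+ 2 + theta * rho) / (2 * theta * rho * (theta + rho)).
    by rewrite /a /b; field; rewrite (lt_eqF t0) (lt_eqF r0) (lt_eqF tr).
  by field; rewrite (lt_eqF t0) (lt_eqF r0) (lt_eqF tr) (gt_eqF P).
have cB : integral_on (fun t => V_hat x T t ^+ 2) 0 T / T @[T --> +oo] -->
    a - (theta + rho) * 0 + (theta + rho) ^+ 2 * b.
  apply: cvg_trans (_ : integral_on (fun t => x t ^+ 2) 0 T / T - q T * (S T ^+ 2 / T)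
     + q T ^+ 2 * (integral_on (fun t => S t ^+ 2) 0 T / T) @[T --> +oo] --> _).
    apply: near_eq_cvg; near=> T.
    have T0 : 0 < T by near: T; exact: near_pinfty_gt0.
    by rewrite /V_hat [in RHS](integral_residual (theta_hat x T) cx (ltW T0)) -/(q T) -/S; ring.
  by apply: cvgD; [apply: cvgB => //; exact: cvgM|exact: cvgM].
have cA : V_hat x T T ^+ 2 / T @[T --> +oo] --> 0.
  have -> : (0 : R) = 0 - 2 * (theta + rho) * 0 + (theta + rho) ^+ 2 * 0 by ring.
  apply: cvg_trans (_ : x T ^+ 2 / T - 2 * q T * (x T * S T / T) + q T ^+ 2 * (S T ^+ 2 / T)
     @[T --> +oo] --> _).
    apply: near_eq_cvg; near=> T.
    by rewrite /V_hat -/(q T) /time_integral -/(integral_on x 0 T) -/(S T); ring.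
  apply: cvgD; last exact: cvgM.
  apply: cvgB => //; apply: cvgM => //; apply: cvgM => //; exact: cvg_cst.
apply: (cvg_quotient (A := fun T => V_hat x T T ^+ 2)
  (B := fun T => integral_on (fun t => V_hat x T t ^+ 2) 0 T)) cA cB.
have P : 0 < (theta + rho) ^+ 2 + theta * rho.
  by rewrite ltr_wpDl ?sqr_ge0// nmulr_rgt0.
have -> : a - (theta + rho) * 0 + (theta + rho) ^+ 2 * b =
  - ((theta + rho) ^+ 2 + theta * rho) / (2 * theta * rho * (theta + rho)).
  by rewrite /a /b; field; rewrite (lt_eqF t0) (lt_eqF r0) (lt_eqF tr).
by rewrite mulf_neq0 ?oppr_eq0 ?(gt_eqF P)// invr_eq0 !mulf_neq0// lt_eqF.
Unshelve. all: by end_near. Qed.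

(** When [rho = 0] the residual is [k * W + (1 - k) * X] with
    [k = theta_hat / theta] close to [1]. It inherits from [W] an energy that
    dominates both [T] and the square of the endpoint, whence the limit [0]. *)
Lemma estimators_cvg_critical theta w v x : theta < 0 ->
  brownian_like w -> continuous x -> ou_path 0 w v -> ou_path theta v x ->
  theta_hat x T @[T --> +oo] --> theta /\ rho_hat x T @[T --> +oo] --> (0 : R).
Proof.
move=> t0 bw cx hv hx; have cw := bl_continuous bw.
have {}hx : ou_path theta w x by move=> t tt; rewrite hx// hv// mul0r add0r.
pose S := integral_on x 0.
have cS : continuous S by exact: continuous_integral_on.
have mX := time_mean_ou t0 bw cx hx; set a := (- (2 * theta))^-1 in mX.
have eX := ou_endpoint cw (bl_oscillation bw) cx hx mX.
have a0 : a != 0 by rewrite invr_eq0 oppr_eq0 mulf_neq0// lt_eqF.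
have th : theta_hat x T @[T --> +oo] --> theta.
  have -> : theta = - (2 * a)^-1 by rewrite /a; field; rewrite (lt_eqF t0).
  exact: theta_hat_cvg.
split => //.
pose k T := theta_hat x T / theta.
have hk : k T @[T --> +oo] --> (1 : R).
  have tn0 : theta != 0 by rewrite lt_eqF.
  rewrite -(mulfV tn0).
  by apply: cvgM => //; exact: cvg_cst.
have VE T t : 0 <= t -> V_hat x T t = k T * w t + (1 - k T) * x t.
  move=> tt; rewrite /V_hat /time_integral -/(integral_on x 0 t).
  have -> : integral_on x 0 t = (x t - w t) / theta by rewrite (hx t)//; field; rewrite lt_eqF.
  by rewrite /k; field; rewrite lt_eqF.
have cV T : continuous (V_hat x T).
  by apply: continuousBf => //; exact: continuousZf.
apply/cvgrPdist_le => e e0.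
pose Iw T := integral_on (fun t => w t ^+ 2) 0 T.
pose Ix T := integral_on (fun t => x t ^+ 2) 0 T.
have cX := sublinear_time_cvg eX; have cIX := time_mean_cvg mX.
(* The first part of [M] makes the energy of [w] dominate that of [x], the
   second makes it dominate [T] by the factor [24 / e]. *)
pose M := 8 * (`|a| + 1) + 8 * 3 / e.
have c0 := normr_ge0 a.
have M0 : 0 <= M by rewrite /M addr_ge0 ?mulr_ge0 ?divr_ge0 ?addr_ge0 ?invr_ge0// ltW.
have [T1 hT1] := integral_sqr_superlinear bw M.
have e16 : 0 < e / 32 by lra.
have [T2 hT2] := endpoint_negligible bw e16.
near=> T.
have T0 : 0 < T by near: T; exact: near_pinfty_gt0.
have k1 : `|1 - k T| <= 1 / 4.
  near: T; move/cvgrPdist_le : hk => /(_ (1 / 4)); apply; lra.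
have x1 : `|0 - x T ^+ 2 / T| <= 1.
  by near: T; move/cvgrPdist_le : cX => /(_ 1 ltr01).
have x2 : `|a - Ix T / T| <= 1.
  by near: T; move/cvgrPdist_le : cIX => /(_ 1 ltr01).
have hI : M * T <= Iw T.
  by apply: hT1; near: T; apply: nbhs_pinfty_ge; exact: num_real.
have hw : w T ^+ 2 <= e / 32 * Iw T.
  by apply: hT2; near: T; apply: nbhs_pinfty_ge; exact: num_real.
have {}x1 : x T ^+ 2 <= T.
  move: x1; rewrite sub0r normrN ger0_norm ?divr_ge0 ?sqr_ge0 ?(ltW T0)//.
  by rewrite ler_pdivrMr// mul1r.
have {}x2 : Ix T <= (`|a| + 1) * T.
  rewrite -ler_pdivrMr//; have := ler_norm a; move: x2; rewrite ler_norml => /andP[]; lra.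
set kk := k T in k1 *.
have /andP[k2 k3] : -(1/4) <= 1 - kk <= 1/4 by rewrite -ler_norml.
pose J := integral_on (fun t => V_hat x T t ^+ 2) 0 T.
have cw2 := continuous_sqr cw; have cx2 := continuous_sqr cx.
have kk2 : 1 / 2 <= kk ^+ 2 <= 2 by apply/andP; split; nra.
have kk3 : (1 - kk) ^+ 2 <= 1 / 2 by nra.
have hJ : Iw T / 8 <= J.
  have : integral_on (fun t => 4^-1 * w t ^+ 2 + (- 1) * x t ^+ 2) 0 T <= J.
    apply: le_integral_on => [| |t /andP[tt _]].
    - by apply: continuousDf; exact: continuousZf.
    - exact: continuous_sqr.
    rewrite VE// -/kk.
    have h1 : 1 / 2 * w t ^+ 2 <= kk ^+ 2 * w t ^+ 2 by rewrite ler_wpM2r ?sqr_ge0//; case/andP: kk2.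
    have h2 := ler_wpM2r (sqr_ge0 (x t)) kk3.
    have := sqr_ge0 (kk * w t + 2 * ((1 - kk) * x t)).
    have := sqr_ge0 (x t); lra.
  rewrite integral_onD; [|exact: continuousZf|exact: continuousZf].
  rewrite !integral_onZ// -/(Iw T) -/(Ix T).
  have : 8 * (`|a| + 1) * T <= M * T.
    rewrite ler_wpM2r ?(ltW T0)// /M lerDl divr_ge0// ?mulr_ge0// ltW//.
  lra.
have hV : V_hat x T T ^+ 2 <= 4 * w T ^+ 2 + T.
  rewrite VE ?(ltW T0)// -/kk.
  have h1 : kk ^+ 2 * w T ^+ 2 <= 2 * w T ^+ 2 by rewrite ler_wpM2r ?sqr_ge0//; case/andP: kk2.
  have h2 := ler_wpM2r (sqr_ge0 (x T)) kk3.
  have := sqr_ge0 (kk * w T - (1 - kk) * x T); lra.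
have eI : 24 * T <= e * Iw T.
  have := ler_wpM2l (ltW e0) hI.
  have : e * (8 * 3 / e * T) = 24 * T by field; rewrite gt_eqF.
  have : 0 <= e * (8 * (`|a| + 1) * T) by rewrite !mulr_ge0 ?addr_ge0 ?(ltW e0) ?(ltW T0).
  rewrite /M; lra.
have I0 : 0 < Iw T by rewrite -(pmulr_rgt0 _ e0); lra.
have J0 : 0 < J by lra.
rewrite sub0r normrN /rho_hat /time_integral -/(integral_on _ 0 T) -/J.
rewrite normrM normfV (gtr0_norm (_ : 0 < 2 * J)); last by lra.
rewrite ler_pdivrMr; last by lra.
have V0 := sqr_ge0 (V_hat x T T).
have eJ := ler_wpM2l (ltW e0) hJ.
rewrite ler_norml; apply/andP; split; lra.
Unshelve. all: by end_near. Qed.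

Lemma estimators_cvg theta rho w v x : theta < 0 -> rho <= 0 ->
  brownian_like w -> continuous v -> continuous x ->
  ou_path rho w v -> ou_path theta v x ->
  theta_hat x T @[T --> +oo] --> theta + rho /\
  rho_hat x T @[T --> +oo] -->
    theta * rho * (theta + rho) / ((theta + rho) ^+ 2 + theta * rho).
Proof.
move=> t0; rewrite le_eqVlt => /predU1P[->|r0] bw cv cx hv hx.
  rewrite addr0 !mulr0 !mul0r.
  exact: (estimators_cvg_critical t0 bw cx hv hx).
exact: (estimators_cvg_stable t0 r0 bw cv cx hv hx).
Qed.

End Estimators.

(** * Moments of centred normal laws *)

Section NormalMoments.
Variable R : realType.
Local Notation mu := (@lebesgue_measure R).
Implicit Types (s t : R).

Lemma ge0_integral_normal_prob s (f : R -> \bar R) : measurable_fun setT f ->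
  (forall x, 0 <= f x)%E ->
  (\int[normal_prob 0 s]_x f x = \int[mu]_x (f x * (normal_pdf 0 s x)%:E))%E.
Proof.
move=> mf f0.
have dom := @normal_prob_dominates R 0 s.
rewrite -(Radon_Nikodym_SigmaFinite.change_of_variables dom)//.
apply: ae_eq_integral => //.
- apply: emeasurable_funM => //.
  exact: (measurable_int _ (Radon_Nikodym_SigmaFinite.f_integrable dom)).
- apply: emeasurable_funM => //; apply/measurable_EFinP; exact: measurable_normal_pdf.
- have ae : ae_eq mu setT (Radon_Nikodym_SigmaFinite.f (normal_prob 0 s) mu)
      (fun x => (normal_pdf 0 s x)%:E).
    apply: integral_ae_eq => //.
    + exact: Radon_Nikodym_SigmaFinite.f_integrable.
    + by apply/measurable_EFinP; exact: measurable_normal_pdf.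
    + by move=> E _ mE; rewrite -Radon_Nikodym_SigmaFinite.f_integral.
  by apply: filterS ae => x /= h _; rewrite h.
Qed.

Let kappa : R := (Num.sqrt (pi *+ 2))^-1.

Lemma normal_pdf_scaled s x : 0 < s ->
  s * normal_pdf 0 s x = kappa * expR (- (x ^+ 2 / (2 * s ^+ 2))).
Proof.
move=> s0; rewrite normal_pdfE ?gt_eqF// /normal_peak /normal_fun subr0.
rewrite -mulrnAr sqrtrM ?sqr_ge0// sqrtr_sqr gtr0_norm// invfM.
rewrite mulrA mulVKf ?gt_eqF// /kappa; congr (_ * expR _).
by rewrite mulNr -[s ^+ 2 *+ 2]mulr_natl.
Qed.

Lemma kappa_ge0 : 0 <= kappa.
Proof. by rewrite invr_ge0 sqrtr_ge0. Qed.

Let A s : R := (2 * s ^+ 2)^-1.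

(** The derivative of the density in the scale parameter involves [x ^ 2];
    replacing it by a difference quotient, and using only [1 + y <= exp y],
    encloses [x ^ 2] times a density between differences of densities, whose
    integrals are known. *)
Lemma normal_pdf_compare s t x : 0 < s -> s < t ->
  s * normal_pdf 0 s x + (A s - A t) * s * (x ^+ 2 * normal_pdf 0 s x) <= t * normal_pdf 0 t x /\
  t * normal_pdf 0 t x <= s * normal_pdf 0 s x + (A s - A t) * t * (x ^+ 2 * normal_pdf 0 t x).
Proof.
move=> s0 st; have t0 : 0 < t by lra.
have -> : (A s - A t) * s * (x ^+ 2 * normal_pdf 0 s x) =
  (A s - A t) * x ^+ 2 * (s * normal_pdf 0 s x) by ring.
have -> : (A s - A t) * t * (x ^+ 2 * normal_pdf 0 t x) =
  (A s - A t) * x ^+ 2 * (t * normal_pdf 0 t x) by ring.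
rewrite !normal_pdf_scaled// -/(A s) -/(A t).
set y := (A s - A t) * x ^+ 2.
have E : expR (- (x ^+ 2 * A t)) = expR (- (x ^+ 2 * A s)) * expR y.
  by rewrite -expRD /y; congr expR; ring.
have E' : expR (- (x ^+ 2 * A s)) = expR (- (x ^+ 2 * A t)) * expR (- y).
  by rewrite -expRD /y; congr expR; ring.
have k0 := kappa_ge0; have es := expR_ge0 (- (x ^+ 2 * A s)).
have et := expR_ge0 (- (x ^+ 2 * A t)).
split.
  have := expR_ge1Dx y; rewrite E => /(ler_wpM2l (mulr_ge0 k0 es)); lra.
have := expR_ge1Dx (- y); rewrite E' => /(ler_wpM2l (mulr_ge0 k0 et)); lra.
Qed.

(** A Gaussian of twice the scale dominates [x ^ 4] times the density. *)
Lemma normal_pdf_compare4 s x : 0 < s ->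
  x ^+ 4 * normal_pdf 0 s x <= 64 * s ^+ 4 * normal_pdf 0 (2 * s) x.
Proof.
move=> s0; have t0 : 0 < 2 * s by lra.
rewrite -(ler_pM2l s0).
have -> : s * (x ^+ 4 * normal_pdf 0 s x) = x ^+ 4 * (s * normal_pdf 0 s x) by ring.
have -> : s * (64 * s ^+ 4 * normal_pdf 0 (2 * s) x) =
  32 * s ^+ 4 * (2 * s * normal_pdf 0 (2 * s) x) by ring.
rewrite !normal_pdf_scaled//.
pose y := x ^+ 2 * 3 / (16 * s ^+ 2).
have E : expR (- (x ^+ 2 / (2 * (2 * s) ^+ 2))) =
   expR (- (x ^+ 2 / (2 * s ^+ 2))) * expR y ^+ 2.
  by rewrite -expRM_natl -expRD /y; congr expR; rewrite -mulr_natl; field; lra.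
rewrite E; have k0 := kappa_ge0; have es := expR_ge0 (- (x ^+ 2 / (2 * s ^+ 2))).
have y0 : 0 <= y by apply: divr_ge0; apply: mulr_ge0 => //; exact: sqr_ge0.
have ey : y ^+ 2 <= expR y ^+ 2.
  rewrite ler_sqr ?nnegrE ?expR_ge0//; have := expR_ge1Dx y; lra.
have : 32 * s ^+ 4 * y ^+ 2 = 9 / 8 * x ^+ 4 by rewrite /y; field; lra.
have s4 : 0 <= 32 * s ^+ 4 by rewrite mulr_ge0// exprn_ge0// ltW.
move=> hy; have := ler_wpM2l s4 ey; rewrite hy.
move=> /(ler_wpM2l (mulr_ge0 k0 es)).
have x4 : 0 <= x ^+ 4 by rewrite (_ : 4%N = (2 * 2)%N)// exprM sqr_ge0.
have := mulr_ge0 (mulr_ge0 k0 es) x4.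
lra.
Qed.

Let meas_pdf k s : measurable_fun setT (fun x : R => k * normal_pdf 0 s x).
Proof. by apply: measurable_funM => //; exact: measurable_normal_pdf. Qed.

Let meas_pow k s n : measurable_fun setT (fun x : R => k * (x ^+ n * normal_pdf 0 s x)).
Proof.
apply: measurable_funM => //; apply: measurable_funM; first exact: exprn_measurable.
exact: measurable_normal_pdf.
Qed.

Let integral_nnD (f g : R -> R) : measurable_fun setT f -> measurable_fun setT g ->
  (forall x, 0 <= f x) -> (forall x, 0 <= g x) ->
  (\int[mu]_x (f x + g x)%:E = \int[mu]_x (f x)%:E + \int[mu]_x (g x)%:E)%E.
Proof.
move=> mf mg f0 g0; under eq_integral do rewrite EFinD.
rewrite ge0_integralD//; do ?[by move=> x _; rewrite lee_fin];
  exact/measurable_EFinP.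
Qed.

Let integral_nnZ k (f : R -> R) : 0 <= k -> measurable_fun setT f ->
  (forall x, 0 <= f x) ->
  (\int[mu]_x (k * f x)%:E = k%:E * \int[mu]_x (f x)%:E)%E.
Proof.
move=> k0 mf f0; under eq_integral do rewrite EFinM.
rewrite ge0_integralZl//; do ?[by move=> x _; rewrite lee_fin];
  exact/measurable_EFinP.
Qed.

Let le_integral_nn (f g : R -> R) : measurable_fun setT f -> measurable_fun setT g ->
  (forall x, 0 <= f x) -> (forall x, f x <= g x) ->
  (\int[mu]_x (f x)%:E <= \int[mu]_x (g x)%:E)%E.
Proof.
move=> mf mg f0 fg; apply: ge0_le_integral => //; do ?[by move=> x _; rewrite lee_fin];
  exact/measurable_EFinP.
Qed.

Let integral_pdfZ k s : 0 <= k -> (\int[mu]_x (k * normal_pdf 0 s x)%:E = k%:E)%E.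
Proof.
move=> k0; rewrite integral_nnZ//.
- by rewrite integral_normal_pdf mule1.
- exact: measurable_normal_pdf.
- by move=> x; rewrite normal_pdf_ge0.
Qed.

Let M2 s := (\int[mu]_x (x ^+ 2 * normal_pdf 0 s x)%:E)%E.

Let x2_ge0 s x : 0 <= x ^+ 2 * normal_pdf 0 s x.
Proof. by rewrite mulr_ge0 ?sqr_ge0 ?normal_pdf_ge0. Qed.

(** Letting [t] tend to [s] in [normal_pdf_compare], from above and from below. *)
Lemma normal_second_moment_pdf s : 0 < s -> M2 s = (s ^+ 2)%:E.
Proof.
move=> s0.
have Aneg p q : 0 < p -> p < q -> 0 < A p - A q.
  move=> p0 pq; have q0 : 0 < q by lra.
  rewrite subr_gt0 ltf_pV2 ?posrE ?mulr_gt0 ?exprn_gt0// ltr_pM2l//.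
  by rewrite ltr_pXn2r// nnegrE ltW.
have up t : s < t -> (s%:E + ((A s - A t) * s)%:E * M2 s <= t%:E)%E.
  move=> st; have t0 : 0 < t by lra.
  have a0 := ltW (Aneg _ _ s0 st).
  have as0 : 0 <= (A s - A t) * s by rewrite mulr_ge0// ltW.
  rewrite -(integral_pdfZ s (ltW s0)) -(integral_pdfZ t (ltW t0)) -integral_nnZ//; last first.
    by have := meas_pow 1 s 2; under eq_fun do rewrite mul1r.
  rewrite -integral_nnD//.
  - apply: le_integral_nn => // [|x|x].
    + exact: measurable_funD.
    + by rewrite addr_ge0// mulr_ge0// ?normal_pdf_ge0// ltW.
    + by have [] := normal_pdf_compare x s0 st.
  - by move=> x; rewrite mulr_ge0 ?normal_pdf_ge0// ltW.
  - by move=> x; rewrite mulr_ge0.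
have lo t : 0 < t -> t < s -> (s%:E <= t%:E + ((A t - A s) * s)%:E * M2 s)%E.
  move=> t0 ts; have a0 := ltW (Aneg _ _ t0 ts).
  have as0 : 0 <= (A t - A s) * s by rewrite mulr_ge0// ltW.
  rewrite -[X in (X <= _)%E](integral_pdfZ s (ltW s0)) -[X in (_ <= X + _)%E](integral_pdfZ t (ltW t0)).
  rewrite -integral_nnZ//; last first.
    by have := meas_pow 1 s 2; under eq_fun do rewrite mul1r.
  rewrite -integral_nnD//.
  - apply: le_integral_nn => // [|x|x].
    + exact: measurable_funD.
    + by rewrite mulr_ge0 ?normal_pdf_ge0// ltW.
    + by have [] := normal_pdf_compare x t0 ts.
  - by move=> x; rewrite mulr_ge0 ?normal_pdf_ge0// ltW.
  - by move=> x; rewrite mulr_ge0.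
have M0 : (0 <= M2 s)%E by apply: integral_ge0 => x _; rewrite lee_fin x2_ge0.
have [r Er] : exists r, M2 s = r%:E.
  have : (M2 s < +oo)%E.
    rewrite ltNge; apply/negP; rewrite leye_eq => /eqP E.
    have s2 : s < 2 * s by lra.
    have := up _ s2; rewrite E gt0_muley ?lte_fin ?mulr_gt0 ?Aneg//.
  move=> Moo; exists (fine (M2 s)); rewrite fineK// ge0_fin_numE//.
rewrite Er; congr EFin; apply/eqP; rewrite eq_le; apply/andP; split.
- apply/ler_addgt0Pr => e e0.
  (* With [t = s (1 + d)] the bound is [s ^ 2 * 2 (1 + d) ^ 2 / (2 + d)], at most
     [s ^ 2 (1 + 2 d)]; symmetrically below. *)
  pose d := e / (2 * s ^+ 2).
  have d0 : 0 < d by rewrite divr_gt0// mulr_gt0// ?exprn_gt0.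
  have st : s < s * (1 + d) by rewrite mulrDr mulr1 ltrDl mulr_gt0.
  have := up _ st; rewrite Er -EFinM -EFinD lee_fin => h.
  have AE : (A s - A (s * (1 + d))) * s = ((2 + d) * d) / (2 * s * (1 + d) ^+ 2).
    by rewrite /A; field; lra.
  have P : 0 < 2 * s * (1 + d) ^+ 2 by rewrite !mulr_gt0// ?exprn_gt0//; lra.
  have {}h : (2 + d) * d * r <= s * d * (2 * s * (1 + d) ^+ 2).
    rewrite -ler_pdivrMr// mulrAC -AE; lra.
  have -> : e = 2 * d * s ^+ 2 by rewrite /d; field; lra.
  have dd : 0 < (2 + d) * d by rewrite mulr_gt0//; lra.
  rewrite -(ler_pM2l dd); apply: (le_trans h).
  have : 0 <= s ^+ 2 * d ^+ 2 by rewrite mulr_ge0// sqr_ge0.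
  lra.
- apply/ler_addgt0Pr => e e0.
  pose d := Num.min (1 / 2) (e / (2 * s ^+ 2)).
  have s2 : 0 < 2 * s ^+ 2 by rewrite mulr_gt0// ?exprn_gt0.
  have d0 : 0 < d by rewrite lt_min !divr_gt0.
  have d1 : d <= 1 / 2 by rewrite ge_min lexx.
  have de : d * (2 * s ^+ 2) <= e by rewrite -ler_pdivlMr// ge_min lexx orbT.
  have ts : s * (1 - d) < s by rewrite mulrBr mulr1 ltrBlDr ltrDl mulr_gt0.
  have t0 : 0 < s * (1 - d) by rewrite mulr_gt0//; lra.
  have := lo _ t0 ts; rewrite Er -EFinM -EFinD lee_fin => h.
  have AE : (A (s * (1 - d)) - A s) * s = ((2 - d) * d) / (2 * s * (1 - d) ^+ 2).
    by rewrite /A; field; lra.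
  have P : 0 < 2 * s * (1 - d) ^+ 2 by rewrite !mulr_gt0// ?exprn_gt0//; lra.
  have {}h : s * d * (2 * s * (1 - d) ^+ 2) <= (2 - d) * d * r.
    rewrite -ler_pdivlMr// mulrAC -AE; lra.
  have dd : 0 < (2 - d) * d by rewrite mulr_gt0//; lra.
  apply: (@le_trans _ _ (r + d * (2 * s ^+ 2))); last by lra.
  rewrite -(ler_pM2l dd).
  have : 0 <= s ^+ 2 * d ^+ 2 by rewrite mulr_ge0// sqr_ge0.
  lra.
Qed.

Lemma normal_second_moment s : 0 < s ->
  (\int[normal_prob 0 s]_x (x ^+ 2)%:E = (s ^+ 2)%:E)%E.
Proof.
move=> s0; rewrite ge0_integral_normal_prob.
- by rewrite -normal_second_moment_pdf//; apply: eq_integral => x _; rewrite EFinM.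
- by apply/measurable_EFinP; exact: exprn_measurable.
- by move=> x; rewrite lee_fin sqr_ge0.
Qed.

Lemma normal_fourth_moment s : 0 < s ->
  (\int[normal_prob 0 s]_x (x ^+ 4)%:E <= (64 * s ^+ 4)%:E)%E.
Proof.
move=> s0; have x4 (x : R) : 0 <= x ^+ 4 by rewrite (_ : 4%N = (2 * 2)%N)// exprM sqr_ge0.
rewrite ge0_integral_normal_prob.
- have s4 : 0 <= 64 * s ^+ 4 by rewrite mulr_ge0.
  rewrite -(integral_pdfZ (2 * s) s4); under eq_integral do rewrite -EFinM.
  apply: le_integral_nn => // [|x|x].
  + by have := meas_pow 1 s 4; under eq_fun do rewrite mul1r.
  + by rewrite mulr_ge0 ?normal_pdf_ge0.
  + exact: normal_pdf_compare4.
- by apply/measurable_EFinP; exact: exprn_measurable.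
- by move=> x; rewrite lee_fin.
Qed.

End NormalMoments.

(** * Variance of sums with independent distant terms *)

Section Independence.
Context {d : measure_display} {Omega : measurableType d} {R : realType}.
Variable P : probability Omega R.

(** The joint law agrees with the product law on rectangles, hence everywhere,
    and Tonelli's theorem applies. *)
Lemma integral_prod_indep (X Y : {RV P >-> R}) (f g : R -> R) :
  (forall A B, measurable A -> measurable B ->
     P (X @^-1` A `&` Y @^-1` B) = (P (X @^-1` A) * P (Y @^-1` B))%E) ->
  measurable_fun setT f -> measurable_fun setT g ->
  (forall x, 0 <= f x) -> (forall x, 0 <= g x) ->
  (\int[P]_w (f (X w) * g (Y w))%:E =
   \int[P]_w (f (X w))%:E * \int[P]_w (g (Y w))%:E)%E.
Proof.
move=> ind mf g_m f0 g0.
have mfE : measurable_fun setT (EFin \o f) by exact/measurable_EFinP.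
have mgE : measurable_fun setT (EFin \o g) by exact/measurable_EFinP.
have mXY : measurable_fun setT (fun w => (X w, Y w)) by exact: measurable_fun_pair.
pose XY : {mfun Omega >-> (R * R)%type} :=
  HB.pack (fun w => (X w, Y w)) (isMeasurableFun.Build _ _ _ _ _ mXY).
pose F (z : R * R) := (f z.1 * g z.2)%:E.
have mF : measurable_fun setT F.
  apply/measurable_EFinP; apply: measurable_funM.
    exact: (measurableT_comp mf measurable_fst).
  exact: (measurableT_comp g_m measurable_snd).
have F0 z : (0 <= F z)%E by rewrite lee_fin mulr_ge0.
have -> : (\int[P]_w (f (X w) * g (Y w))%:E = \int[distribution P XY]_z F z)%E.
  by rewrite ge0_integral_distribution.
have -> : (\int[distribution P XY]_z F z = \int[distribution P X \x distribution P Y]_z F z)%E.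
  apply: eq_measure_integral => A mA _; apply/esym.
  apply: product_measure_unique => // B C mB mC.
rewrite fubini_tonelli1//= /fubini_F /F/=.
under eq_integral => x _.
  under eq_integral do rewrite EFinM.
  rewrite ge0_integralZl//=; last 2 first.
  - by move=> y _; rewrite lee_fin.
  - by rewrite lee_fin.
  rewrite ge0_integral_distribution//=.
  over.
rewrite /= ge0_integralZr//=; last 2 first.
- by move=> y _; rewrite lee_fin.
- by apply: integral_ge0 => y _; rewrite lee_fin.
by rewrite ge0_integral_distribution//= => y; rewrite lee_fin.
Qed.

Lemma sum_window_le (a b n : nat) : (\sum_(j < n) (a <= j < b) <= b - a)%N.
Proof.
suff -> : (\sum_(j < n) (a <= j < b) = minn n b - a)%N by lia.
elim: n => [|n IH]; first by rewrite big_ord0; lia.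
rewrite big_ord_recr/= IH; case: (ltnP n b) => nb; case: (leqP a n) => an /=; lia.
Qed.

(** Only the pairs at distance less than [L] contribute to the variance, and
    there are at most [2 * L] of them for each index. *)
Lemma variance_sum_le (Y : nat -> Omega -> R) (m C : R) (L n : nat) :
  (forall k, measurable_fun setT (Y k)) -> (forall k w, 0 <= Y k w) ->
  0 <= m -> 0 <= C ->
  (forall k, \int[P]_w (Y k w)%:E = m%:E)%E ->
  (forall k, \int[P]_w (Y k w ^+ 2)%:E <= C%:E)%E ->
  (forall k j, (k + L <= j)%N -> \int[P]_w (Y k w * Y j w)%:E = (m ^+ 2)%:E)%E ->
  (\int[P]_w ((\sum_(k < n) Y k w - n%:R * m) ^+ 2)%:E <= (2 * L%:R * C * n%:R)%:E)%E.
Proof.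
move=> mY Y0 m0 C0 hm hC hind.
have pair k j : (\int[P]_w (Y k w * Y j w)%:E <=
    (m ^+ 2 + C * ((k.+1 - L <= j < k + L)%N : nat)%:R)%:E)%E.
  have [kj|kj] := leqP (k + L) j.
    by rewrite hind// lee_fin lerDl mulr_ge0.
  have [jk|jk] := leqP (j + L) k.
    under eq_integral do rewrite mulrC.
    by rewrite hind// lee_fin lerDl mulr_ge0.
  have -> : (k.+1 - L <= j)%N by lia.
  rewrite mulr1; apply: (@le_trans _ _ C%:E); last first.
    by rewrite lee_fin lerDr sqr_ge0.
  have m2 i : measurable_fun setT (fun w => (2^-1 * Y i w ^+ 2)%:E : \bar R).
    apply/measurable_EFinP; apply: measurable_funM => //; exact: measurable_funX.
  have i2 i : (\int[P]_w (2^-1 * Y i w ^+ 2)%:E <= (2^-1 * C)%:E)%E.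
    under eq_integral do rewrite EFinM.
    rewrite ge0_integralZl//; last 2 first.
    - by apply/measurable_EFinP; exact: measurable_funX.
    - by move=> w _; rewrite lee_fin sqr_ge0.
    by rewrite EFinM lee_wpmul2l.
  apply: (@le_trans _ _ (\int[P]_w ((2^-1 * Y k w ^+ 2)%:E + (2^-1 * Y j w ^+ 2)%:E))%E).
    apply: ge0_le_integral => //.
    - by move=> w _; rewrite lee_fin mulr_ge0.
    - by apply/measurable_EFinP; exact: measurable_funM.
    - by apply: emeasurable_funD; exact: m2.
    - move=> w _; rewrite -EFinD lee_fin; have := sqr_ge0 (Y k w - Y j w); lra.
  rewrite ge0_integralD//; try by move=> w _; rewrite lee_fin mulr_ge0 ?sqr_ge0.
  have -> : C%:E = ((2^-1 * C)%:E + (2^-1 * C)%:E)%E by rewrite -EFinD; congr EFin; field.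
  by apply: leeD.
pose S w := \sum_(k < n) Y k w.
have mS : measurable_fun setT S by exact: measurable_sum.
have S0 w : 0 <= S w by apply: sumr_ge0.
have ES : (\int[P]_w (S w)%:E = (n%:R * m)%:E)%E.
  rewrite /S; under eq_integral do rewrite -sumEFin.
  rewrite ge0_integral_sum//; last 2 first.
  - by move=> i; exact/measurable_EFinP.
  - by move=> i w _; rewrite lee_fin.
  under eq_bigr do rewrite hm.
  by rewrite sumEFin sumr_const card_ord mulr_natl.
have ES2 : (\int[P]_w (S w ^+ 2)%:E <= (n%:R * (n%:R * m ^+ 2 + C * (2 * L%:R)))%:E)%E.
  have E w : (S w ^+ 2)%:E = (\sum_(k < n) \sum_(j < n) (Y k w * Y j w)%:E)%E.
    rewrite /S expr2 mulr_suml -sumEFin; apply: eq_bigr => k _.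
    by rewrite mulr_sumr -sumEFin.
  under eq_integral do rewrite E.
  rewrite ge0_integral_sum//; last 2 first.
  - by move=> k; apply: emeasurable_sum => j; apply/measurable_EFinP; exact: measurable_funM.
  - by move=> k w _; apply: sume_ge0 => j _; rewrite lee_fin mulr_ge0.
  apply: (@le_trans _ _ (\sum_(k < n) (n%:R * m ^+ 2 + C * (2 * L%:R))%:E)%E); last first.
    by rewrite sumEFin sumr_const card_ord lee_fin [leRHS]mulr_natl.
  apply: lee_sum => k _.
  rewrite ge0_integral_sum//; last 2 first.
  - by move=> j; apply/measurable_EFinP; exact: measurable_funM.
  - by move=> j w _; rewrite lee_fin mulr_ge0.
  apply: (@le_trans _ _ (\sum_(j < n) (m ^+ 2 + C * ((k.+1 - L <= j < k + L)%N : nat)%:R)%:E)%E).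
    by apply: lee_sum => j _; exact: pair.
  rewrite sumEFin lee_fin big_split/= sumr_const card_ord mulr_natl lerD2l.
  rewrite -mulr_sumr ler_wpM2l// -natr_sum -natrM ler_nat.
  apply: (leq_trans (sum_window_le _ _ _)); lia.
have nm0 : 0 <= n%:R * m by rewrite mulr_ge0.
have mV : measurable_fun setT (fun w => ((S w - n%:R * m) ^+ 2)%:E : \bar R).
  by apply/measurable_EFinP; apply: measurable_funX; exact: measurable_funB.
have : (\int[P]_w ((S w - n%:R * m) ^+ 2)%:E + (2 * (n%:R * m) * (n%:R * m))%:E =
   \int[P]_w (S w ^+ 2)%:E + ((n%:R * m) ^+ 2)%:E)%E.
  transitivity (\int[P]_w (((S w - n%:R * m) ^+ 2)%:E + (2 * (n%:R * m) * S w)%:E))%E.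
    rewrite ge0_integralD//; last 3 first.
    - by move=> w _; rewrite lee_fin sqr_ge0.
    - by move=> w _; rewrite lee_fin !mulr_ge0.
    - by apply/measurable_EFinP; exact: measurable_funM.
    congr (_ + _)%E; under eq_integral do rewrite EFinM.
    rewrite ge0_integralZl//; last 3 first.
    - exact/measurable_EFinP.
    - by move=> w _; rewrite lee_fin.
    - by rewrite lee_fin !mulr_ge0.
    by rewrite ES.
  transitivity (\int[P]_w ((S w ^+ 2)%:E + ((n%:R * m) ^+ 2)%:E))%E.
    by apply: eq_integral => w _; rewrite -!EFinD; congr EFin; ring.
  rewrite ge0_integralD//; last 3 first.
  - by move=> w _; rewrite lee_fin sqr_ge0.
  - by apply/measurable_EFinP; exact: measurable_funX.
  - by move=> w _; rewrite lee_fin sqr_ge0.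
  rewrite integral_cst//; congr (_ + _)%E; rewrite -[RHS]mule1; congr (_ * _)%E.
  exact: probability_setT.
move=> key; rewrite -(leeD2rE (x := (2 * (n%:R * m) * (n%:R * m))%:E))//.
rewrite -/(S _) key; apply: (@le_trans _ _ ((n%:R * (n%:R * m ^+ 2 + C * (2 * L%:R)))%:E + ((n%:R * m) ^+ 2)%:E)%E).
  by rewrite leeD2r.
by rewrite -!EFinD lee_fin; lra.
Qed.

End Independence.

(** * From summable expectations to almost sure averages *)

Section MonotoneInterpolation.
Variable R : realType.

Lemma bounded_series_small (u : nat -> R) : (forall j, 0 <= u j) ->
  (exists K : R, forall n, \sum_(j < n) u j <= K) ->
  forall e : R, 0 < e -> exists N, forall j, (N <= j)%N -> u j <= e.
Proof.
move=> u0 [K hK] e e0.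
have cs : cvgn (series u).
  apply: nondecreasing_is_cvgn.
    by apply/nondecreasing_seqP => n; rewrite /series/= big_nat_recr//= lerDl.
  by exists K => _ [n _ <-]; rewrite /series/= big_mkord.
have /cvgrPdist_le /(_ e e0) [N _ hN] := cvg_series_cvg_0 cs.
exists N => j Nj; have /= := hN j Nj.
by rewrite sub0r normrN; apply: le_trans; exact: ler_norm.
Qed.

(** Partial sums of nonnegative terms are monotone, so their behaviour along
    the squares determines it everywhere: consecutive squares have ratio tending
    to [1]. *)
Lemma has_mean_of_squares (Y : nat -> R) (mu : R) : (forall k, 0 <= Y k) -> 0 <= mu ->
  (forall e : R, 0 < e -> exists N, forall j, (N <= j)%N ->
    ((\sum_(k < j.+1 ^ 2) Y k - (j.+1 ^ 2)%:R * mu) / (j.+1 ^ 2)%:R) ^+ 2 <= e) ->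
  has_mean Y mu.
Proof.
move=> Y0 mu0 hs e e0.
pose S n := \sum_(k < n) Y k.
have mS n p : (n <= p)%N -> S n <= S p.
  move=> /subnKC <-; rewrite /S big_split_ord/= lerDl; exact: sumr_ge0.
pose d : R := Num.min 1 (e / (mu + 2)).
have m2 : 0 < mu + 2 by lra.
have d0 : 0 < d by rewrite lt_min ltr01 divr_gt0.
have d1 : d <= 1 by rewrite ge_min lexx.
have de : d * (mu + 2) <= e by rewrite -ler_pdivlMr// ge_min lexx orbT.
have d2 : 0 < d ^+ 2 by exact: exprn_gt0.
have [N hN] := hs _ d2.
have key p : (N < p)%N -> `|S (p ^ 2)%N - p%:R ^+ 2 * mu| <= d * p%:R ^+ 2.
  case: p => // p; rewrite ltnS => /hN; rewrite -/(S _) natrX.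
  set q := p.+1%:R ^+ 2; have q0 : 0 < q by rewrite exprn_gt0// ltr0n.
  rewrite -real_normK ?num_real// ler_sqr ?nnegrE ?(ltW d0)//.
  by rewrite normrM normfV (gtr0_norm q0) ler_pdivrMr.
have di0 : 0 < d^-1 by rewrite invr_gt0.
exists (S (N.+2 ^ 2)%N + N.+2%:R ^+ 2 * mu + (mu + 1) * (d^-1 + 1)) => n.
have n0 : 0 <= n%:R :> R by [].
have S0 m : 0 <= S m by exact: sumr_ge0.
have C0 : 0 <= (mu + 1) * (d^-1 + 1) by rewrite mulr_ge0//; lra.
have A0 : 0 <= N.+2%:R ^+ 2 * mu by rewrite mulr_ge0// sqr_ge0.
have en : 0 <= e * n%:R by rewrite mulr_ge0// ltW.
rewrite -/(S n).
have [hn|hn] := leqP n (N.+2 ^ 2).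
  have nN : n%:R * mu <= N.+2%:R ^+ 2 * mu by rewrite ler_wpM2r// -natrX ler_nat.
  have := mS _ _ hn; have := S0 n; have : 0 <= n%:R * mu by rewrite mulr_ge0.
  by rewrite ler_norml => *; apply/andP; split; lra.
have /andP[] := truncn_itv (sqrtr_ge0 (n%:R : R)); set p := Num.truncn _ => p1 p2.
have p3 : p%:R ^+ 2 <= n%:R :> R.
  by rewrite -[leRHS]sqr_sqrtr// ler_sqr ?nnegrE ?sqrtr_ge0.
have p4 : n%:R < p.+1%:R ^+ 2 :> R.
  by rewrite -[ltLHS]sqr_sqrtr// ltr_sqr ?nnegrE ?sqrtr_ge0.
have Np : (N < p)%N.
  rewrite ltnNge; apply/negP => pN.
  have : p.+1%:R ^+ 2 <= N.+2%:R ^+ 2 :> R.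
    by rewrite ler_sqr ?nnegrE// ler_nat ltnS (leq_trans pN).
  have : N.+2%:R ^+ 2 < n%:R :> R by rewrite -natrX ltr_nat.
  lra.
have := mS (p ^ 2)%N n; rewrite -(ler_nat R) natrX => /(_ p3) s1.
have := mS n (p.+1 ^ 2)%N; rewrite -(ler_nat R) natrX => /(_ (ltW p4)) s2.
have := key _ Np; rewrite ler_norml => /andP[k1 _].
have := key p.+1 (ltnW Np); rewrite ler_norml => /andP[_ k2].
rewrite -natr1 in p4 k2.
have h2p : 2 * p%:R <= d * p%:R ^+ 2 + d^-1.
  have : 0 <= d * (p%:R - d^-1) ^+ 2 by rewrite mulr_ge0 ?sqr_ge0// ltW.
  have -> : d * (p%:R - d^-1) ^+ 2 = d * p%:R ^+ 2 - 2 * p%:R + d^-1 by field; lra.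
  lra.
have dp : d * p%:R ^+ 2 <= d * n%:R by rewrite ler_wpM2l// ltW.
have q1 : (p%:R + 1) ^+ 2 <= n%:R + d * n%:R + d^-1 + 1.
  have : (p%:R + 1) ^+ 2 = p%:R ^+ 2 + 2 * p%:R + 1 :> R by ring.
  lra.
have q2 : n%:R - d * n%:R - d^-1 - 1 <= p%:R ^+ 2.
  have : (p%:R + 1) ^+ 2 = p%:R ^+ 2 + 2 * p%:R + 1 :> R by ring.
  lra.
have md : 0 <= mu + d by lra.
have r1 := ler_wpM2l md q1.
have r2 := ler_wpM2r mu0 q2.
have r3 := ler_wpM2r n0 de.
have dn : d * (d * n%:R) <= d * n%:R by rewrite ler_piMl// mulr_ge0// ltW.
have dd : d * (d^-1 + 1) <= d^-1 + 1 by rewrite ler_piMl//; lra.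
have SN := S0 (N.+2 ^ 2)%N.
have mdi : 0 <= mu * d^-1 by rewrite mulr_ge0// ltW.
rewrite ler_norml; apply/andP; split; lra.
Qed.

Lemma sum_inv_squares n : \sum_(j < n) (j.+1%:R ^+ 2)^-1 <= 2 :> R.
Proof.
case: n => [|n]; first by rewrite big_ord0.
suff h : \sum_(j < n.+1) (j.+1%:R ^+ 2)^-1 <= 2 - n.+1%:R^-1 :> R.
  by apply: (le_trans h); rewrite gerBl invr_ge0.
elim: n => [|n IH]; first by rewrite big_ord1 expr1n invr1; lra.
rewrite big_ord_recr/=; apply: (le_trans (lerD IH (lexx _))).
rewrite -(natr1 n.+1); have : 0 < n.+1%:R :> R by rewrite ltr0n.
set x := n.+1%:R => x0.
have -> : 2 - x^-1 + ((x + 1) ^+ 2)^-1 = 2 - (x + 1)^-1 - (x * (x + 1) ^+ 2)^-1.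
  by field; lra.
by rewrite gerBl invr_ge0 mulr_ge0 ?sqr_ge0// ltW.
Qed.

Lemma sum_arith_geom (r : R) n : 0 <= r < 1 ->
  \sum_(N < n) N.+1%:R * r ^+ N <= (1 - r) ^- 2.
Proof.
move=> /andP[r0 r1]; have p : 0 < 1 - r by lra.
have p2 : 0 < (1 - r) ^+ 2 by exact: exprn_gt0.
rewrite -[leRHS]mul1r ler_pdivlMr//.
have -> : (\sum_(N < n) N.+1%:R * r ^+ N) * (1 - r) ^+ 2 =
    1 - n.+1%:R * r ^+ n + n%:R * r ^+ n.+1.
  elim: n => [|n IH]; first by rewrite big_ord0; ring.
  rewrite big_ord_recr/= mulrDl IH !exprS -(natr1 n.+1) -(natr1 n); ring.
have : n%:R * r ^+ n.+1 <= n.+1%:R * r ^+ n.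
  apply: ler_pM; rewrite ?exprn_ge0// ?ler_nat// exprS.
  by rewrite ler_piMl ?exprn_ge0// ltW.
lra.
Qed.

End MonotoneInterpolation.

(** * Almost sure properties of Brownian paths *)

Section AlmostSure.
Context {d : measure_display} {Omega : measurableType d} {R : realType}.
Variable P : probability Omega R.

(** The sum of the series has finite expectation, hence is finite almost
    surely. *)
Lemma ae_bounded_series (Z : nat -> Omega -> R) (c : nat -> R) (C : R) :
  (forall j, measurable_fun setT (Z j)) -> (forall j w, 0 <= Z j w) ->
  (forall j, \int[P]_w (Z j w)%:E <= (c j)%:E)%E ->
  (forall n, \sum_(j < n) c j <= C) ->
  {ae P, forall w, exists K : R, forall n, \sum_(j < n) Z j w <= K}.
Proof.
move=> mZ Z0 hc hC.
pose G w := (\sum_(j <oo) (Z j w)%:E)%E.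
have mZE j : measurable_fun setT (fun w => (Z j w)%:E : \bar R).
  exact/measurable_EFinP.
have G0 w : (0 <= G w)%E by apply: nneseries_ge0 => j _ _; rewrite lee_fin.
have iG : (\int[P]_w G w <= C%:E)%E.
  rewrite integral_nneseries//; last by move=> j w _; rewrite lee_fin.
  apply: lime_le.
    by apply: is_cvg_nneseries => j _ _; apply: integral_ge0 => w _; rewrite lee_fin.
  apply: nearW => n; rewrite big_mkord.
  apply: (@le_trans _ _ (\sum_(j < n) (c j)%:E)%E); first exact: lee_sum.
  by rewrite sumEFin lee_fin.
have mG : measurable_fun setT G.
  by apply: ge0_emeasurable_sum => // j w _ _; rewrite lee_fin.
have /integrable_ae : P.-integrable setT G.
  apply/integrableP; split => //.
  under eq_integral do rewrite gee0_abs//.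
  by rewrite (le_lt_trans iG)// ltry.
move=> /(_ measurableT); apply: filterS => w /(_ I) Gfin.
exists (fine (G w)) => n; rewrite -lee_fin fineK// -sumEFin -(big_mkord xpredT (fun j => (Z j w)%:E)).
by apply: nneseries_lim_ge => j _; rewrite lee_fin.
Qed.

(** Summing along the antidiagonals [m + k = N] makes the threshold [k0] valid
    for all [m] at once. *)
Lemma ae_double_family (Z : nat -> nat -> Omega -> R) (c r : R) :
  0 <= r < 1 -> 0 <= c ->
  (forall m k, measurable_fun setT (Z m k)) -> (forall m k w, 0 <= Z m k w) ->
  (forall m k, \int[P]_w (Z m k w)%:E <= (c * r ^+ (m + k))%:E)%E ->
  {ae P, forall w, exists k0, forall k, (k0 <= k)%N -> forall m, Z m k w <= 1}.
Proof.
move=> r01 c0 mZ Z0 hZ.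
pose Y N w := \sum_(m < N.+1) Z m (N - m)%N w.
have Y0 N w : 0 <= Y N w by exact: sumr_ge0.
have hY N : (\int[P]_w (Y N w)%:E <= (c * (N.+1%:R * r ^+ N))%:E)%E.
  rewrite /Y; under eq_integral do rewrite -sumEFin.
  rewrite ge0_integral_sum//; last 2 first.
  - by move=> m; exact/measurable_EFinP.
  - by move=> m w _; rewrite lee_fin.
  apply: (@le_trans _ _ (\sum_(m < N.+1) (c * r ^+ N)%:E)%E).
    by apply: lee_sum => m _; have := hZ m (N - m)%N; rewrite subnKC// -ltnS.
  by rewrite sumEFin sumr_const card_ord lee_fin -[leLHS]mulr_natl mulrCA.
have hC n : \sum_(N < n) c * (N.+1%:R * r ^+ N) <= c * (1 - r) ^- 2.
  by rewrite -mulr_sumr ler_wpM2l// sum_arith_geom.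
have mY N : measurable_fun setT (Y N) by exact: measurable_sum.
have := ae_bounded_series mY Y0 hY hC.
apply: filterS => w hw.
have [k0 h0] := bounded_series_small (fun N => Y0 N w) hw ltr01.
exists k0 => k k0k m; apply: le_trans (h0 (m + k)%N (leq_trans k0k (leq_addl _ _))).
have mlt : (m < (m + k).+1)%N by rewrite ltnS leq_addr.
by rewrite /Y (bigD1 (Ordinal mlt))//= addKn lerDl; exact: sumr_ge0.
Qed.

Variable W : R -> {RV P >-> R}.
Hypothesis hW : brownian_motion W.

Let mincr s t : measurable_fun setT (W t \- W s).
Proof. exact: measurable_funB. Qed.

Definition increment s t : {RV P >-> R} :=
  HB.pack (W t \- W s) (isMeasurableFun.Build _ _ _ _ _ (mincr s t)).

Lemma integral_increment (f : R -> R) s t : 0 <= s -> s < t ->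
  measurable_fun setT f -> (forall x, 0 <= f x) ->
  (\int[P]_w (f (W t w - W s w))%:E = \int[normal_prob 0 (Num.sqrt (t - s))]_x (f x)%:E)%E.
Proof.
move=> s0 st mf f0; have [_ _ hN _] := hW.
(* [normal_prob] lives on the Borel sets presented as a generated
   sigma-algebra, so the increment is repackaged with that codomain. *)
have mI : @measurable_fun _ _ Omega (measurableTypeR R) setT (fun w => W t w - W s w).
  exact: mincr.
pose I := @MeasurableFun.Pack _ _ Omega (measurableTypeR R) (fun w => W t w - W s w)
  (@MeasurableFun.Class _ _ Omega (measurableTypeR R) _ (isMeasurableFun.Build _ _ _ _ _ mI)).
have mfE : @measurable_fun _ _ (measurableTypeR R) (\bar R) setT (EFin \o f).
  exact/measurable_EFinP.
have f0E (x : measurableTypeR R) : (0 <= (EFin \o f) x)%E by rewrite lee_fin.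
transitivity (\int[distribution P I]_x (EFin \o f) x)%E.
  by rewrite ge0_integral_distribution.
apply: eq_measure_integral => A mA _.
exact: hN.
Qed.

Lemma increment_second_moment s t : 0 <= s -> s < t ->
  (\int[P]_w ((W t w - W s w) ^+ 2)%:E = (t - s)%:E)%E.
Proof.
move=> s0 st; have ts : 0 < t - s by lra.
rewrite (integral_increment (f := fun x => x ^+ 2))//; last by move=> x; exact: sqr_ge0.
by rewrite normal_second_moment ?sqrtr_gt0// sqr_sqrtr// ltW.
Qed.

Lemma increment_fourth_moment s t : 0 <= s -> s < t ->
  (\int[P]_w ((W t w - W s w) ^+ 4)%:E <= (64 * (t - s) ^+ 2)%:E)%E.
Proof.
move=> s0 st; have ts : 0 < t - s by lra.
rewrite (integral_increment (f := fun x => x ^+ 4))//; last first.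
  by move=> x; rewrite (_ : 4%N = (2 * 2)%N)// exprM sqr_ge0.
have sq0 : 0 < Num.sqrt (t - s) by rewrite sqrtr_gt0.
have := normal_fourth_moment sq0.
by rewrite [in X in (_ <= X)%E -> _](_ : 4%N = (2 * 2)%N)// exprM sqr_sqrtr// ltW.
Qed.

Lemma increment_indep s1 t1 s2 t2 : 0 <= s1 -> s1 <= t1 -> t1 <= s2 -> s2 <= t2 ->
  forall A B, measurable A -> measurable B ->
  P (increment s1 t1 @^-1` A `&` increment s2 t2 @^-1` B) =
  (P (increment s1 t1 @^-1` A) * P (increment s2 t2 @^-1` B))%E.
Proof.
move=> s10 st1 ts st2 A B mA mB; have [_ hI _ _] := hW.
pose t i := nth t2 [:: s1; t1; s2] i.
have ht : {homo t : i j / (i <= j)%N >-> i <= j}.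
  apply: homo_leq => [x|y x z|i]; [exact: lexx|exact: le_trans|].
  by case: i => [|[|[|i]]]; rewrite /t/= ?nth_nil ?lexx.
pose AB (i : 'I_3) : set R := nth setT [:: A; setT; B] i.
have mAB i : measurable (AB i).
  by case: i => -[|[|[|i]]] Hi //; rewrite /AB/=; exact: measurableT.
have := hI 3%N t s10 ht AB mAB.
rewrite !big_ord_recl big_ord0 /= /bump/= /AB/=.
rewrite mule1 preimage_setT.
have -> : P setT = 1%E by exact: probability_setT.
rewrite mul1e => <-; congr (P _).
apply/seteqP; split => w /=.
  move=> [wA wB] i _; case: i => -[|[|[|]]]//=.
move=> h; split.
  exact: (h (@Ordinal 3 0 isT) I).
exact: (h (@Ordinal 3 2 isT) I).
Qed.

Let msh m : R := mesh R m.
Let gr m k w : R := W (k%:R * msh m) w.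

Let gr0 m k : 0 <= k%:R * msh m.
Proof. by rewrite mulr_ge0// ltW// mesh_gt0. Qed.

Let gr_lt m k L : (0 < L)%N -> k%:R * msh m < (k + L)%:R * msh m.
Proof. by move=> L0; rewrite ltr_pM2r ?mesh_gt0// ltr_nat -{1}(addn0 k) ltn_add2l. Qed.

Let gr_le m k j : (k <= j)%N -> k%:R * msh m <= j%:R * msh m.
Proof. by move=> L0; rewrite ler_pM2r ?mesh_gt0// ler_nat. Qed.

Let mgr m k L : measurable_fun setT (fun w => (gr m (k + L) w - gr m k w) ^+ 2).
Proof. by apply: measurable_funX; exact: mincr. Qed.

(** Increments over [L] steps whose starting points are at least [L] steps
    apart are independent. *)
Lemma structure_variance m L n : (0 < L)%N ->
  (\int[P]_w ((\sum_(k < n) (gr m (k + L) w - gr m k w) ^+ 2 - n%:R * (L%:R * msh m)) ^+ 2)%:E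
    <= (2 * L%:R * (64 * (L%:R * msh m) ^+ 2) * n%:R)%:E)%E.
Proof.
move=> L0.
have len k : (k + L)%:R * msh m - k%:R * msh m = L%:R * msh m.
  by rewrite natrD; ring.
have Lm0 : 0 <= L%:R * msh m by rewrite mulr_ge0// ltW// mesh_gt0.
apply: (variance_sum_le (Y := fun k w => (gr m (k + L) w - gr m k w) ^+ 2)) => //.
- by move=> k w; exact: sqr_ge0.
- by rewrite mulr_ge0// sqr_ge0.
- by move=> k; rewrite /gr increment_second_moment ?gr_lt// len.
- move=> k; have := increment_fourth_moment (gr0 m k) (gr_lt m k L0); rewrite len.
  by under eq_integral do rewrite (_ : 4%N = (2 * 2)%N)// exprM.
- move=> k j kj.
  have ind := @increment_indep (k%:R * msh m) ((k + L)%:R * msh m) (j%:R * msh m)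
    ((j + L)%:R * msh m) (gr0 m k) (ltW (gr_lt m k L0)) (gr_le m kj) (ltW (gr_lt m j L0)).
  have := integral_prod_indep (f := fun x => x ^+ 2) (g := fun x => x ^+ 2) ind.
  rewrite /= => -> //; try exact: exprn_measurable; try by move=> x; exact: sqr_ge0.
  by rewrite !increment_second_moment ?gr_lt// !len -EFinM expr2.
Qed.

(** The variance bound is summable along the squares [n = (j + 1) ^ 2]. *)
Lemma ae_structure : {ae P, forall w, forall m L,
  has_mean (fun k => (gr m (k + L) w - gr m k w) ^+ 2) (L%:R * mesh R m)}.
Proof.
apply: ae_foralln => m; apply: ae_foralln => L.
case: L => [|L].
  apply: aeW => w; rewrite mul0r; apply: eq_has_mean (@has_mean0 R) => k.
  by rewrite addn0 subrr expr0n.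
set mu := L.+1%:R * mesh R m.
pose Y k w := (gr m (k + L.+1) w - gr m k w) ^+ 2.
pose q (j : nat) : R := (j.+1 ^ 2)%:R.
pose Z j w := ((\sum_(k < j.+1 ^ 2) Y k w - q j * mu) / q j) ^+ 2.
pose c : R := 2 * L.+1%:R * (64 * (L.+1%:R * msh m) ^+ 2).
have c0 : 0 <= c by apply: mulr_ge0 => //; apply: mulr_ge0 => //; exact: sqr_ge0.
have q0 j : 0 < q j by rewrite ltr0n expn_gt0.
have mS j : measurable_fun setT (fun w => \sum_(k < j.+1 ^ 2) Y k w - q j * mu).
  by apply: measurable_funB => //; apply: measurable_sum => k; exact: mgr.
have mZ j : measurable_fun setT (Z j).
  by apply: measurable_funX; apply: measurable_funM.
have hZ j : (\int[P]_w (Z j w)%:E <= (c * (j.+1%:R ^+ 2)^-1)%:E)%E.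
  have E w : (Z j w)%:E = ((q j ^- 2)%:E * ((\sum_(k < j.+1 ^ 2) Y k w - q j * mu) ^+ 2)%:E)%E.
    by rewrite -EFinM /Z exprMn mulrC exprVn.
  under eq_integral do rewrite E.
  rewrite ge0_integralZl//; last 3 first.
  - by apply/measurable_EFinP; exact: measurable_funX.
  - by move=> w _; rewrite lee_fin sqr_ge0.
  - by rewrite lee_fin invr_ge0 sqr_ge0.
  have q2 : 0 <= q j ^- 2 by rewrite invr_ge0 sqr_ge0.
  have := lee_wpmul2l (_ : (0 <= (q j ^- 2)%:E)%E) (structure_variance m (j.+1 ^ 2) (ltn0Sn L)).
  rewrite lee_fin => /(_ q2) /le_trans; apply.
  rewrite -EFinM lee_fin -/c -/(q j) mulrCA ler_wpM2l//.
  rewrite /q natrX; set x := j.+1%:R; have x0 : 0 < x :> R by rewrite ltr0n.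
  by rewrite le_eqVlt; apply/orP; left; apply/eqP; field; lra.
have hC n : \sum_(j < n) c * (j.+1%:R ^+ 2)^-1 <= c * 2.
  by rewrite -mulr_sumr ler_wpM2l// sum_inv_squares.
have := @ae_bounded_series Z _ _ mZ (fun j w => sqr_ge0 _) hZ hC.
apply: filterS => w hw; apply: has_mean_of_squares => [k||e e0].
- exact: sqr_ge0.
- by rewrite mulr_ge0// ltW// mesh_gt0.
exact: (bounded_series_small (fun j => sqr_ge0 _) hw e0).
Qed.

(** The variance of the quadratic variation at level [m] over [0, 2 ^ k] is of
    order [2 ^ (k - m)], so Chebyshev's bound [2 ^ - (m + k)] is summable over
    both indices. *)
Lemma ae_quadratic_variation : {ae P, forall w, exists k0, forall k, (k0 <= k)%N ->
  forall m, \sum_(i < 2 ^ (m + k)) (gr m i.+1 w - gr m i w) ^+ 2 <= 2 * 2 ^+ k}.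
Proof.
pose S m k w := \sum_(i < 2 ^ (m + k)) (gr m i.+1 w - gr m i w) ^+ 2.
pose Z m k w := ((S m k w - 2 ^+ k) / 2 ^+ k) ^+ 2.
have mS m k : measurable_fun setT (fun w => S m k w - 2 ^+ k).
  apply: measurable_funB => //; apply: measurable_sum => i.
  by apply: measurable_funX; exact: mincr.
have half01 : 0 <= (2^-1 : R) < 1 by lra.
have c0 : 0 <= (128 : R) by [].
have p0 k : 0 < 2 ^+ k :> R by exact: exprn_gt0.
have hZ m k : (\int[P]_w (Z m k w)%:E <= (128 * 2^-1 ^+ (m + k))%:E)%E.
  have E w : (Z m k w)%:E = ((2 ^+ k ^- 2)%:E * ((S m k w - 2 ^+ k) ^+ 2)%:E)%E.
    by rewrite -EFinM /Z exprMn mulrC exprVn.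
  under eq_integral do rewrite E.
  rewrite ge0_integralZl//; last 2 first.
  - by apply/measurable_EFinP; exact: measurable_funX.
  - by move=> w _; rewrite lee_fin sqr_ge0.
  have q2 : 0 <= 2 ^+ k ^- 2 :> R by rewrite invr_ge0 sqr_ge0.
  have := lee_wpmul2l (_ : (0 <= (2 ^+ k ^- 2)%:E)%E) (structure_variance m (2 ^ (m + k)) (ltn0Sn 0)).
  rewrite lee_fin => /(_ q2).
  have -> : (2 ^ (m + k))%:R * (1 * msh m) = 2 ^+ k :> R.
    by rewrite mul1r natrX exprD mulrAC mesh_exp mul1r.
  have -> : (fun w => ((\sum_(i < 2 ^ (m + k)) (gr m (i + 1) w - gr m i w) ^+ 2 - 2 ^+ k) ^+ 2)%:E) =
     (fun w => ((S m k w - 2 ^+ k) ^+ 2)%:E).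
    apply/funext => w; congr ((_ - _) ^+ 2)%:E.
    by apply: eq_bigr => i _; rewrite addn1.
  move=> /le_trans; apply.
  rewrite -EFinM lee_fin natrX /msh /mesh exprVn exprD.
  have := p0 m; have := p0 k; set x := 2 ^+ m; set y := 2 ^+ k => y0 x0.
  by rewrite le_eqVlt; apply/orP; left; apply/eqP; field; lra.
have mZ m k : measurable_fun setT (Z m k).
  by apply: measurable_funX; apply: measurable_funM.
have := ae_double_family half01 c0 mZ (fun m k w => sqr_ge0 _) hZ.
apply: filterS => w [k0 h]; exists k0 => k /h {}h m.
have := h m; rewrite /Z -[X in _ <= X](expr1n _ 2) -real_normK ?num_real//.
rewrite ler_sqr ?nnegrE// normrM normfV (gtr0_norm (p0 k)) ler_pdivrMr// mul1r.
by move=> /(le_trans (ler_norm _)); rewrite /S; lra.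
Qed.

(** Each increment is bounded by the sum of their fourth powers, to which
    Markov's inequality applies. *)
Lemma ae_increments : {ae P, forall w, exists k0, forall k, (k0 <= k)%N ->
  forall m i, (i < 2 ^ (m + k))%N ->
    (gr m i.+1 w - gr m i w) ^+ 2 <= 2 ^+ k * ((9 / 10) ^+ (k + m)) ^+ 2}.
Proof.
pose q : R := 9 / 10.
have q0 : 0 < q by rewrite /q; lra.
pose D m k : R := (2 ^+ k * (q ^+ (k + m)) ^+ 2) ^+ 2.
have D0 m k : 0 < D m k by rewrite exprn_gt0// mulr_gt0// ?exprn_gt0// exprn_gt0.
pose S m k w := \sum_(i < 2 ^ (m + k)) (gr m i.+1 w - gr m i w) ^+ 4.
have x4 (x : R) : 0 <= x ^+ 4 by rewrite (_ : 4%N = (2 * 2)%N)// exprM sqr_ge0.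
have mI m i : measurable_fun setT (fun w => (gr m i.+1 w - gr m i w) ^+ 4).
  by apply: measurable_funX; exact: mincr.
have mS m k : measurable_fun setT (S m k) by exact: measurable_sum.
have hS m k : (\int[P]_w (S m k w)%:E <= (2 ^+ (m + k) * (64 * msh m ^+ 2))%:E)%E.
  rewrite /S; under eq_integral do rewrite -sumEFin.
  rewrite ge0_integral_sum//; last 2 first.
  - by move=> i; exact/measurable_EFinP.
  - by move=> i w _; rewrite lee_fin.
  apply: (@le_trans _ _ (\sum_(i < 2 ^ (m + k)) (64 * msh m ^+ 2)%:E)%E).
    apply: lee_sum => i _.
    have := increment_fourth_moment (gr0 m i) (gr_lt m i (ltn0Sn 0)).
    have -> : (i + 1)%:R * msh m - i%:R * msh m = msh m by rewrite natrD; ring.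
    by rewrite addn1.
  by rewrite sumEFin sumr_const card_ord lee_fin -natrX [leRHS]mulr_natl.
pose r : R := (2 * q ^+ 4)^-1.
have r01 : 0 <= r < 1.
  have : 1 < 2 * q ^+ 4 by rewrite /q; lra.
  by move=> h; rewrite invr_ge0 invf_lt1 ?h//; lra.
have c0 : 0 <= (64 : R) by [].
pose Z m k w := (D m k)^-1 * S m k w.
have S0 m k w : 0 <= S m k w by exact: sumr_ge0.
have Z0 m k w : 0 <= Z m k w by rewrite mulr_ge0// invr_ge0 ltW.
have mZ m k : measurable_fun setT (Z m k) by exact: measurable_funM.
have hZ m k : (\int[P]_w (Z m k w)%:E <= (64 * r ^+ (m + k))%:E)%E.
  rewrite /Z; under eq_integral do rewrite EFinM.
  have Di : 0 <= (D m k)^-1 by rewrite invr_ge0 ltW.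
  rewrite ge0_integralZl//; last 2 first.
  - exact/measurable_EFinP.
  - by move=> w _; rewrite lee_fin.
  have := lee_wpmul2l (_ : (0 <= ((D m k)^-1)%:E)%E) (hS m k).
  rewrite lee_fin => /(_ Di) /le_trans; apply.
  have -> : r ^+ (m + k) = (2 ^+ m * 2 ^+ k * (q ^+ (k + m)) ^+ 4)^-1.
    by rewrite /r exprVn exprMn exprD exprAC addnC.
  rewrite -EFinM lee_fin /D /msh /mesh (exprD _ m k).
  have p0 j : 0 < 2 ^+ j :> R by exact: exprn_gt0.
  have := p0 m; have := p0 k; have : 0 < q ^+ (k + m) by exact: exprn_gt0.
  set x := 2 ^+ m; set y := 2 ^+ k; set z := q ^+ (k + m) => z0 y0 x0.
  by rewrite le_eqVlt; apply/orP; left; apply/eqP; field; lra.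
have := ae_double_family r01 c0 mZ Z0 hZ.
apply: filterS => w [k0 h]; exists k0 => k /h {}h m i im.
have := h m; rewrite /Z mulrC ler_pdivrMr// mul1r => hD.
have hi : (gr m i.+1 w - gr m i w) ^+ 4 <= D m k.
  apply: le_trans hD; rewrite /S (bigD1 (Ordinal im))//= lerDl; exact: sumr_ge0.
move: hi; rewrite (_ : 4%N = (2 * 2)%N)// exprM /D ler_sqr ?nnegrE ?sqr_ge0//.
by rewrite mulr_ge0 ?sqr_ge0// exprn_ge0.
Qed.

Lemma ae_brownian_like :
  {ae P, forall w, brownian_like (fun t : R => W (Num.max 0 t) w)}.
Proof.
have [h0 _ _ hc] := hW.
have grE w m k : grid (fun t : R => W (Num.max 0 t) w) m k = gr m k w.
  by rewrite /grid max_r// gr0.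
suff hS : {ae P, forall w, W 0 w = 0 ->
    {within `[0, +oo[, continuous (fun t => W t w)} ->
    brownian_like (fun t : R => W (Num.max 0 t) w)}.
  by move: h0 hc hS; apply: filterS3 => w a b; apply.
move: ae_structure ae_quadratic_variation ae_increments.
apply: filterS3 => w hs hq hi w0 cw.
have cw' := continuous_max0 cw.
split => //.
- by rewrite maxxx.
- by move=> m L; apply: eq_has_mean (hs m L) => k; rewrite !grE.
- have [k0 h] := hq; exists k0 => k /h {}h m.
  by apply: le_trans (h m); rewrite /incr; under eq_bigr do rewrite !grE.
- apply: oscillation_from_increments => //.
  have [k0 h] := hi; exists k0 => k /h {}h m i /h.
  by rewrite /incr !grE.
Qed.

End AlmostSure.

(** * The theorem *)

Section Extension.
Variable R : realType.
Implicit Types (x z : R -> R) (T : R).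

Lemma max0_restrict x t : 0 <= t -> x (Num.max 0 t) = x t.
Proof. by move=> t0; rewrite max_r. Qed.

Lemma eq_integral_max0 x T :
  integral_on (fun t => x (Num.max 0 t)) 0 T = integral_on x 0 T.
Proof. by apply: eq_integral_on => t /andP[t0 _]; rewrite max0_restrict. Qed.

Lemma theta_hat_max0 x T : 0 <= T ->
  theta_hat (fun t => x (Num.max 0 t)) T = theta_hat x T.
Proof.
move=> T0; rewrite /theta_hat /time_integral max0_restrict//.
by rewrite -/(integral_on _ 0 T) (eq_integral_max0 (fun t => x t ^+ 2)).
Qed.

Lemma rho_hat_max0 x T : 0 <= T ->
  rho_hat (fun t => x (Num.max 0 t)) T = rho_hat x T.
Proof.
move=> T0.
have VE t : 0 <= t -> V_hat (fun t => x (Num.max 0 t)) T t = V_hat x T t.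
  move=> t0; rewrite /V_hat theta_hat_max0// max0_restrict//.
  by congr (_ - _ * _); exact: eq_integral_max0.
rewrite /rho_hat VE//; congr (_ / (2 * _)).
by apply: eq_integral_on => t /andP[t0 _]; rewrite VE.
Qed.

Lemma ou_path_of_sde a z x : z 0 = 0 -> x 0 = 0 ->
  (forall t, 0 <= t -> x t - x 0 = a * time_integral x t + (z t - z 0)) ->
  ou_path a (fun t => z (Num.max 0 t)) (fun t => x (Num.max 0 t)).
Proof.
move=> z0 x0 h t t0; rewrite !max0_restrict// eq_integral_max0.
by have := h t t0; rewrite x0 z0 !subr0.
Qed.

End Extension.

Lemma ae_and (d : measure_display) (Omega : measurableType d) (R : realType)
    (P : probability Omega R) (A B : Omega -> Prop) :
  {ae P, forall w, A w} -> {ae P, forall w, B w} -> {ae P, forall w, A w /\ B w}.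
Proof. by apply: filterS2. Qed.

Theorem theorem3p1 (d : measure_display) (Omega : measurableType d)
    (R : realType) (P : probability Omega R) (theta rho : R)
    (W X V : R -> {RV P >-> R}) :
  theta < 0 -> rho <= 0 ->
  brownian_motion W ->
  linear_sde_solution theta V X ->
  linear_sde_solution rho W V ->
  {ae P, forall w : Omega,
    (theta_hat (fun t => X t w) T @[T --> +oo] --> theta + rho) /\
    (rho_hat (fun t => X t w) T @[T --> +oo] -->
       theta * rho * (theta + rho) / ((theta + rho) ^+ 2 + theta * rho))}.
Proof.
move=> theta0 rho0 hW [cX X0 hX] [cV V0 hV].
have [W0 _ _ _] := hW; have hB := ae_brownian_like hW.
have := ae_and (ae_and W0 (ae_and V0 X0)) (ae_and hB (ae_and (ae_and cV cX) (ae_and hV hX))).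
apply: filterS => w [[w0 [v0 x0]] [bw [[cv cx] [hv hx]]]].
have [h1 h2] := estimators_cvg theta0 rho0 bw (continuous_max0 cv) (continuous_max0 cx)
  (ou_path_of_sde w0 v0 hv) (ou_path_of_sde v0 x0 hx).
split.
- apply: cvg_trans h1; apply: near_eq_cvg; near=> T.
  by apply: (theta_hat_max0 (fun t => X t w)); apply: ltW; near: T; exact: near_pinfty_gt0.
- apply: cvg_trans h2; apply: near_eq_cvg; near=> T.
  by apply: (rho_hat_max0 (fun t => X t w)); apply: ltW; near: T; exact: near_pinfty_gt0.
Unshelve. all: by end_near. Qed.
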